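(* Let $n\ge 1$, let $Q,B\in M_n(\mathbb{R})$ with $Q$ symmetric positive definite, and let $P=\frac12\mathrm{Tr}(Q\nabla_x^2)+\langle Bx,\nabla_x\rangle$, $x\in\mathbb{R}^n$, be the corresponding (elliptic) Ornstein-Uhlenbeck operator. Assume that $P$ admits an invariant measure $d\mu(x)=\rho(x)\,dx$ and that $[Q_\infty^{-1}Q,B^T]\neq 0$ (which implies that $P$ is non-normal on $L^2_\mu$). Set $$m_-=\inf_{(x,\xi)\in\mathcal{B}}\Big\langle\Big(-\tfrac12QQ_\infty^{-1}-B\Big)x,\xi\Big\rangle,\qquad m_+=\sup_{(x,\xi)\in\mathcal{B}}\Big\langle\Big(-\tfrac12QQ_\infty^{-1}-B\Big)x,\xi\Big\rangle,$$ with $$\mathcal{B}=\Big\{(x,\xi)\in\mathbb{R}^{2n}:\ \tfrac12|Q^{1/2}\xi|^2+\tfrac18|Q^{1/2}Q_\infty^{-1}x|^2=1\Big\}.$$ Then for all real $\lambda$ with $m_-<\lambda<m_+$ and all $N\in\mathbb{N}$, $$\lim_{t\to+\infty}\frac{\big\|\big(P+\frac12\mathrm{Tr}(B)+t(1+i\lambda)\big)^{-1}\big\|_{\mathcal{L}(L^2_\mu)}}{t^N}=+\infty .$$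
   Context: Notation: $\mathrm{Tr}(Q\nabla_x^2)=\sum_{i,j}q_{i,j}\partial^2_{x_i,x_j}$ and $\langle Bx,\nabla_x\rangle=\sum_{i,j}b_{i,j}x_j\partial_{x_i}$. $[X,Y]=XY-YX$ for matrices. Invariant measure: $P$ generates the Markov semigroup $(T(t)f)(x)=\frac{1}{(2\pi)^{n/2}\sqrt{\det Q_t}}\int_{\mathbb{R}^n}e^{-\frac12\langle Q_t^{-1}y,y\rangle}f(e^{tB}x-y)\,dy$, $t>0$, where $Q_t=\int_0^te^{sB}Qe^{sB^T}ds$; an invariant measure is a probability measure $\mu$ with $\int T(t)f\,d\mu=\int f\,d\mu$ for all $t\ge0$ and all bounded continuous $f$. It is known that existence of an invariant measure is equivalent to $\sigma(B)\subset\{z\in\mathbb{C}:\mathrm{Re}\,z<0\}$, and then it is unique and given by $d\mu=\rho\,dx$ with $\rho(x)=\frac{1}{(2\pi)^{n/2}\sqrt{\det Q_\infty}}e^{-\frac12\langle Q_\infty^{-1}x,x\rangle}$, $Q_\infty=\int_0^{+\infty}e^{sB}Qe^{sB^T}ds$ (symmetric positive definite). $L^2_\mu=L^2(\mathbb{R}^n,d\mu)$ (complex valued functions). $P$ is regarded as the unbounded operator on $L^2_\mu$ with maximal domain $D(P)=\{u\in L^2_\mu: Pu\in L^2_\mu\}$. $\|\cdot\|_{\mathcal{L}(L^2_\mu)}$ is the operator norm of bounded operators on $L^2_\mu$, with the convention $\|(P-z)^{-1}\|=+\infty$ if $z\in\sigma(P)$. Normality of a closed operator $A$ means that the resolvents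 $(A-z)^{-1}$ and $(A^*-\zeta)^{-1}$ commute for all $z\notin\sigma(A)$, $\zeta\notin\sigma(A^* )$. $\mathbb{N}$ is the set of non-negative integers. *)

(* Defs.v *)
From HB Require Import structures.
From mathcomp Require Import all_boot all_order all_algebra.
From mathcomp Require Import all_classical all_reals all_analysis.
From mathcomp Require Import complex.

Set Implicit Arguments.
Unset Strict Implicit.
Unset Printing Implicit Defensive.

Import Order.TTheory GRing.Theory Num.Theory.
Import numFieldNormedType.Exports.

Local Open Scope classical_set_scope.
Local Open Scope ring_scope.
Local Open Scope complex_scope.

(* R^n is 'cV[R]_n, with the sigma-algebra generated by the coordinates
   (i.e., the Borel one). *)

Definition cV_display : measure_display -> measure_display.
Proof. exact. Qed.

Section measurable_cV.
Context {d} {T : measurableType d} (n : nat).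

Let coords : 'I_n -> 'cV[T]_n -> T := fun i x => x i 0.

Let cV_set0 : g_sigma_preimage coords set0.
Proof. exact: sigma_algebra0. Qed.

Let cV_setC A : g_sigma_preimage coords A -> g_sigma_preimage coords (~` A).
Proof. exact: sigma_algebraC. Qed.

Let cV_bigcup (F : (set 'cV[T]_n)^nat) : (forall i, g_sigma_preimage coords (F i)) ->
  g_sigma_preimage coords (\bigcup_i (F i)).
Proof. exact: sigma_algebra_bigcup. Qed.

HB.instance Definition _ := @isMeasurable.Build (cV_display d)
  'cV[T]_n (g_sigma_preimage coords) cV_set0 cV_setC cV_bigcup.

End measurable_cV.

Lemma measurable_fun_cVP d1 d2 (T1 : measurableType d1) (T2 : measurableType d2)
    n (f : T1 -> 'cV[T2]_n) :
  measurable_fun setT f <-> forall i, measurable_fun setT (fun x => f x i 0).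
Proof.
split=> [mf i|mf].
  apply: (@measurableT_comp _ _ _ _ _ _ (fun x : 'cV[T2]_n => x i 0)) => //.
  move=> _ Y mY; rewrite setTI; apply: sub_sigma_algebra => /=.
  rewrite -bigcup_seq/=; exists i => /=; first by rewrite mem_index_enum.
  by exists Y => //; rewrite setTI.
move=> _ A mA.
rewrite setTI.
suff : measurable `<=` [set A : set 'cV[T2]_n | measurable (f @^-1` A)] by exact.
apply: smallest_sub => [|{mA}A].
  split=> [|{mA}A /= mA|F /= mF].
  - by rewrite /= preimage_set0.
  - by rewrite setTD -preimage_setC; exact: measurableC.
  - by rewrite preimage_bigcup; exact: bigcup_measurable.
rewrite -bigcup_seq => -[i /= _ [Y mY <-]].
rewrite setTI; have := mf i measurableT Y mY.
by rewrite setTI.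
Qed.

Section lebesgue_cV.
Context {R : realType}.
Implicit Types n : nat.

Definition cV_cons n (p : measurableTypeR R * 'cV[R]_n) : 'cV[R]_n.+1 :=
  \col_i oapp (fun j => p.2 j 0) p.1 (unlift ord0 i).

Definition cV_uncons n (x : 'cV[R]_n.+1) : measurableTypeR R * 'cV[R]_n :=
  (x ord0 0, \col_i x (lift ord0 i) 0).

Lemma cV_consK n : cancel (@cV_cons n) (@cV_uncons n).
Proof.
case=> a x; congr pair; rewrite ?mxE ?unlift_none//.
by apply/matrixP => i j; rewrite !mxE liftK/= (ord1 j).
Qed.

Lemma cV_unconsK n : cancel (@cV_uncons n) (@cV_cons n).
Proof.
move=> x; apply/matrixP => i j; rewrite (ord1 j) !mxE.
by case: unliftP => [k ->|->] /=; rewrite ?mxE.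
Qed.

Lemma measurable_cV_cons n : measurable_fun setT (@cV_cons n).
Proof.
apply/measurable_fun_cVP => i; case: (unliftP ord0 i) => [j ->|->].
  rewrite (_ : (fun _ => _) = (fun x : 'cV[R]_n => x j 0) \o snd); last first.
    by apply/funext => p /=; rewrite mxE liftK.
  apply: measurableT_comp => //.
  by have [+ _] := measurable_fun_cVP (@id 'cV[R]_n); apply; exact: measurable_id.
rewrite (_ : (fun _ => _) = fst)//.
by apply/funext => p /=; rewrite mxE unlift_none.
Qed.

Lemma measurable_cV_uncons n : measurable_fun setT (@cV_uncons n).
Proof.
have H m i : measurable_fun setT (fun x : 'cV[R]_m => x i 0).
  by have [+ _] := measurable_fun_cVP (@id 'cV[R]_m); apply; exact: measurable_id.
apply: measurable_fun_pair; first exact: H.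
by apply/measurable_fun_cVP => i; under eq_fun do rewrite mxE; exact: H.
Qed.

(* n-dimensional Lebesgue measure *)
Fixpoint leb n : set 'cV[R]_n -> \bar R :=
  if n is m.+1 then
    pushforward (lebesgue_measure \x @leb m)%E (@cV_cons m)
  else dirac (0 : 'cV[R]_0).
Arguments leb : clear implicits.

Let leb_ex n : exists m : {sigma_finite_measure set 'cV[R]_n -> \bar R},
  m = leb n :> (set _ -> \bar R).
Proof.
elim: n => [|n [m em]].
  by exists (dirac (0 : 'cV[R]_0) : {sigma_finite_measure set 'cV[R]_0 -> \bar R}).
have mc := @measurable_cV_cons n.
pose l := @lebesgue_measure R.
pose p : {measure set (measurableTypeR R * 'cV[R]_n)%type -> \bar R} :=
  (l \x m)%E.
pose M : {measure set 'cV[R]_n.+1 -> \bar R} :=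
  measure_function_pushforward__canonical__measure_function_Measure p mc.
have sM : sigma_finite setT M.
  have /sigma_finiteP[F [FT Fnd Foo]] := sigma_finiteT l.
  have /sigma_finiteP[G [GT Gnd Goo]] := sigma_finiteT m.
  exists (fun k => @cV_uncons n @^-1` (F k `*` G k)).
    rewrite -preimage_bigcup (_ : \bigcup_k (F k `*` G k) = setT)//.
    rewrite -setXTT FT GT predeqE => -[x y]; split.
      by move=> [k _ []/= ? ?]; split; exists k.
    move=> [/= [i _ Fx] [k _ Gy]]; exists (maxn i k) => //; split.
    - by move: x Fx; exact/subsetPset/Fnd/leq_maxl.
    - by move: y Gy; exact/subsetPset/Gnd/leq_maxr.
  move=> k; have [mF Fk] := Foo k; have [mG Gk] := Goo k; split.
    rewrite -[X in measurable X]setTI; apply: measurable_cV_uncons => //.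
    exact: measurableX.
  rewrite /M/= /pushforward (_ : _ @^-1` _ = F k `*` G k); last first.
    by apply/funext => x; rewrite /preimage /mkset cV_consK.
  rewrite product_measure1E// lte_mul_pinfty// ge0_fin_numE//.
pose sig := Measure_isSigmaFinite.Build _ _ _ M sM.
pose M' : {sigma_finite_measure set 'cV[R]_n.+1 -> \bar R} :=
  HB.pack (M : set _ -> \bar R) M sig.
by exists M'; rewrite /= -em.
Qed.

Section instances.
Variable n : nat.
Local Open Scope ereal_scope.

Let leb0 : leb n set0 = 0.
Proof. by have [m <-] := leb_ex n; exact: measure0. Qed.

Let leb_ge0 A : 0 <= leb n A.
Proof. by have [m <-] := leb_ex n; exact: measure_ge0. Qed.

Let leb_sigma_additive : semi_sigma_additive (leb n).
Proof. by have [m <-] := leb_ex n; exact: measure_semi_sigma_additive. Qed.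

HB.instance Definition _ := isMeasure.Build _ _ _ (leb n)
  leb0 leb_ge0 leb_sigma_additive.

Let leb_sigma_finite : sigma_finite setT (leb n).
Proof. by have [m <-] := leb_ex n; exact: sigma_finiteT. Qed.

HB.instance Definition _ := Measure_isSigmaFinite.Build _ _ _ (leb n)
  leb_sigma_finite.

End instances.

Lemma leb_box n (A : 'I_n -> set R) : (forall i, measurable (A i)) ->
  leb n [set x | forall i, A i (x i 0)] = (\prod_(i < n) lebesgue_measure (A i))%E.
Proof.
elim: n A => [|n IH] A mA.
  by rewrite big_ord0 /= diracE mem_set// => -[].
pose B : set 'cV[R]_n := [set x | forall i, A (lift ord0 i) (x i 0)].
have mB : measurable B.
  have -> : B = \big[setI/setT]_(i < n)
      ((fun x : 'cV[R]_n => x i 0) @^-1` A (lift ord0 i)).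
    rewrite -bigcap_seq; apply/seteqP; split => [x Ax i _|x Ax i].
      exact: Ax.
    by apply: Ax => /=; rewrite mem_index_enum.
  apply: bigsetI_measurable => i _; rewrite -[X in measurable X]setTI.
  have [+ _] := measurable_fun_cVP (@id 'cV[R]_n).
  by move=> /(_ (@measurable_id _ _ _) i); apply.
rewrite big_ord_recl -(IH (fun i => A (lift ord0 i)))// -/B.
rewrite -product_measure1E//=; last exact: mA.
rewrite /pushforward.
congr ((lebesgue_measure \x leb n)%E _).
apply/seteqP; split => -[a x] /= Aax.
  split; first by have := Aax ord0; rewrite mxE unlift_none.
  by move=> i; have := Aax (lift ord0 i); rewrite mxE liftK.
case: Aax => Aa Ax i.
by rewrite mxE; case: unliftP => [j ->|->] /=; [exact: Ax|exact: Aa].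
Qed.

End lebesgue_cV.
Arguments leb R n : clear implicits.

Section linear_algebra.
Context {R : realType} {n : nat}.
Implicit Types (x y : 'cV[R]_n) (A S X Y : 'M[R]_n).

Definition dot x y : R := \sum_i x i 0 * y i 0.

Definition enorm x : R := Num.sqrt (dot x x).

Definition posdefmx S :=
  S^T = S /\ forall x, x != 0 -> 0 < dot (S *m x) x.

(* the unique positive definite square root of a positive definite matrix *)
Definition sqrtmx S : 'M[R]_n :=
  xget 0 [set T | posdefmx T /\ T *m T = S].

Definition bracket X Y : 'M[R]_n := X *m Y - Y *m X.

Definition expmx A : 'M[R]_n :=
  limn (fun m => \sum_(0 <= k < m) (k`!%:R^-1 : R) *: A ^+ k).

End linear_algebra.

Section ornstein_uhlenbeck_semigroup.
Context {R : realType} {n : nat} (Q B : 'M[R]_n).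
Implicit Types (t : R) (x y : 'cV[R]_n) (S : 'M[R]_n) (f : 'cV[R]_n -> R).

(* entrywise integral; for D = [0, +oo[ it is the improper integral whenever
   the latter converges absolutely, e.g., for B with spectrum in Re z < 0 *)
Definition covmx (D : set R) : 'M[R]_n :=
  \matrix_(i, j) \int[lebesgue_measure]_(s in D)
    (expmx (s *: B) *m Q *m expmx (s *: B^T)) i j.

Definition Qt t := covmx `[0, t].

Definition Qinf := covmx `[0, +oo[.

Definition gauss S y : R :=
  (((2 * pi) `^ (n%:R / 2)) * Num.sqrt (\det S))^-1 *
  expR (- 2^-1 * dot (invmx S *m y) y).

Definition OU_semigroup t f x : R :=
  if t == 0 then f x
  else \int[leb R n]_y (gauss (Qt t) y * f (expmx (t *: B) *m x - y)).

Definition OU_invariant (mu : probability 'cV[R]_n R) :=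
  forall t f, 0 <= t -> continuous f -> (exists M, forall x, `|f x| <= M) ->
  \int[mu]_x OU_semigroup t f x = \int[mu]_x f x.

End ornstein_uhlenbeck_semigroup.

Section distributions.
Context {R : realType} {n : nat}.
Implicit Types (i j : 'I_n) (phi : 'cV[R]_n -> R) (u v : 'cV[R]_n -> R[i]).

Definition partial i phi : 'cV[R]_n -> R := 'D_(delta_mx i 0) phi.

(* partial derivatives of all orders exist and are continuous *)
Definition smooth phi := forall s : seq 'I_n,
  continuous (foldr partial phi s) /\
  forall i x, derivable (foldr partial phi s) x (delta_mx i 0).

Definition test_function phi :=
  smooth phi /\ compact (closure [set x | phi x != 0]).

(* A complex distribution is represented by its values on real test functions,
   which determine it by linearity; only these values are meaningful. *)
Definition cdistribution := ('cV[R]_n -> R) -> R[i].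
Implicit Types T : cdistribution.

Definition distr_of u : cdistribution := fun phi =>
  (\int[leb R n]_x (complex.Re (u x) * phi x)) +i* (\int[leb R n]_x (complex.Im (u x) * phi x)).

Definition distr_partial i T : cdistribution := fun phi => - T (partial i phi).

Definition distr_coord j T : cdistribution :=
  fun phi => T (fun x => x j 0 * phi x).

Definition OU_distr (Q B : 'M[R]_n) T : cdistribution := fun phi =>
  2^-1 * (\sum_i \sum_j (Q i j)%:C * distr_partial i (distr_partial j T) phi)
  + \sum_i \sum_j (B i j)%:C * distr_coord j (distr_partial i T) phi.

End distributions.

Section L2.
Context {R : realType} {n : nat} (mu : probability 'cV[R]_n R).
Implicit Types u v f : 'cV[R]_n -> R[i].

Definition L2norm u : \bar R := ('N[mu]_2%:E [EFin \o (@Normc.normc R \o u)])%E.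

Definition inL2 u :=
  [/\ measurable_fun setT (fun x => complex.Re (u x)),
      measurable_fun setT (fun x => complex.Im (u x)) & (L2norm u < +oo)%E].

(* An unbounded operator on L^2_mu is given by its graph [A u v] (u is in the
   domain and v is the image of u), stated on representatives. *)
Implicit Types A : ('cV[R]_n -> R[i]) -> ('cV[R]_n -> R[i]) -> Prop.

(* A - z is onto, and injective with bounded inverse *)
Definition resolvent_set A (z : R[i]) :=
  (forall f, inL2 f -> exists u v,
     A u v /\ {ae mu, forall x, v x - z * u x = f x}) /\
  (exists C : R, forall u v, A u v ->
     (L2norm u <= C%:E * L2norm (fun x => (v x - z * u x)%R))%E).

(* the operator norm of (A - z)^-1, and +oo when z is in the spectrum *)
Definition resolvent_norm A (z : R[i]) : \bar R :=
  if `[< resolvent_set A z >] then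
    ereal_sup [set r | exists u v, [/\ A u v,
      (L2norm (fun x => (v x - z * u x)%R) <= 1)%E & r = L2norm u]]
  else +oo%E.

(* the Ornstein-Uhlenbeck operator with maximal domain *)
Definition OU_L2 (Q B : 'M[R]_n) u v :=
  [/\ inL2 u, inL2 v & forall phi, test_function phi ->
      OU_distr Q B (distr_of u) phi = distr_of v phi].

End L2.

Section numerical_range.
Context {R : realType} {n : nat} (Q B : 'M[R]_n).

Let Qi := invmx (Qinf Q B).

Definition Bset : set ('cV[R]_n * 'cV[R]_n) :=
  [set p | 2^-1 * enorm (sqrtmx Q *m p.2) ^+ 2 +
           8^-1 * enorm (sqrtmx Q *m Qi *m p.1) ^+ 2 = 1].

Definition Bform (p : 'cV[R]_n * 'cV[R]_n) : R :=
  dot ((- 2^-1 *: (Q *m Qi) - B) *m p.1) p.2.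

Definition m_minus : R := inf [set Bform p | p in Bset].

Definition m_plus : R := sup [set Bform p | p in Bset].

End numerical_range.

(* Main.v *)
(* Write S for Qinf, C = B^T and <a, b> = b^* S a. The coherent states
   k_a(x) = exp(a . x - (S a) . a / 2), a in C^n, satisfy
   (d/ds - P) k_{exp(s C) a} = 0 and (k_a, k_b) = exp <a, b>. Put
   N = S B^T - B S, which is skew. The substitution x = 2 S p, xi = r turns the
   numerical range into the values of (N p) . r under (Q p . p + Q r . r) / 2 = 1,
   and the non-commutation hypothesis provides alpha = p + i r with
   (N p) . r = lambda and rho = Re <X, Y> > 0, where X = S^-1 Q alpha / 2,
   Y = S^-1 N alpha / 2, so that C alpha = Y - X.
   With y = s / 2 + i tau, the packets E_{s,tau} built on
   sqrt t exp(s C) (alpha + 2 y X), multiplied by the exponential of t times a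
   suitable quadratic polynomial in (s, tau), solve
   (d_s + (i / 2) d_tau) E = (P - z) E. Hence, for u the integral of E over the
   square [-eps, eps]^2, (P - z) u is an integral over its boundary. Relative to
   the coherent state at sqrt t alpha, the norm of E has exponent
   t (- rho s^2 / 2 - 2 rho tau^2 + O(3)), so (P - z) u is exponentially small,
   while the scalar product of E with this coherent state has a real negative
   definite quadratic exponent up to O(3), so |u| is at least of order 1 / t. *)
From HB Require Import structures.
Require Import Defs.
From mathcomp Require Import all_boot all_order all_algebra.
From mathcomp Require Import all_classical all_reals all_analysis.
From mathcomp Require Import measurable_realfun lebesgue_integral_under complex ring lra.

Import Order.TTheory GRing.Theory Num.Theory.
Import numFieldNormedType.Exports.

Set Implicit Arguments.
Unset Strict Implicit.
Unset Printing Implicit Defensive.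

Local Open Scope classical_set_scope.
Local Open Scope ring_scope.
Local Open Scope complex_scope.

(** * Linear algebra *)

(** The plain evolution exp(s (P - z)) of one coherent state has, to second order, the norm exponent
    t (|X|^2 - rho) s^2, and nothing makes |X|^2 smaller than rho. The dissipative drift -X in C
    alpha = Y - X is to blame. Starting from alpha + 2 y X with Re y = s / 2 cancels it: to first
    order the orbit is alpha + s Y + 2 i tau X. Such a start is admissible because d_s + (i / 2)
    d_tau annihilates every holomorphic function of y, so that neither the moving start nor a scalar
    factor holomorphic in y disturbs the evolution equation. The price is the second real variable
    tau. The constants of the scalar factor come from the pairing with the coherent state at alpha:
    its term -2 y balances <2 y X, alpha> = 2 y, and the coefficient th = 4 (|X|^2 + rho) of y^2 / 2
    removes the quadratic part of the phase. The same value makes the norm decay in both variables.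
    Only a cubic phase is left, which is harmless at the Gaussian scale t^(-1/2). *)

Section dot_theory.
Context {R : realType} {n : nat}.
Implicit Types (x y z : 'cV[R]_n) (A S T : 'M[R]_n).

Lemma dotE x y : dot x y = (x^T *m y) 0 0.
Proof. by rewrite mxE; apply: eq_bigr => i _; rewrite mxE. Qed.

Lemma dotC x y : dot x y = dot y x.
Proof. by apply: eq_bigr => i _; rewrite mulrC. Qed.

Lemma dotDl x y z : dot (x + y) z = dot x z + dot y z.
Proof. by rewrite -big_split/=; apply: eq_bigr => i _; rewrite mxE mulrDl. Qed.

Lemma dotZl a x y : dot (a *: x) y = a * dot x y.
Proof. by rewrite mulr_sumr; apply: eq_bigr => i _; rewrite mxE mulrA. Qed.

Lemma dotDr x y z : dot z (x + y) = dot z x + dot z y.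
Proof. by rewrite dotC dotDl !(dotC z). Qed.

Lemma dotZr a x y : dot x (a *: y) = a * dot x y.
Proof. by rewrite dotC dotZl dotC. Qed.

Lemma dotNl x y : dot (- x) y = - dot x y.
Proof. by rewrite -scaleN1r dotZl mulN1r. Qed.

Lemma dotNr x y : dot x (- y) = - dot x y.
Proof. by rewrite dotC dotNl dotC. Qed.

Lemma dotBl x y z : dot (x - y) z = dot x z - dot y z.
Proof. by rewrite dotDl dotNl. Qed.

Lemma dotBr x y z : dot z (x - y) = dot z x - dot z y.
Proof. by rewrite dotDr dotNr. Qed.

Lemma dot0l y : dot 0 y = 0.
Proof. by rewrite -(scale0r 0) dotZl mul0r. Qed.

Lemma dot0r y : dot y 0 = 0.
Proof. by rewrite dotC dot0l. Qed.

Lemma dot_mull A x y : dot (A *m x) y = dot x (A^T *m y).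
Proof. by rewrite !dotE trmx_mul -mulmxA. Qed.

Lemma dot_mulr A x y : dot x (A *m y) = dot (A^T *m x) y.
Proof. by rewrite dot_mull trmxK. Qed.

Lemma dot_ge0 x : 0 <= dot x x.
Proof. by apply: sumr_ge0 => i _; exact: sqr_ge0. Qed.

Lemma dot_eq0 x : (dot x x == 0) = (x == 0).
Proof.
apply/eqP/eqP => [/eqP|->]; last exact: dot0l.
rewrite psumr_eq0 => [/allP x0|i _]; last exact: sqr_ge0.
apply/matrixP => i j; rewrite (ord1 j) mxE; apply/eqP.
by have := x0 i (mem_index_enum _); rewrite mulf_eq0 orbb.
Qed.

Lemma dot_gt0 x : x != 0 -> 0 < dot x x.
Proof. by move=> x0; rewrite lt_neqAle dot_ge0 eq_sym dot_eq0 x0. Qed.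

Lemma sqr_enorm x : enorm x ^+ 2 = dot x x.
Proof. by rewrite /enorm sqr_sqrtr// dot_ge0. Qed.

Lemma dot_delta i x : dot x (delta_mx i 0) = x i 0.
Proof.
rewrite /dot (bigD1 i)//= !mxE !eqxx mulr1 big1 ?addr0// => j ji.
by rewrite !mxE (negbTE ji) mulr0.
Qed.

Lemma dot_inj x y : (forall z, dot x z = dot y z) -> x = y.
Proof.
move=> xy; apply/matrixP => i j; rewrite (ord1 j).
by rewrite -!dot_delta xy.
Qed.

Lemma posdef_ge0 S x : posdefmx S -> 0 <= dot (S *m x) x.
Proof.
move=> [_ S0]; have [->|/S0/ltW//] := eqVneq x 0.
by rewrite mulmx0 dot0l.
Qed.

Lemma posdef_unit S : posdefmx S -> S \in unitmx.
Proof.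
move=> [ST S0]; rewrite -row_free_unit -kermx_eq0; apply/eqP/row_matrixP => i.
rewrite row0; apply: trmx_inj; rewrite trmx0; apply: contrapT => /eqP/S0.
rewrite -{1}ST -trmx_mul -row_mul mulmx_ker row0 trmx0 dot0l.
by rewrite ltxx.
Qed.

Lemma posdef_inv S : posdefmx S -> posdefmx (invmx S).
Proof.
move=> pS; have uS := posdef_unit pS; have [ST S0] := pS; split.
  by rewrite trmx_inv ST.
move=> x x0; have -> : x = S *m (invmx S *m x) by rewrite mulKVmx.
rewrite mulKmx// dotC; apply: S0; apply: contra x0 => /eqP y0.
by rewrite -(mulKVmx uS x) y0 mulmx0.
Qed.

End dot_theory.

(** Newton interpolation: the correction for a new node carries a product vanishing at all earlier
    ones. It turns a function of a diagonalizable matrix into a polynomial in that matrix. *)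
Lemma interpolation_poly (F : fieldType) (f : F -> F) (s : seq F) :
  exists p : {poly F}, forall x, x \in s -> p.[x] = f x.
Proof.
elim: s => [|y s [p ps]]; first by exists 0.
have [ys|ys] := boolP (y \in s).
  by exists p => x; rewrite inE => /orP[/eqP ->|]; exact: ps.
pose q : {poly F} := \prod_(z <- s) ('X - z%:P).
have qy : q.[y] != 0 by rewrite -[_ == 0]/(root q y) root_prod_XsubC.
exists (p + ((f y - p.[y]) / q.[y])%:P * q) => x.
rewrite inE hornerD hornerM hornerC => /orP[/eqP ->|xs].
  by rewrite divfK// addrC subrK.
have /eqP -> : q.[x] == 0 by rewrite -[_ == 0]/(root q x) root_prod_XsubC.
by rewrite mulr0 addr0 ps.
Qed.

(** * Square roots of positive definite matrices *)

Section sqrtmx_theory.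
Context {R : realType} {n : nat}.
Implicit Types (Q : 'M[R]_n).

(** Spectral theorem for the complexified matrix. The change of basis P may be complex; what has to
    be shown real and positive is the diagonal. *)
Lemma posdef_spectral Q : posdefmx Q ->
  exists P (r : 'rV[R]_n), [/\ P \in unitmx, forall i, 0 < r 0 i &
    map_mx (real_complex R) Q =
      invmx P *m diag_mx (map_mx (real_complex R) r) *m P].
Proof.
move=> [QT Q0]; set QC := map_mx _ _.
have QCh : QC \is hermsymmx.
  apply/is_hermitianmxP; rewrite expr0 scale1r -map_trmx.
  apply/matrixP => i j; rewrite !mxE -{1}QT mxE.
  by rewrite conj_Creal// complex_real.
have := spectral_unit QC; have := hermitian_spectral_diag_real QCh.
have /orthomx_spectralP := hermitian_normalmx QCh.
move: (spectralmx QC) (spectral_diag QC) => P d dec dr Pu.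
have PQ : P *m QC = diag_mx d *m P by rewrite dec !mulmxA mulmxV// mul1mx.
have dreal i : exists2 r : R, 0 < r & d 0 i = r%:C.
  have /mxOverP/(_ 0 i) := dr.
  move=> /complex_realP[r dri]; exists r => //.
  have : eigenvalue QC (d 0 i).
    apply/eigenvalueP; exists (row i P).
      by rewrite -row_mul PQ row_mul row_diag_mx -scalemxAl -rowE.
    apply/eqP => /(congr1 (mulmx^~ (invmx P))).
    rewrite -row_mul mulmxV// mul0mx => /matrixP/(_ 0 i).
    by rewrite !mxE eqxx => /eqP; rewrite oner_eq0.
  (* A real eigenvalue is a root of the real characteristic polynomial, hence has a real eigenvector
     [v], on which the form of [Q] is positive. *)
  rewrite dri eigenvalue_root_char -map_char_poly fmorph_root.
  rewrite -eigenvalue_root_char => /eigenvalueP[v vQ v0].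
  have vT0 : v^T != 0 by rewrite -trmx0 (inj_eq trmx_inj).
  have := Q0 _ vT0; rewrite -{1}QT -trmx_mul vQ linearZ/= dotZl.
  by rewrite pmulr_lgt0// dot_gt0.
exists P, (\row_i complex.Re (d 0 i)); split; [exact: Pu| |].
  by move=> i; rewrite mxE; have [a a0 ->] := dreal i.
rewrite [LHS]dec; congr (invmx P *m diag_mx _ *m P); apply/matrixP => i j.
by rewrite (ord1 i) !mxE; have [a a0 ->] := dreal j.
Qed.

(* The root is a real polynomial in [Q], read off the spectral decomposition. *)
Lemma posdef_fourth_root Q : posdefmx Q ->
  exists2 U : 'M[R]_n, U^T = U & U *m U *m (U *m U) = Q.
Proof.
move=> pQ; have [QT _] := pQ; have [P [r [Pu r0 dec]]] := posdef_spectral pQ.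
(* [horner_mx] acts on matrices of size m + 1. *)
case: n Q {pQ} QT P r Pu r0 dec => [|m] Q QT P r Pu r0 dec.
  by exists 0; apply/matrixP => -[].
have [p pr] := interpolation_poly (fun x => Num.sqrt (Num.sqrt x)) (codom (r 0)).
pose U := horner_mx Q p; exists U.
  rewrite /U; elim/poly_ind: p {pr U} => [|p c IH]; first by rewrite rmorph0 trmx0.
  rewrite rmorphD rmorphM/= horner_mx_C horner_mx_X linearD/= tr_scalar_mx.
  congr (_ + _); rewrite [in LHS]/GRing.mul/= trmx_mul IH QT.
  exact: comm_mx_horner (comm_mx_refl _).
apply: (map_mx_inj (f := real_complex R)); rewrite !map_mxM/= dec.
rewrite /U map_horner_mx dec horner_mx_uconjC// horner_mx_diag.
set D := diag_mx (map_mx (horner _) _).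
suff <- : D *m D *m (D *m D) = diag_mx (map_mx (real_complex R) r).
  by rewrite !mulmxA !mulmxK.
rewrite /D !mulmx_diag; congr diag_mx.
apply/matrixP => i j; rewrite (ord1 i) !mxE horner_map/= pr ?codom_f//.
rewrite -!rmorphM/=; congr (_%:C).
by rewrite -!expr2 !sqr_sqrtr ?sqrtr_ge0// ltW.
Qed.

(** With U a symmetric fourth root, <U^2 x, x> = |U x|^2, so positivity of U^2 needs no discussion
    of eigenvalues. *)
Lemma posdef_sqrt Q : posdefmx Q ->
  exists T : 'M[R]_n, posdefmx T /\ T *m T = Q.
Proof.
move=> pQ; have [U UT U4] := posdef_fourth_root pQ.
exists (U *m U); split=> //; split; first by rewrite trmx_mul UT.
move=> x x0; rewrite -mulmxA dot_mull UT; apply: dot_gt0.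
apply: contra x0 => /eqP Ux; apply/eqP/(can_inj (mulKmx (posdef_unit pQ))).
by rewrite -U4 -!mulmxA Ux !mulmx0.
Qed.

Lemma sqrtmxP Q : posdefmx Q -> posdefmx (sqrtmx Q) /\ sqrtmx Q *m sqrtmx Q = Q.
Proof. by move=> /posdef_sqrt[T TP]; rewrite /sqrtmx; case: xgetP => [? _ []|/(_ T)/(_ TP)]. Qed.

Lemma enorm_sqrtmx Q (x : 'cV[R]_n) : posdefmx Q ->
  enorm (sqrtmx Q *m x) ^+ 2 = dot (Q *m x) x.
Proof.
move=> /sqrtmxP[[TT _] TQ].
by rewrite sqr_enorm dot_mulr TT mulmxA TQ.
Qed.

End sqrtmx_theory.

(** * The numerical range as a pencil of quadratic forms *)

(** Serves as the first-order condition at a maximum: [a] and [b] are the first and second order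
    terms of a variation. *)
Lemma quadratic_le0_linear0 (R : realType) (a b : R) :
  (forall h, a * h + b * h ^+ 2 <= 0) -> a = 0.
Proof.
move=> H; apply/eqP/negPn/negP => a0.
(* At h = a / c the left side equals h^2 (c + b), and c > -b. *)
pose c := 1 + `|b|; have c0 : 0 < c by rewrite ltr_pwDl.
have := H (a / c); rewrite leNgt => /negP; apply.
have -> : a * (a / c) + b * (a / c) ^+ 2 = (a / c) ^+ 2 * (c + b).
  by field; rewrite gt_eqF.
rewrite mulr_gt0// ?exprn_even_gt0//= ?mulf_neq0// ?invr_eq0 ?gt_eqF//.
by rewrite /c; have := ler_norm (- b); rewrite normrN; lra.
Qed.

(** The product c / a of the roots is negative, so there is one on each side of 0 and a caller may
    choose the sign. *)
Lemma quadratic_roots (R : realType) (a b c : R) : a * c < 0 ->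
  exists h1 h2, [/\ 0 <= h1, h2 <= 0, a * h1 ^+ 2 + b * h1 + c = 0 &
    a * h2 ^+ 2 + b * h2 + c = 0].
Proof.
move=> ac; have a0 : a != 0 by apply: contraTneq ac => ->; rewrite mul0r ltxx.
pose d := Num.sqrt (b ^+ 2 - 4 * a * c).
have d2 : d ^+ 2 = b ^+ 2 - 4 * a * c by rewrite sqr_sqrtr//; nra.
have bd : `|b| <= d by rewrite -sqrtr_sqr ler_wsqrtr//; lra.
have rt e : e ^+ 2 = d ^+ 2 -> a * ((e - b) / (2 * a)) ^+ 2 + b * ((e - b) / (2 * a)) + c = 0.
  move=> ed; have -> : a * ((e - b) / (2 * a)) ^+ 2 + b * ((e - b) / (2 * a)) + c
      = (e ^+ 2 - (b ^+ 2 - 4 * a * c)) / (4 * a) by field.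
  by rewrite ed d2 subrr mul0r.
move: bd; rewrite ler_norml => /andP[bd1 bd2].
have [a_gt0|a_lt0|/eqP] := ltgtP a 0; last by rewrite (negbTE a0).
- exists ((- d - b) / (2 * a)), ((d - b) / (2 * a)); split; try (apply: rt; rewrite ?sqrrN//).
    by apply: mulr_le0; rewrite ?invr_le0; lra.
  by apply: mulr_ge0_le0; rewrite ?invr_le0; lra.
- exists ((d - b) / (2 * a)), ((- d - b) / (2 * a)); split; try (apply: rt; rewrite ?sqrrN//).
    by apply: mulr_ge0; rewrite ?invr_ge0; lra.
  by apply: mulr_le0_ge0; rewrite ?invr_ge0; lra.
Qed.

Lemma continuous_sumr (T : topologicalType) (R : realType) (I : Type) (r : seq I)
    (f : I -> T -> R) :
  (forall i, continuous (f i)) -> continuous (fun x => \sum_(i <- r) f i x).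
Proof.
move=> cf; elim: r => [|i r IH].
  by rewrite (_ : (fun _ => _) = cst 0); [exact: cst_continuous|apply/funext => x; rewrite big_nil].
rewrite (_ : (fun _ => _) = (fun x => f i x + \sum_(i <- r) f i x)).
  by move=> x; apply: cvgD; [exact: cf|exact: IH].
by apply/funext => x; rewrite big_cons.
Qed.

Lemma continuous_dot (T : topologicalType) (R : realType) n (f g : T -> 'cV[R]_n) :
  (forall i, continuous (fun x => f x i 0)) -> (forall i, continuous (fun x => g x i 0)) ->
  continuous (fun x => dot (f x) (g x)).
Proof. by move=> cf cg; apply: continuous_sumr => i x; apply: cvgM; [exact: cf|exact: cg]. Qed.

Lemma continuous_mulmx (T : topologicalType) (R : realType) n (A : 'M[R]_n) (f : T -> 'cV[R]_n) :
  (forall i, continuous (fun x => f x i 0)) ->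
  forall i, continuous (fun x => (A *m f x) i 0).
Proof.
move=> cf i; under eq_fun do rewrite mxE; apply: continuous_sumr => j x.
by apply: cvgMr; exact: cf.
Qed.

Section pencil.
Context {R : realType} {n : nat} (Q S N : 'M[R]_n).
Hypothesis pQ : posdefmx Q.
Hypothesis pS : posdefmx S.
Hypothesis NT : N^T = - N.
Implicit Types (p r : 'cV[R]_n).

Let QT : Q^T = Q. Proof. by case: pQ. Qed.
Let ST : S^T = S. Proof. by case: pS. Qed.
Let uS : S \in unitmx. Proof. exact: posdef_unit. Qed.
Let SiT : (invmx S)^T = invmx S. Proof. by rewrite trmx_inv ST. Qed.

Definition pencil_q1 p r := 2^-1 * (dot (Q *m p) p + dot (Q *m r) r).
Definition pencil_q2 p r := dot (N *m p) r.
(** [pencil_k p + pencil_k r] is the derivative of [pencil_q1] at (p, r) along the linear flow of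
    S^-1 N. For the N of the overview it equals 4 rho. *)
Definition pencil_k p := dot (Q *m (invmx S *m (N *m p))) p.

Local Notation q1 := pencil_q1.
Local Notation q2 := pencil_q2.
Local Notation k := pencil_k.

Let Sdot p r := dot (S *m p) p + dot (S *m r) r.

Lemma dotN p r : dot (N *m p) r = - dot (N *m r) p.
Proof. by rewrite dot_mull NT mulNmx dotNr dotC. Qed.

Lemma pencil_dotNN p : dot (N *m p) p = 0.
Proof. by have := dotN p p; lra. Qed.

Lemma pencil_q1_gt0 p r : (p != 0) || (r != 0) -> 0 < q1 p r.
Proof.
move=> pr; rewrite /q1 mulr_gt0// ?invr_gt0//.
have [_ Q0] := pQ; case/orP: pr => /Q0 h.
  by rewrite ltr_pwDl// posdef_ge0.
by rewrite ltr_wpDl// posdef_ge0.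
Qed.

Lemma pencil_q1D p r a b h :
  q1 (p + h *: a) (r + h *: b) = q1 p r +
    h * (dot (Q *m a) p + dot (Q *m b) r) + h ^+ 2 * q1 a b.
Proof.
rewrite /q1 !mulmxDr -!scalemxAr !(dotDl, dotDr, dotZl, dotZr).
have e x y : dot (Q *m x) y = dot (Q *m y) x by rewrite dot_mull QT dotC.
by rewrite (e p a) (e r b); field.
Qed.

Lemma pencil_q2D p r a b h :
  q2 (p + h *: a) (r + h *: b) = q2 p r +
    h * (dot (N *m a) r + dot (N *m p) b) + h ^+ 2 * q2 a b.
Proof. by rewrite /q2 !mulmxDr -!scalemxAr !(dotDl, dotDr, dotZl, dotZr); ring. Qed.

Lemma pencil_kD p a h : k (p + h *: a) = k p +
  h * (dot (Q *m (invmx S *m (N *m a))) p + dot (Q *m (invmx S *m (N *m p))) a)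
  + h ^+ 2 * k a.
Proof.
by rewrite /k !(mulmxDr, =^~ scalemxAr) !(dotDl, dotDr, dotZl, dotZr); ring.
Qed.

(** Compactness of a Euclidean sphere: with T the square root of S, the vector (T p, T r) has
    squared length [Sdot p r], and homogeneity carries the maximum over the sphere to all pairs. *)
Lemma Sdot_compact_max (g : 'cV[R]_n -> 'cV[R]_n -> R) :
  (forall T, continuous
     (fun w : 'rV[R]_(n + n) => g (T *m (lsubmx w)^T) (T *m (rsubmx w)^T))) ->
  (forall c p r, g (c *: p) (c *: r) = c ^+ 2 * g p r) ->
  (exists p r, 0 < g p r) ->
  exists gam p0 r0, [/\ 0 < g p0 r0, g p0 r0 = gam * Sdot p0 r0 &
    forall p r, g p r <= gam * Sdot p r].
Proof.
move=> gc gZ [p1 [r1 g1]].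
have [T [pT TS]] := posdef_sqrt pS.
have uT := posdef_unit pT; have [TT _] := pT.
have ST2 p : dot (S *m p) p = dot (T *m p) (T *m p).
  by rewrite -TS -mulmxA dot_mull TT.
pose A : set 'rV[R]_(n + n) := [set w | dot w^T w^T = 1].
pose G w := g (invmx T *m (lsubmx w)^T) (invmx T *m (rsubmx w)^T).
pose W p r : 'rV[R]_(n + n) := row_mx (T *m p)^T (T *m r)^T.
have GW p r : G (W p r) = g p r by rewrite /G /W row_mxKl row_mxKr !trmxK !mulKmx.
have dW p r : dot (W p r)^T (W p r)^T = Sdot p r.
  by rewrite /Sdot !ST2 /W tr_row_mx !trmxK !dotE tr_col_mx mul_row_col mxE.
have WZ c p r : W (c *: p) (c *: r) = c *: W p r.
  by rewrite /W -!scalemxAr !linearZ/= scale_row_mx.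
have S0 p r : g p r != 0 -> 0 < Sdot p r.
  move=> gpr; rewrite lt_neqAle -dW dot_ge0 andbT eq_sym dot_eq0.
  apply: contra gpr => /eqP W0; apply/eqP; rewrite -GW.
  have -> : W p r = W (0 *: p) (0 *: r) by rewrite WZ scale0r -trmx0 -W0 trmxK.
  by rewrite GW gZ expr0n mul0r.
have AW p r : g p r != 0 -> A (W ((Num.sqrt (Sdot p r))^-1 *: p) ((Num.sqrt (Sdot p r))^-1 *: r)).
  move=> gpr; rewrite /A/= WZ linearZ/= dotZl dotZr dW mulrA -expr2 exprVn.
  by rewrite sqr_sqrtr ?(ltW (S0 _ _ gpr))// mulVf// gt_eqF// S0.
have GA p r : g p r != 0 -> g p r =
    G (W ((Num.sqrt (Sdot p r))^-1 *: p) ((Num.sqrt (Sdot p r))^-1 *: r)) * Sdot p r.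
  move=> gpr; rewrite GW gZ exprVn sqr_sqrtr ?(ltW (S0 _ _ gpr))//.
  by rewrite mulrC mulrA divff ?mul1r// gt_eqF// S0.
have [|||w Aw Gmax] := @EVT_max_rV R _ G A.
- by eexists; exact: (AW _ _ (lt0r_neq0 g1)).
- apply: bounded_closed_compact.
    exists 1; split; first exact: num_real.
    move=> c c1 w Aw; rewrite /= [leLHS]/Num.norm /= mx_normrE; apply/bigmax_leP; split => [|[i j] _/=].
      exact: ltW (lt_trans ltr01 c1).
    apply: le_trans (ltW c1); rewrite (ord1 i).
    have : (w 0 j) ^+ 2 <= 1.
      rewrite -[leRHS]Aw /dot (bigD1 j)//= !mxE -expr2 lerDl.
      by apply: sumr_ge0 => k _; rewrite -expr2 sqr_ge0.
    by rewrite ler_norml => h; apply/andP; split; nra.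
  rewrite (_ : A = (fun w => dot w^T w^T) @^-1` [set 1]); last by [].
  apply: closed_comp; last exact: closed_eq.
  by move=> w _; apply: continuous_dot => i; under eq_fun do rewrite mxE; exact: coord_continuous.
- exact/continuous_subspaceT/gc.
rewrite inE/= in Aw.
have wW : w = W (invmx T *m (lsubmx w)^T) (invmx T *m (rsubmx w)^T).
  by rewrite /W !mulKVmx// !trmxK hsubmxK.
exists (G w), (invmx T *m (lsubmx w)^T), (invmx T *m (rsubmx w)^T).
split; [|by rewrite -dW -wW Aw mulr1|].
- rewrite -/(G w); have := Gmax _ (mem_set (AW _ _ (lt0r_neq0 g1))).
  apply: lt_le_trans; rewrite -(pmulr_lgt0 _ (S0 _ _ (lt0r_neq0 g1))) -GA//.
  exact: lt0r_neq0.
(* Normalising would divide by 0 at p = r = 0; wherever g vanishes the bound follows instead from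
   the positivity of the maximum. *)
- move=> p r; have [g0|g0] := eqVneq (g p r) 0.
    rewrite g0; apply: mulr_ge0; last by rewrite -dW dot_ge0.
    have := Gmax _ (mem_set (AW _ _ (lt0r_neq0 g1))).
    apply: le_trans; rewrite ltW// -(pmulr_lgt0 _ (S0 _ _ (lt0r_neq0 g1))) -GA//.
    exact: lt0r_neq0.
  by rewrite {1}GA// ler_wpM2r ?(ltW (S0 _ _ g0))// Gmax// inE; exact: AW.
Qed.

(** Maximize ([q2] - mu [q1]) / [Sdot] and move the maximizer along S^-1 N, which is skew for S. In
    this direction [Sdot] and [q2] are stationary while the first variation of [q1] is k p + k r, so
    stationarity reads mu (k p + k r) = 0. *)
Lemma pencil_extremal (mu : R) : mu != 0 ->
  (exists p r, 0 < q2 p r - mu * q1 p r) ->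
  exists p r, 0 < q2 p r - mu * q1 p r /\ k p + k r = 0.
Proof.
move=> mu0 ex.
have [||//|gam [p [r [g0 gE gle]]]] := @Sdot_compact_max (fun p r => q2 p r - mu * q1 p r).
- have cl i : continuous (fun w : 'rV[R]_(n + n) => (lsubmx w)^T i 0).
    by under eq_fun do rewrite !mxE; exact: coord_continuous.
  have cr i : continuous (fun w : 'rV[R]_(n + n) => (rsubmx w)^T i 0).
    by under eq_fun do rewrite !mxE; exact: coord_continuous.
  move=> T w; rewrite /q1 /q2.
  have cb A (f h : 'rV[R]_(n + n) -> 'cV[R]_n) :
      (forall i, continuous (fun w => f w i 0)) ->
      (forall i, continuous (fun w => h w i 0)) ->
      continuous (fun w => dot (A *m (T *m f w)) (T *m h w)).
    by move=> cf ch; apply: continuous_dot => i; do 2?[apply: continuous_mulmx => {}i].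
  have cN := cb N _ _ cl cr w; have cl2 := cb Q _ _ cl cl w.
  have cr2 := cb Q _ _ cr cr w.
  by have := cvgB cN (cvgM (cvg_cst mu) (cvgM (cvg_cst (2^-1 : R)) (cvgD cl2 cr2))); apply.
- by move=> c p r; rewrite /q1 /q2 -!scalemxAr !dotZl !dotZr; ring.
exists p, r; split=> //.
pose a := invmx S *m (N *m p); pose b := invmx S *m (N *m r).
have /quadratic_le0_linear0 : forall h,
   (- mu * (k p + k r)) * h + (q2 a b - mu * q1 a b - gam * Sdot a b) * h ^+ 2 <= 0.
  move=> h; have := gle (p + h *: a) (r + h *: b).
  rewrite pencil_q1D pencil_q2D.
  have -> : Sdot (p + h *: a) (r + h *: b) = Sdot p r + h ^+ 2 * Sdot a b.
    rewrite /Sdot !mulmxDr -!scalemxAr !(dotDl, dotDr, dotZl, dotZr).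
    have e x y : dot (S *m x) y = dot (S *m y) x by rewrite dot_mull ST dotC.
    rewrite (e p a) (e r b) /a /b !mulKVmx// !pencil_dotNN; ring.
  have -> : dot (N *m a) r + dot (N *m p) b = 0.
    have e : dot a (N *m r) = dot (N *m p) b by rewrite [LHS](dot_mull (invmx S)) SiT.
    by rewrite dotN (dotC (N *m r)) e addNr.
  move: gE; rewrite -/(k p) -/(k r) -/a -/b => gE; rewrite /k -/a -/b.
  lra.
by move/eqP; rewrite mulf_eq0 oppr_eq0 (negbTE mu0) => /eqP.
Qed.

(** The trace of the form [k] in an S-orthonormal basis is the trace of Q S^-1 N S^-1, which is 0
    because Q is symmetric and N skew. If [k] were nowhere positive it would vanish on that basis,
    each basis vector would lie in the kernel of the form, and the symmetric part of M = Q S^-1 N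
    would be 0; this is the excluded commutation. *)
Lemma pencil_k_gt0 : Q *m invmx S *m N <> N *m invmx S *m Q -> exists p, 0 < k p.
Proof.
move=> QN; apply: contrapT => /forallNP k0; apply: QN.
have {}k0 p : k p <= 0 by rewrite leNgt; apply/negP; exact: k0.
have [T [pT TS]] := posdef_sqrt (posdef_inv pS).
have uT := posdef_unit pT; have [TT _] := pT.
pose M := Q *m invmx S *m N.
have kM p : k p = dot (M *m p) p by rewrite /k /M !mulmxA.
have trM : \sum_i k (T *m delta_mx i 0) = 0.
  have -> : \sum_i k (T *m delta_mx i 0) = \tr (M *m invmx S).
    rewrite -TS mulmxA mxtrace_mulC mulmxA; apply: eq_bigr => i _.
    rewrite kM dot_mulr TT dot_delta !mulmxA.
    by rewrite (_ : delta_mx i 0 = delta_mx i ord0)// -colE mxE.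
  have : \tr (M *m invmx S) = - \tr (M *m invmx S).
    rewrite -{1}mxtrace_tr /M !trmx_mul SiT NT QT !(mulmxN, mulNmx) raddfN/=.
    by rewrite -!mulmxA [in RHS]mxtrace_mulC !mulmxA.
  lra.
have kT i : k (T *m delta_mx i 0) = 0.
  apply/eqP; move: trM => /eqP; rewrite -oppr_eq0 -sumrN psumr_eq0; last first.
    by move=> j _; rewrite oppr_ge0 k0.
  by move/allP/(_ i (mem_index_enum _)); rewrite oppr_eq0.
(* A zero of [k] is then a maximum of [k], hence a critical point. *)
have MT p : k p = 0 -> (M + M^T) *m p = 0.
  move=> kp; apply: dot_inj => w; rewrite dot0l mulmxDl dotDl (dot_mull M^T) trmxK.
  have /quadratic_le0_linear0 : forall h,
     (dot (M *m p) w + dot p (M *m w)) * h + k w * h ^+ 2 <= 0.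
    move=> h; have := k0 (p + h *: w); rewrite pencil_kD kp.
    rewrite !(mulmxA Q) !(mulmxA _ N) -/M [dot (M *m w) _]dotC; lra.
  by rewrite addrC.
have : (M + M^T) *m T = 0.
  apply/matrixP => i j; have := kT j => /MT /matrixP/(_ i 0).
  by rewrite mulmxA -[delta_mx j 0]/(delta_mx j ord0) -colE !mxE.
move=> /(congr1 (mulmx^~ (invmx T))); rewrite mulmxK// mul0mx => /eqP.
rewrite addr_eq0 => /eqP MM; rewrite -/M [LHS]MM.
by rewrite /M !trmx_mul QT SiT NT !mulNmx opprK mulmxA.
Qed.

(* The form k vanishes at the extremal points of q2 - mu q1, which exist on both
   sides of the level lam, and is positive at some point; a perturbation of an
   extremal point in that direction, of the right sign, meets q2 = lam q1. *)
Lemma pencil_level_k_gt0 lam :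
  Q *m invmx S *m N <> N *m invmx S *m Q ->
  (exists p r, [/\ q1 p r = 1 & lam < q2 p r]) ->
  (exists p r, [/\ q1 p r = 1 & q2 p r < lam]) ->
  exists p r, [/\ q1 p r = 1, q2 p r = lam & 0 < k p + k r].
Proof.
move=> /pencil_k_gt0[p1 k1] [p2 [r2 [q12 q22]]] [p3 [r3 [q13 q23]]].
have [pp [rp [gp kp]]] : exists p r, 0 < q2 p r - lam * q1 p r /\ k p + k r = 0.
  (* [pencil_extremal] needs a nonzero mu: if the midpoint of lam and the attained value is 0, one
     further midpoint is taken. *)
  pose m := (lam + q2 p2 r2) / 2.
  have [mu [lmu muq mu0]] : exists mu, [/\ lam < mu, mu < q2 p2 r2 & mu != 0].
    have [m0|m0] := eqVneq m 0; last by exists m; split=> //; rewrite /m; lra.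
    exists ((m + q2 p2 r2) / 2); rewrite /m in m0 *; split; [lra|lra|].
    by apply/eqP; lra.
  have [|p [r [g0 kpr]]] := pencil_extremal mu0.
    by exists p2, r2; rewrite q12; lra.
  exists p, r; split=> //; apply: lt_le_trans g0 _.
  have : 0 <= q1 p r by rewrite /q1 mulr_ge0 ?addr_ge0 ?posdef_ge0.
  nra.
have [pm [rm [gm km]]] : exists p r, q2 p r - lam * q1 p r < 0 /\ k p + k r = 0.
  pose m := (lam + q2 p3 r3) / 2.
  have [mu [lmu muq mu0]] : exists mu, [/\ mu < lam, q2 p3 r3 < mu & mu != 0].
    have [m0|m0] := eqVneq m 0; last by exists m; split=> //; rewrite /m; lra.
    exists ((m + q2 p3 r3) / 2); rewrite /m in m0 *; split; [lra|lra|].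
    by apply/eqP; lra.
  (* The reflection r -> -r changes the sign of [q2] and preserves [q1] and [k], so a maximum for
     -mu gives the point below the level. *)
  have muN : - mu != 0 by rewrite oppr_eq0.
  have q1N p r : q1 p (- r) = q1 p r by rewrite /q1 mulmxN dotNl dotNr opprK.
  have q2N p r : q2 p (- r) = - q2 p r by rewrite /q2 dotNr.
  have [|p [r [g0 kpr]]] := pencil_extremal muN.
    by exists p3, (- r3); rewrite q1N q2N q13; lra.
  exists p, (- r); rewrite q1N q2N; split; last first.
    by rewrite /k !mulmxN dotNl dotNr opprK.
  have : 0 <= q1 p r by rewrite /q1 mulr_ge0 ?addr_ge0 ?posdef_ge0.
  nra.
suff [p [r [gpr kpr]]] : exists p r, q2 p r = lam * q1 p r /\ 0 < k p + k r.
  have q0 : 0 < q1 p r.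
    apply: pencil_q1_gt0; apply: contraTT kpr; rewrite negb_or !negbK => /andP[/eqP -> /eqP ->].
    by rewrite /k !mulmx0 dot0l addr0 ltxx.
  pose c := (Num.sqrt (q1 p r))^-1.
  have c2 : c * c = (q1 p r)^-1 by rewrite -expr2 exprVn sqr_sqrtr// ltW.
  have c0 : 0 < c * c by rewrite c2 invr_gt0.
  exists (c *: p), (c *: r); split.
  - have -> : q1 (c *: p) (c *: r) = c * c * q1 p r.
      by rewrite /q1 -!scalemxAr !dotZl !dotZr; ring.
    by rewrite c2 mulVf// gt_eqF.
  - have -> : q2 (c *: p) (c *: r) = c * c * q2 p r.
      by rewrite /q2 -!scalemxAr !dotZl !dotZr; ring.
    by rewrite gpr c2 mulrCA mulVf ?mulr1// gt_eqF.
  - have -> : k (c *: p) + k (c *: r) = c * c * (k p + k r).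
      by rewrite /k -!scalemxAr !dotZl !dotZr; ring.
    by rewrite mulr_gt0.
(* On the line through (p1, 0) with direction (a, b), the sum of the two values of [k] is affine,
   since it vanishes on the direction, and [q2] - lam [q1] is a quadratic polynomial whose extreme
   coefficients have opposite signs. The root is taken on the side where the affine function does
   not fall below [k p1]. *)
have move_along a b : k a + k b = 0 ->
    (q2 p1 0 - lam * q1 p1 0) * (q2 a b - lam * q1 a b) < 0 ->
    exists p r, q2 p r = lam * q1 p r /\ 0 < k p + k r.
  move=> kab; rewrite mulrC => gab.
  pose L := dot (Q *m (invmx S *m (N *m a))) p1 + dot (Q *m (invmx S *m (N *m p1))) a.
  have kh h : k (p1 + h *: a) + k (0 + h *: b) = k p1 + h * L.
    have k00 : k 0 = 0 by rewrite /k !mulmx0 dot0l.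
    rewrite !pencil_kD !mulmx0 dot0r dot0l k00 -/L.
    transitivity (k p1 + h * L + h ^+ 2 * (k a + k b)); first by ring.
    by rewrite kab; ring.
  have [h1 [h2 [h1p h2n e1 e2]]] := quadratic_roots
     (dot (N *m a) 0 + dot (N *m p1) b
       - lam * (dot (Q *m a) p1 + dot (Q *m b) 0)) gab.
  have fin h : 0 <= h * L ->
      (q2 a b - lam * q1 a b) * h ^+ 2 + (dot (N *m a) 0 + dot (N *m p1) b
       - lam * (dot (Q *m a) p1 + dot (Q *m b) 0)) * h + (q2 p1 0 - lam * q1 p1 0) = 0 ->
      exists p r, q2 p r = lam * q1 p r /\ 0 < k p + k r.
    move=> hL eh; exists (p1 + h *: a), (0 + h *: b).
    rewrite kh pencil_q1D pencil_q2D; split; last lra.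
    by apply/eqP; rewrite -subr_eq0; apply/eqP; rewrite -eh; ring.
  have [L0|L0] := leP 0 L.
    by apply: fin e1; rewrite mulr_ge0.
  by apply: fin e2; rewrite mulr_le0// ltW.
have [g1|g1|g1] := ltgtP (q2 p1 0 - lam * q1 p1 0) 0.
- by apply: move_along kp _; rewrite nmulr_rlt0.
- by apply: move_along km _; rewrite pmulr_rlt0.
- exists p1, 0; split; first by lra.
  by rewrite {2}/k !mulmx0 dot0l addr0.
Qed.

End pencil.

(** * The matrix exponential *)

Section expmx_theory.
Context {R : realType} {n : nat}.
Implicit Types (C : 'M[R]_n) (s : R).

Let mxabs C : R := \sum_(ij : 'I_n * 'I_n) `|C ij.1 ij.2|.

Lemma expmx_entry_bound C k i j : `|(C ^+ k) i j| <= mxabs C ^+ k.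
Proof.
have M0 : 0 <= mxabs C by apply: sumr_ge0.
elim: k i j => [|k IH] i j.
  by rewrite !expr0 mxE; case: (i == j); rewrite ?normr1 ?normr0.
rewrite !exprS mxE; apply: le_trans (ler_norm_sum _ _ _) _.
apply: (@le_trans _ _ (\sum_l `|C i l| * mxabs C ^+ k)).
  by apply: ler_sum => l _; rewrite normrM ler_wpM2l.
rewrite -mulr_suml ler_wpM2r ?exprn_ge0//.
rewrite /mxabs -(pair_bigA _ (fun a b => `|C a b|))/= [leRHS](bigD1 i)//= lerDl.
by apply: sumr_ge0 => a _; apply: sumr_ge0.
Qed.

(** Comparison with A times the exponential series of M |s|. *)
Lemma cvg_pseries_fact (d : R^nat) (A M : R) s : 0 <= A -> 0 <= M ->
  (forall k, `|d k| <= A * M ^+ k) ->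
  cvgn (pseries (fun k => k`!%:R^-1 * d k) s).
Proof.
move=> A0 M0 dM; apply: normed_cvg.
have : cvgn (series (A *: exp_coeff (M * `|s|))).
  by rewrite -[X in cvgn X]/(series _); apply: is_cvg_seriesZ; exact: is_cvg_series_exp_coeff.
apply: series_le_cvg => [k|k|k]; first exact: normr_ge0.
  by rewrite mulr_ge0// divr_ge0 ?exprn_ge0 ?mulr_ge0.
rewrite /= !normrM normfV (normr_nat R) normrX.
rewrite -[leRHS]/(A * ((M * `|s|) ^+ k / k`!%:R)) exprMn.
have -> : A * (M ^+ k * `|s| ^+ k / k`!%:R) = k`!%:R^-1 * (A * M ^+ k) * `|s| ^+ k.
  by ring.
by rewrite ler_wpM2r ?exprn_ge0// ler_wpM2l.
Qed.

Lemma cvg_sumr (T : Type) (F : set_system T) (FF : Filter F) (I : Type) (r : seq I)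
    (f : I -> T -> R) (l : I -> R) :
  (forall k : I, f k x @[x --> F] --> l k) ->
  (\sum_(k <- r) f k x) @[x --> F] --> \sum_(k <- r) l k.
Proof.
move=> fl; elim: r => [|k r IH].
  rewrite big_nil (_ : (fun _ => _) = cst 0); first exact: cvg_cst.
  by apply/funext => x; rewrite big_nil.
rewrite big_cons (_ : (fun _ => _) = (fun x => f k x + \sum_(k <- r) f k x)).
  exact: cvgD.
by apply/funext => x; rewrite big_cons.
Qed.

Lemma scalemx_exp C s k : (s *: C) ^+ k = s ^+ k *: C ^+ k.
Proof.
elim: k => [|k IH]; first by rewrite !expr0 scale1r.
rewrite !exprS IH -[LHS]/((s *: C) *m (s ^+ k *: C ^+ k)).
by rewrite -scalemxAl -scalemxAr scalerA.
Qed.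

Let coef C i j k : R := k`!%:R^-1 * (C ^+ k) i j.

Let cvg_coef C i j s : cvgn (pseries (coef C i j) s).
Proof.
apply: (@cvg_pseries_fact _ 1 (mxabs C)) => // [|k]; first exact: sumr_ge0.
by rewrite mul1r expmx_entry_bound.
Qed.

Let diffs_coef C i j :
  pseries_diffs (coef C i j) = fun k => k`!%:R^-1 * (C ^+ k.+1) i j.
Proof.
apply/funext => k; rewrite /pseries_diffs /coef factS natrM invfM.
by rewrite mulrA mulrA divff ?mul1r// pnatr_eq0.
Qed.

Lemma cvg_mxP (m1 m2 : nat) (u : nat -> 'M[R]_(m1, m2)) (l : 'M[R]_(m1, m2)) :
  (forall i j, (fun k => u k i j) @ \oo --> l i j) -> u @ \oo --> l.
Proof.
move=> ul; apply/cvg_mx_entourageP => A entA.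
have H i j : \forall k \near \oo, (l i j, u k i j) \in A.
  have /cvg_app_entourageP/(_ _ entA) H := ul i j.
  by near=> k; apply/mem_set; near: k; exact: H.
have HA : \forall k \near \oo, forall ij : 'I_m1 * 'I_m2,
    (l ij.1 ij.2, u k ij.1 ij.2) \in A.
  by apply: filter_forall => -[a b]; exact: H.
by apply: filterS HA => k Hk i j; exact: (Hk (i, j)).
Unshelve. all: by end_near. Qed.

Let cvg_expmx C s :
  (fun m => \sum_(0 <= k < m) (k`!%:R^-1 : R) *: (s *: C) ^+ k) @ \oo -->
  \matrix_(i, j) limn (pseries (coef C i j) s).
Proof.
apply: cvg_mxP => i j; rewrite mxE.
rewrite (_ : (fun _ => _) = pseries (coef C i j) s); first exact: cvg_coef.
apply/funext => m; rewrite /pseries/series/= summxE.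
by apply: eq_bigr => k _; rewrite mxE scalemx_exp mxE /coef; ring.
Qed.

Lemma expmx_entry C s i j : expmx (s *: C) i j = limn (pseries (coef C i j) s).
Proof.
rewrite /expmx (_ : limn _ = \matrix_(i, j) limn (pseries (coef C i j) s)).
  by rewrite mxE.
by apply: cvg_lim => //; exact: cvg_expmx.
Qed.

Lemma expmx0 C : expmx (0 *: C) = 1%:M.
Proof.
apply/matrixP => i j; rewrite expmx_entry mxE.
apply/cvg_lim => //; rewrite -cvg_shiftS/=.
rewrite (_ : (fun _ => _) = cst (i == j)%:R); first exact: cvg_cst.
apply/funext => m; rewrite /pseries/series/= big_nat_recl//= big1.
  by rewrite /coef expr0 fact0 invr1 expr0 mul1r mulr1 addr0 mxE.
by move=> k _; rewrite exprS !mul0r mulr0.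
Qed.

Lemma trmx_exp C k : (C ^+ k)^T = C^T ^+ k.
Proof.
elim: k => [|k IH]; first by rewrite !expr0 trmx1.
by rewrite exprS exprSr -[(C * _)^T]/((C *m C ^+ k)^T) trmx_mul IH.
Qed.

Lemma trmx_expmx C s : (expmx (s *: C))^T = expmx (s *: C^T).
Proof.
apply/matrixP => i j; rewrite mxE !expmx_entry.
suff -> : coef C j i = coef C^T i j by [].
by apply/funext => k; rewrite /coef -trmx_exp mxE.
Qed.

(** Each entry is a scalar power series. Termwise differentiation asks that the series and its first
    two formal derivatives converge at a point of modulus larger than that of s; |s| + 1 is used. *)
Lemma is_derive_expmx C s i j : is_derive s (1 : R)
  (fun s => expmx (s *: C) i j) ((C *m expmx (s *: C)) i j).
Proof.
under eq_fun do rewrite expmx_entry.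
have M0 : 0 <= mxabs C by exact: sumr_ge0.
have -> : (C *m expmx (s *: C)) i j = limn (pseries (pseries_diffs (coef C i j)) s).
  rewrite mxE; apply/esym/cvg_lim => //.
  rewrite (_ : pseries _ _ = (fun m => \sum_l C i l * pseries (coef C l j) s m)).
    under eq_bigr do rewrite expmx_entry.
    by apply: cvg_sumr => l; apply: cvgM; [exact: cvg_cst|exact: cvg_coef].
  apply/funext => m; rewrite /pseries/series/= diffs_coef.
  under [RHS]eq_bigr do rewrite mulr_sumr.
  rewrite exchange_big/=; apply: eq_bigr => k _.
  rewrite exprS mxE mulr_sumr mulr_suml; apply: eq_bigr => l _; rewrite /coef; ring.
apply: (@pseries_snd_diffs _ _ (`|s| + 1)).
- exact: cvg_coef.
- rewrite diffs_coef; apply: (@cvg_pseries_fact _ (mxabs C) (mxabs C)) => // k.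
  by rewrite -exprS expmx_entry_bound.
- rewrite diffs_coef.
  rewrite (_ : pseries_diffs _ = fun k => k`!%:R^-1 * (C ^+ k.+2) i j); last first.
    apply/funext => k; rewrite /pseries_diffs factS natrM invfM.
    by rewrite mulrA mulrA divff ?mul1r// pnatr_eq0.
  apply: (@cvg_pseries_fact _ (mxabs C ^+ 2) (mxabs C)) => // [|k].
    exact: exprn_ge0.
  by rewrite -exprD expmx_entry_bound.
- by rewrite [ltRHS]ger0_norm// ltrDl.
Qed.

End expmx_theory.

(** * The Lyapunov equation *)

Section FTC_line.
Context {R : realType}.
Local Notation mu := (@lebesgue_measure R).

Lemma is_derive_continuous (F f : R -> R) :
  (forall x, is_derive x (1 : R) F (f x)) -> continuous F.
Proof.
move=> dF x; apply: differentiable_continuous; apply/derivable1_diffP.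
by have [] := dF x.
Qed.

Lemma FTC_line (F f : R -> R) a b : (forall x, is_derive x (1 : R) F (f x)) ->
  continuous f -> a < b ->
  (\int[mu]_(x in `[a, b]) (f x)%:E = (F b - F a)%:E)%E.
Proof.
move=> dF cf ab; have cF := is_derive_continuous dF.
rewrite (@continuous_FTC2 _ f F)//.
- exact: continuous_subspaceT.
- split.
  + by move=> x _; have [] := dF x.
  + by apply: cvg_at_right_filter; exact: cF.
  + by apply: cvg_at_left_filter; exact: cF.
- by move=> x _; rewrite derive1E; have [_ ->] := dF x.
Qed.

(** Integrability of the derivative gives g a limit at infinity; integrability of g forces that
    limit to be 0. *)
Lemma integrable_derivative (g h : R -> R) :
  (forall x, is_derive x (1 : R) g (h x)) -> continuous h ->
  mu.-integrable `[0, +oo[ (EFin \o g) -> mu.-integrable `[0, +oo[ (EFin \o h) ->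
  \int[mu]_(x in `[0, +oo[) h x = - g 0.
Proof.
move=> dg ch ig ih.
set L := \int[mu]_(x in _) _.
have mD : measurable (`[0, +oo[%classic : set (measurableTypeR R)) by [].
have ubn (u : R^nat) : (forall k, 0 < u k) -> u k @[k --> \oo] --> +oo ->
    g (u k) @[k --> \oo] --> g 0 + L.
  move=> u0 uoo.
  have -> : (fun k => g (u k)) = (fun k => g 0 + \int[mu]_(x in `[0, u k]) h x).
    by apply/funext => k; rewrite /Rintegral (FTC_line dg ch (u0 k))/=; ring.
  apply: cvgD; first exact: cvg_cst.
  have mh : measurable_fun [set: R] (EFin \o h).
    by apply/measurable_EFinP; exact: continuous_measurable_fun.
  have [] := @dominated_convergence _ _ R mu _ mD
    (fun k => (EFin \o h) \_ `[0, u k]) (EFin \o h) (fun x => `|(h x)%:E|%E).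
  - move=> k; apply: (@measurable_funS _ _ _ _ setT) => //.
    by apply: (measurable_restrictT _ _).1 => //; exact: measurable_funTS mh.
  - exact: measurable_funTS mh.
  - apply: aeW => x/= /[!in_itv]/= /andP[x0 _].
    apply: cvg_near_cst; move/cvgryPge : uoo => /(_ x); apply: filterS => k xu.
    by rewrite patchE mem_set//= in_itv/= x0.
  - exact: integrable_abse.
  - apply: aeW => x k _; rewrite patchE; case: ifPn => // _.
    by rewrite abse0.
  move=> _ _ cv.
  have LE : (\int[mu]_(x in `[0%R, +oo[) (EFin \o h) x)%E = L%:E.
    by rewrite fineK//; exact: integrable_fin_num.
  rewrite LE in cv; apply/fine_cvg; apply: cvg_trans cv.
  apply: near_eq_cvg; apply: nearW => k /=.
  by rewrite -integral_mkcondr setIidr//= ?fineK//; exact: subset_itvl.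
have gcv : g x @[x --> +oo] --> g 0 + L.
  apply/cvg_pinftyP => u uoo.
  (* [ubn] asks for positive terms; since u tends to infinity, finitely many terms are changed. *)
  pose v k := if 0 < u k then u k else 1.
  have uv : \forall k \near \oo, u k = v k.
    by move/cvgryPgt : uoo => /(_ 0); apply: filterS => k; rewrite /v => ->.
  have /ubn : forall k, 0 < v k by move=> k; rewrite /v; case: ifPn.
  have voo : v k @[k --> \oo] --> +oo.
    by apply: cvg_trans uoo; apply: near_eq_cvg; apply: filterS uv => k ->.
  move=> /(_ voo); apply: cvg_trans; apply: near_eq_cvg.
  by apply: filterS uv => k ->.
suff : g 0 + L = 0 by move/eqP; rewrite addrC addr_eq0 => /eqP.
(* A nonzero limit would keep |g| above half its modulus on a half-line, whose measure is
   infinite. *)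
apply/eqP/negPn/negP => l0.
have [M [_ HM]] : \forall x \near +oo, `|g 0 + L| / 2 <= `|g x|.
  have /cvgrPdist_le/(_ (`|g 0 + L| / 2)) := gcv.
  move=> /(_ _); rewrite divr_gt0 ?normr_gt0// => /(_ isT).
  apply: filterS => x; have := ler_normB (g 0 + L - g x) (- g x).
  by rewrite opprK subrK normrN; lra.
have /integrableP[mg] := ig; rewrite ltNge => /negP; apply.
pose M' := Num.max 0 (M + 1).
apply: (@le_trans _ _ (\int[mu]_(x in `[M', +oo[) (`|g 0 + L| / 2)%:E)%E).
  rewrite integral_cst//= lebesgue_measure_itv/= ltry.
  by rewrite addye// gt0_muley// lte_fin divr_gt0// normr_gt0.
apply: (@le_trans _ _ (\int[mu]_(x in `[M', +oo[) `|(EFin \o g) x|)%E).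
  apply: ge0_le_integral => //=.
  - apply: (@measurableT_comp _ _ _ _ _ _ (abse : \bar R -> \bar R) _ (EFin \o g)) => //.
    apply/measurable_EFinP.
    by apply: measurable_funTS; apply: continuous_measurable_fun; exact: is_derive_continuous dg.
  - move=> x; rewrite in_itv/= andbT => Mx; rewrite lee_fin; apply: HM.
    by apply: lt_le_trans Mx; rewrite lt_max ltrDl ltr01 orbT.
apply: ge0_subset_integral => //=.
  exact: (@measurableT_comp _ _ _ _ _ _ (abse : \bar R -> \bar R) _ (EFin \o g)).
by apply: subset_itvr; rewrite bnd_simp le_max lexx.
Qed.

End FTC_line.

(** * Derivatives and integrals of finite sums *)

Section finite_sums.
Context {R : realType}.

Lemma is_derive_sumr (I : Type) (r : seq I) (F : I -> R -> R) (d : I -> R) (x : R) :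
  (forall l, is_derive x (1 : R) (F l) (d l)) ->
  is_derive x (1 : R) (fun y => \sum_(l <- r) F l y) (\sum_(l <- r) d l).
Proof.
move=> dF; elim: r => [|l r IH].
  rewrite big_nil (_ : (fun _ => _) = cst 0); first exact: is_derive_cst.
  by apply/funext => y; rewrite big_nil.
rewrite big_cons (_ : (fun _ => _) = F l + (fun y => \sum_(l <- r) F l y)).
  exact: is_deriveD.
by apply/funext => y; rewrite big_cons.
Qed.

Lemma is_derive_mulmx m n p (U : R -> 'M[R]_(m, n)) (V : R -> 'M[R]_(n, p))
    (U' : 'M[R]_(m, n)) (V' : 'M[R]_(n, p)) (x : R) :
  (forall i j, is_derive x (1 : R) (fun y => U y i j) (U' i j)) ->
  (forall i j, is_derive x (1 : R) (fun y => V y i j) (V' i j)) ->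
  forall i j, is_derive x (1 : R) (fun y => (U y *m V y) i j)
    ((U' *m V x + U x *m V') i j).
Proof.
move=> dU dV i j; under eq_fun do rewrite mxE.
rewrite !mxE -big_split/=; apply: is_derive_sumr => l.
have h := is_deriveM (dU i l) (dV l j).
apply: (is_derive_eq h).
by rewrite /GRing.scale/=; ring.
Qed.

Lemma Rintegral_sumZ d (T : measurableType d) (mu : {measure set T -> \bar R})
    (D : set T) (I : Type) (r : seq I) (c : I -> R) (f : I -> T -> R) :
  measurable D ->
  (forall l, mu.-integrable D (EFin \o f l)) ->
  mu.-integrable D (EFin \o (fun x => \sum_(l <- r) c l * f l x)) /\
  \int[mu]_(x in D) (\sum_(l <- r) c l * f l x) = \sum_(l <- r) c l * \int[mu]_(x in D) f l x.
Proof.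
move=> mD intf; elim: r => [|l r [IH1 IH2]].
  rewrite big_nil (_ : (fun _ => _) = cst 0); last by apply/funext => y; rewrite big_nil.
  by rewrite /Rintegral integral0; split=> //; exact: integrable0.
have icf : mu.-integrable D (EFin \o (fun x => c l * f l x)).
  rewrite (_ : EFin \o _ = fun x => ((c l)%:E * (f l x)%:E)%E); last first.
    by apply/funext => x /=; rewrite EFinM.
  by have := integrableZl mD (c l) (intf l).
rewrite (_ : (fun _ => _) = (fun x => c l * f l x + \sum_(l <- r) c l * f l x)); last first.
  by apply/funext => y; rewrite big_cons.
split.
  rewrite (_ : EFin \o _ = fun x => ((c l * f l x)%:E + (\sum_(l <- r) c l * f l x)%:E)%E)//.
  exact: integrableD.
by rewrite big_cons RintegralD// IH2 RintegralZl.
Qed.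

End finite_sums.

Section lyapunov.
Context {R : realType} {n : nat} (Q B : 'M[R]_n).
Hypothesis pQ : posdefmx Q.
Hypothesis pQi : posdefmx (Qinf Q B).
Local Notation mu := (@lebesgue_measure R).

Let G (s : R) : 'M[R]_n := expmx (s *: B) *m Q *m expmx (s *: B^T).
Let G' (s : R) : 'M[R]_n := B *m G s + G s *m B^T.

Let dG i j s : is_derive s (1 : R) (fun r => G r i j) (G' s i j).
Proof.
have dX (C : 'M[R]_n) a b (r : R) : is_derive r (1 : R) (fun r => expmx (r *: C) a b)
    ((C *m expmx (r *: C)) a b) by exact: is_derive_expmx.
have dXT a b : is_derive s (1 : R) (fun r => expmx (r *: B^T) a b)
    ((expmx (s *: B^T) *m B^T) a b).
  have := dX B b a s.
  rewrite (_ : (fun r => expmx (r *: B^T) a b) = (fun r => expmx (r *: B) b a)); last first.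
    by apply/funext => r; rewrite -trmx_expmx mxE.
  by rewrite -trmx_expmx -trmx_mul [(_ ^T) _ _]mxE.
have dQ a b : is_derive s (1 : R) (fun r => (expmx (r *: B) *m Q) a b)
    ((B *m expmx (s *: B) *m Q) a b).
  have := @is_derive_mulmx _ _ _ _ (fun r => expmx (r *: B)) (fun=> Q) _ 0 s (fun a b => dX B a b s).
  move=> /(_ _ a b); rewrite mulmx0 addr0; apply => c d; rewrite mxE.
  exact: is_derive_cst.
have := is_derive_mulmx dQ dXT i j.
by rewrite /G' /G !mulmxA.
Qed.

(** G(s) = exp(s B) Q exp(s B^T) satisfies G' = B G + G B^T and G(0) = Q; integrate over [0, +oo[.
    Convergence is read off the positivity of [Qinf], not off the spectrum of B. *)
Lemma lyapunov : B *m Qinf Q B + Qinf Q B *m B^T = - Q.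
Proof.
have QT : Q^T = Q by case: pQ.
have mI : measurable (`[0, +oo[%classic : set (measurableTypeR R)) by [].
have GT s : (G s)^T = G s.
  by rewrite /G !trmx_mul QT !trmx_expmx trmxK mulmxA.
have cG i j : continuous (fun s => G s i j) by apply: is_derive_continuous => s; exact: dG.
have G0 s x : 0 <= dot (G s *m x) x.
  rewrite /G -mulmxA -mulmxA dot_mull trmx_expmx; exact: posdef_ge0.
have Gii s i : 0 <= G s i i.
  by have := G0 s (delta_mx i 0); rewrite dot_delta -(_ : delta_mx i ord0 = delta_mx i 0)// -colE mxE.
(* Positivity of G(s) tested on e_i + e_j and e_i - e_j: the diagonal entries dominate all
   others. *)
have Gij s i j : `|G s i j| <= G s i i + G s j j.
  have e k l : (G s *m (delta_mx k 0 : 'cV[R]_n)) l 0 = G s l k.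
    by rewrite -colE mxE.
  have := G0 s (delta_mx i 0 + delta_mx j 0); have := G0 s (delta_mx i 0 - delta_mx j 0).
  rewrite !(mulmxDr, mulmxN) !(dotDl, dotDr, dotNl, dotNr) !dot_delta !e.
  have -> : G s j i = G s i j by rewrite -{1}GT mxE.
  by have := Gii s i; have := Gii s j; rewrite ler_norml => *; apply/andP; split; lra.
have mG i j : measurable_fun (`[0, +oo[ : set (measurableTypeR R)) (EFin \o (fun s => G s i j)).
  by apply/measurable_EFinP; apply: measurable_funTS; exact: continuous_measurable_fun.
have iGii i : mu.-integrable `[0, +oo[ (EFin \o (fun s => G s i i)).
  have [_ /(_ (delta_mx i 0))] := pQi.
  have -> : delta_mx i 0 != 0 :> 'cV[R]_n.
    by apply/eqP => /matrixP/(_ i 0); rewrite !mxE !eqxx => /eqP; rewrite oner_eq0.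
  move=> /(_ isT); rewrite dot_delta (_ : delta_mx i 0 = delta_mx i ord0)// -colE mxE.
  rewrite mxE /Rintegral => fi.
  apply/integrableP; split; first exact: mG.
  (* A divergent integral would be recorded as 0, since [fine] sends +oo to 0, against the positive
     diagonal entry of [Qinf]. *)
  rewrite ltNge leye_eq; apply/negP => /eqP foo; move: fi.
  rewrite (_ : (\int[_]_(_ in _) _)%E = +oo%E) ?ltxx//.
  rewrite -foo; apply: eq_integral => s _ /=.
  by rewrite ger0_norm.
have iG i j : mu.-integrable `[0, +oo[ (EFin \o (fun s => G s i j)).
  have iD := integrableD mI (iGii i) (iGii j).
  apply: (le_integrable mI (mG i j) _ iD) => s _ /=.
  by rewrite lee_fin (le_trans (Gij _ _ _))// ler_norm.
have QiE i j : Qinf Q B i j = \int[mu]_(s in `[0, +oo[) G s i j by rewrite mxE.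
have G'E i j : (fun s => G' s i j) =
    (fun s => \sum_l B i l * G s l j + \sum_l B j l * G s i l).
  apply/funext => s; rewrite /G' !mxE; congr (_ + _); apply: eq_bigr => l _ //.
  by rewrite [B^T _ _]mxE mulrC.
have BG i j : mu.-integrable `[0, +oo[ (EFin \o (fun s => G' s i j)) /\
    \int[mu]_(s in `[0, +oo[) G' s i j = (B *m Qinf Q B + Qinf Q B *m B^T) i j.
  have [i1 e1] := @Rintegral_sumZ _ _ _ mu `[0, +oo[ _ (index_enum 'I_n)
    (fun l => B i l) (fun l s => G s l j) mI (fun l => iG l j).
  have [i2 e2] := @Rintegral_sumZ _ _ _ mu `[0, +oo[ _ (index_enum 'I_n)
    (fun l => B j l) (fun l s => G s i l) mI (fun l => iG i l).
  rewrite G'E; split.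
    rewrite (_ : EFin \o _ = fun s => ((\sum_l B i l * G s l j)%:E + (\sum_l B j l * G s i l)%:E)%E)//.
    by have := integrableD mI i1 i2.
  rewrite RintegralD// e1 e2 [RHS]mxE; congr (_ + _); rewrite [RHS]mxE; apply: eq_bigr => l _.
    by rewrite QiE.
  by rewrite [B^T _ _]mxE QiE mulrC.
apply/matrixP => i j; have [iG' <-] := BG i j.
rewrite (integrable_derivative (dG i j)) => [|||//].
- by rewrite /G !expmx0 mul1mx mulmx1 mxE.
- rewrite G'E => s; apply: cvgD; apply: continuous_sumr => l {}s;
    by apply: cvgM; [exact: cvg_cst|exact: cG].
- exact: iG.
Qed.
End lyapunov.

(** * Gaussian measures *)

Section leb_translation.
Context {R : realType}.

Lemma lebesgue_measure_shift (a : R) (A : set (measurableTypeR R)) : measurable A ->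
  lebesgue_measure ((fun x => x + a) @^-1` A) = lebesgue_measure A.
Proof.
move=> mA.
have ms : measurable_fun [set: measurableTypeR R] (fun x : measurableTypeR R => x + a : measurableTypeR R).
  exact: measurable_funD.
pose m' : {measure set (measurableTypeR R) -> \bar R} :=
  measure_function_pushforward__canonical__measure_function_Measure (@lebesgue_measure R) ms.
rewrite -[LHS]/(m' A); apply/esym/lebesgue_measure_unique => // _ [[x y] _ <-].
rewrite /m'/= /pushforward.
rewrite (_ : _ @^-1` _ = [set` `]x - a, y - a]]).
  by rewrite !lebesgue_measure_itv/= !lte_fin ltrD2r; congr (if _ then _ else _); rewrite -!EFinB; congr EFin; ring.
by apply/seteqP; split => z /=; rewrite !in_itv/= ltrBlDr lerBrDr.
Qed.

Lemma measurable_coord n (i : 'I_n) : measurable_fun setT (fun x : 'cV[R]_n => x i 0).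
Proof.
by have [+ _] := measurable_fun_cVP (@id 'cV[R]_n); apply; exact: measurable_id.
Qed.

Lemma measurable_shift n (a : 'cV[R]_n) : measurable_fun setT (fun x : 'cV[R]_n => x + a).
Proof.
apply/measurable_fun_cVP => i; under eq_fun do rewrite mxE.
by apply: measurable_funD => //; exact: measurable_coord.
Qed.

(** By induction on the dimension: the translated measure agrees with the product measure on
    rectangles, hence everywhere by uniqueness. *)
Lemma leb_shift n (a : 'cV[R]_n) (A : set 'cV[R]_n) : measurable A ->
  leb R n ((fun x => x + a) @^-1` A) = leb R n A.
Proof.
elim: n a A => [|n IH] a A mA.
  congr (leb R 0); apply/funext => x /=; congr A.
  by apply/matrixP => -[].
pose psi (p : measurableTypeR R * 'cV[R]_n) : measurableTypeR R * 'cV[R]_n :=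
  (p.1 + (cV_uncons a).1, p.2 + (cV_uncons a).2).
have mpsi : measurable_fun setT psi.
  apply/measurable_fun_pairP; split => /=.
    by apply: measurable_funD => //; exact: measurable_fst.
  by apply: measurableT_comp (@measurable_shift _ _) _; exact: measurable_snd.
pose l := (@lebesgue_measure R \x leb R n)%E.
pose m' : {measure set (measurableTypeR R * 'cV[R]_n) -> \bar R} :=
  measure_function_pushforward__canonical__measure_function_Measure l mpsi.
transitivity (m' (@cV_cons R n @^-1` A)).
  rewrite /= /pushforward /m' /=; congr (_ _).
  apply/funext => -[x y] /=; congr A; apply/matrixP => i j.
  by rewrite (ord1 j) !mxE; case: unliftP => [k ->|->] /=; rewrite ?mxE.
rewrite /=; apply/esym; apply: product_measure_unique => /=.
  move=> X Y mX mY; rewrite /pushforward.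
  rewrite (_ : psi @^-1` _ = ((fun x => x + (cV_uncons a).1) @^-1` X) `*` ((fun x => x + (cV_uncons a).2) @^-1` Y))//.
  rewrite product_measure1E/=.
  - by rewrite IH// lebesgue_measure_shift.
  - rewrite -[_ @^-1` _]setTI; apply: measurable_funD => //.
  - by rewrite -[_ @^-1` _]setTI; exact: measurable_shift.
rewrite -[_ @^-1` _]setTI; exact: measurable_cV_cons.
Qed.

Lemma ge0_integral_leb_shift n (a : 'cV[R]_n) (f : 'cV[R]_n -> \bar R) :
  measurable_fun setT f -> (forall x, 0 <= f x)%E ->
  (\int[leb R n]_x f (x + a)%R = \int[leb R n]_x f x)%E.
Proof.
move=> mf f0.
have := @ge0_integral_pushforward _ _ _ _ R _ (measurable_shift a) (leb R n) setT f measurableT mf (fun x _ => f0 x).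
rewrite preimage_setT => <-.
pose m' : {measure set 'cV[R]_n -> \bar R} :=
  measure_function_pushforward__canonical__measure_function_Measure (leb R n) (measurable_shift a).
by apply: (eq_measure_integral (m1 := m') (leb R n)) => A mA _; exact: leb_shift.
Qed.

Lemma integral_leb_shift n (a : 'cV[R]_n) (f : 'cV[R]_n -> \bar R) :
  measurable_fun setT f ->
  (\int[leb R n]_x f (x + a)%R = \int[leb R n]_x f x)%E.
Proof.
move=> mf; rewrite integralE [RHS]integralE; congr (_ - _)%E.
  rewrite -[RHS](ge0_integral_leb_shift a); [|exact: measurable_funepos|by []].
  by apply: eq_integral => x _; rewrite !funeposE.
rewrite -[RHS](ge0_integral_leb_shift a); [|exact: measurable_funeneg|by []].
by apply: eq_integral => x _; rewrite !funenegE.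
Qed.

End leb_translation.

(** * Integration against a measure with a density *)

Section density.
Local Open Scope ereal_scope.
Context d (T : measurableType d) (R : realType).
Variables (mu nu : {measure set T -> \bar R}) (rho : T -> R).
Hypothesis mrho : measurable_fun setT rho.
Hypothesis rho0 : forall x, (0 <= rho x)%R.
Hypothesis murho : forall A, measurable A -> mu A = \int[nu]_(x in A) (rho x)%:E.

Import HBNNSimple.

(** Holds on simple functions by additivity and passes to the limit by monotone convergence on both
    sides. *)
Lemma ge0_integral_density (f : T -> \bar R) : measurable_fun setT f ->
  (forall x, 0 <= f x) -> \int[mu]_x f x = \int[nu]_x (f x * (rho x)%:E).
Proof.
move=> mf f0; pose h := nnsfun_approx measurableT mf.
have hf x : (h n x)%:E @[n --> \oo] --> f x by exact: cvg_nnsfun_approx.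
have mr : measurable_fun setT (EFin \o rho) by exact/measurable_EFinP.
have mh n : measurable_fun setT (EFin \o h n) by exact/measurable_EFinP.
have ndh x : nondecreasing_seq (fun n => (h n x)%:E).
  by move=> a b ab; rewrite lee_fin; exact/lefP/nd_nnsfun_approx.
have simple n : \int[mu]_x (h n x)%:E = \int[nu]_x ((h n x)%:E * (rho x)%:E).
  have hE x : (h n x)%:E = \sum_(y \in range (h n)) (y * \1_(h n @^-1` [set y]) x)%:E.
    by rewrite fimfunE -fsumEFin.
  have mi y : measurable_fun setT (fun x => (y * \1_(h n @^-1` [set y]) x)%:E).
    by apply/measurable_EFinP; exact: measurable_funM.
  under eq_integral do rewrite hE.
  rewrite ge0_integral_fsum//; last by move=> y x _; exact: nnfun_muleindic_ge0.
  transitivity (\int[nu]_x \sum_(y \in range (h n))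
      ((y * \1_(h n @^-1` [set y]) x)%:E * (rho x)%:E)); last first.
    apply: eq_integral => x _; rewrite hE ge0_mule_fsuml// => y.
    exact: nnfun_muleindic_ge0.
  rewrite ge0_integral_fsum//; last 2 first.
  - by move=> y; exact: emeasurable_funM.
  - by move=> y x _; rewrite mule_ge0 ?lee_fin//; exact: nnfun_muleindic_ge0.
  apply: eq_fsbigr => y /set_mem[x _ hxy].
  have y0 : (0 <= y)%R by rewrite -hxy.
  have my : measurable (h n @^-1` [set y]) by exact: measurable_funPTI.
  under eq_integral do rewrite EFinM.
  rewrite ge0_integralZl_EFin// ?integral_indic ?setIT//; last exact/measurable_EFinP.
  under [RHS]eq_integral do rewrite EFinM -muleA.
  rewrite ge0_integralZl_EFin//; last 2 first.
  - by move=> z _; rewrite mule_ge0 ?lee_fin.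
  - by apply: emeasurable_funM => //; exact/measurable_EFinP.
  rewrite murho// integral_mkcond; congr (_ * _); apply: eq_integral => z _.
  by rewrite patchE indicE; case: ifPn => _; rewrite ?mul1e ?mul0e.
have h0 n x : 0 <= (h n x)%:E by rewrite lee_fin.
transitivity (limn (fun n => \int[mu]_x (h n x)%:E)).
  rewrite -(monotone_convergence mu measurableT mh (fun n x _ => h0 n x) (fun x _ => ndh x)).
  by apply: eq_integral => x _; apply/esym/cvg_lim => //; exact: hf.
under eq_fun do rewrite simple.
rewrite -(monotone_convergence nu measurableT (g' := fun n x => (h n x)%:E * (rho x)%:E)).
- by apply: eq_integral => x _; apply/cvg_lim => //; apply: cvgeZr => //; exact: hf.
- by move=> n; exact: (emeasurable_funM (mh n) mr).
- by move=> n x _; rewrite mule_ge0 ?lee_fin.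
- by move=> x _ a b ab; apply: lee_wpmul2r; rewrite ?lee_fin//; exact: ndh.
Qed.

End density.

Section measurable_dot.
Context {R : realType} {n : nat}.

Lemma measurable_dotr d (T : measurableType d) (f g : T -> 'cV[R]_n) :
  (forall i, measurable_fun setT (fun x => f x i 0)) ->
  (forall i, measurable_fun setT (fun x => g x i 0)) ->
  measurable_fun setT (fun x => dot (f x) (g x)).
Proof. by move=> mf mg; apply: measurable_sum => i; exact: measurable_funM. Qed.

Lemma measurable_mulmx d (T : measurableType d) (A : 'M[R]_n) (f : T -> 'cV[R]_n) :
  (forall i, measurable_fun setT (fun x => f x i 0)) ->
  forall i, measurable_fun setT (fun x => (A *m f x) i 0).
Proof.
move=> mf i; under eq_fun do rewrite mxE.
by apply: measurable_sum => j; exact: measurable_funM.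
Qed.

Lemma measurable_gauss (S : 'M[R]_n) : measurable_fun setT (gauss S).
Proof.
apply: measurable_funM => //; apply: measurableT_comp => //; apply: measurable_funM => //.
apply: measurable_dotr; last exact: measurable_coord.
by apply: measurable_mulmx; exact: measurable_coord.
Qed.

Lemma gauss_ge0 (S : 'M[R]_n) x : 0 <= gauss S x.
Proof. by rewrite mulr_ge0 ?expR_ge0// invr_ge0 mulr_ge0 ?powR_ge0 ?sqrtr_ge0. Qed.

End measurable_dot.

(** * Nondegeneracy and Laplace transform of a Gaussian measure *)

Section gaussian.
Context {R : realType} {n : nat} (S : 'M[R]_n) (mu : probability 'cV[R]_n R).
Hypothesis ST : S^T = S.
Hypothesis muS : forall A, measurable A ->
  mu A = (\int[leb R n]_(x in A) (gauss S x)%:E)%E.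

Let A := invmx S.
Let g x := expR (- 2^-1 * dot (A *m x) x).
Let c := ((2 * pi) `^ (n%:R / 2) * Num.sqrt (\det S))^-1.

Let mg : measurable_fun setT (EFin \o g).
Proof.
apply/measurable_EFinP; apply: measurableT_comp => //; apply: measurable_funM => //.
apply: measurable_dotr; last exact: measurable_coord.
by apply: measurable_mulmx; exact: measurable_coord.
Qed.

Let total : (c%:E * \int[leb R n]_x (g x)%:E)%E = 1%E.
Proof.
rewrite -(probability_setT mu) muS//.
rewrite -ge0_integralZl_EFin//; last 2 first.
- by move=> x _; rewrite lee_fin expR_ge0.
- by rewrite invr_ge0 mulr_ge0 ?powR_ge0 ?sqrtr_ge0.
Qed.

Let c_gt0 : 0 < c.
Proof.
rewrite lt_neqAle invr_ge0 mulr_ge0 ?powR_ge0 ?sqrtr_ge0// andbT eq_sym.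
by apply/eqP => c0; have := total; rewrite c0 mul0e => /eqP; rewrite eqe eq_sym oner_eq0.
Qed.

(** If det S were 0, the conventional inverse of 0 would make the density vanish, while the total
    mass is 1. *)
Lemma gaussian_cov_unit : S \in unitmx.
Proof.
rewrite unitmxE unitfE; apply/eqP => d0; have := c_gt0.
by rewrite /c d0 sqrtr0 mulr0 invr0 ltxx.
Qed.

Let AT : A^T = A. Proof. by rewrite trmx_inv ST. Qed.

(** Translations preserve the finite mass of g. With E = exp(-<A v, v> / 2), the average of g(x + v)
    and g(x - v) is E g(x) times a hyperbolic cosine, hence at least E g(x). Integrating gives E <=
    1, so <A v, v> is not negative. *)
Let Aneg v : 0 <= dot (A *m v) v.
Proof.
rewrite leNgt; apply/negP => av.
have gE x : expR (- 2^-1 * dot (A *m v) v) * g x <= 2^-1 * (g (x + v) + g (x + - v)).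
  have e h : g (x + h *: v) = g x * expR (- h * dot (A *m v) x) * expR (- 2^-1 * h ^+ 2 * dot (A *m v) v).
    rewrite /g -!expRD; congr expR.
    rewrite !(mulmxDr, =^~ scalemxAr) !(dotDl, dotDr, dotZl, dotZr).
    have -> : dot (A *m x) v = dot (A *m v) x by rewrite dot_mull AT dotC.
    by field.
  have := e 1; have := e (-1); rewrite scale1r scaleN1r => -> ->.
  set E := expR (- 2^-1 * dot _ _).
  have -> : - 2^-1 * 1 ^+ 2 * dot (A *m v) v = - 2^-1 * dot (A *m v) v by ring.
  have -> : - 2^-1 * (- 1) ^+ 2 * dot (A *m v) v = - 2^-1 * dot (A *m v) v by ring.
  rewrite -/E; set a := dot _ x.
  have E0 : 0 < E by exact: expR_gt0.
  have g0 : 0 < g x by exact: expR_gt0.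
  have ee : expR (- -1 * a) * expR (- 1 * a) = 1 by rewrite -expRD -expR0; congr expR; ring.
  have : 2 <= expR (- -1 * a) + expR (- 1 * a).
    have := sqr_ge0 (expR (- -1 * a) - expR (- 1 * a)).
    have := expR_gt0 (- -1 * a); have := expR_gt0 (- 1 * a).
    move: ee; nra.
  have Eg : 0 < E * g x by exact: mulr_gt0.
  nra.
have I1 : (\int[leb R n]_x (expR (- 2^-1 * dot (A *m v) v) * g x)%:E <=
    \int[leb R n]_x (2^-1 * (g (x + v) + g (x + - v)))%:E)%E.
  apply: ge0_le_integral => //.
  - by move=> x _; rewrite lee_fin mulr_ge0 ?expR_ge0.
  - by apply/measurable_EFinP; apply: measurable_funM => //; exact/measurable_EFinP.
  - apply/measurable_EFinP; apply: measurable_funM => //.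
    by apply: measurable_funD; apply: (@measurableT_comp _ _ _ _ _ _ g); 
      [exact/measurable_EFinP|exact: measurable_shift|exact/measurable_EFinP|exact: measurable_shift].
  - by move=> x _; rewrite lee_fin.
have gs w : (\int[leb R n]_x (g (x + w))%:E = \int[leb R n]_x (g x)%:E)%E.
  by rewrite -(ge0_integral_leb_shift w mg)// => x; rewrite lee_fin expR_ge0.
have mgs w : measurable_fun setT (fun x : 'cV[R]_n => (g (x + w))%:E).
  apply/measurable_EFinP; apply: (@measurableT_comp _ _ _ _ _ _ g).
    exact/measurable_EFinP.
  exact: measurable_shift.
have gs0 w (x : 'cV[R]_n) : setT x -> (0 <= (g (x + w))%:E)%E by rewrite lee_fin expR_ge0.
move: I1; under eq_integral do rewrite EFinM.
rewrite ge0_integralZl_EFin ?expR_ge0//; last by move=> x _; rewrite lee_fin expR_ge0.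
under [in leRHS]eq_integral do rewrite EFinM EFinD.
rewrite ge0_integralZl_EFin//; last 2 first.
- by move=> x _; rewrite adde_ge0 ?lee_fin ?expR_ge0.
- by apply: emeasurable_funD; exact: mgs.
rewrite (ge0_integralD (leb R n) measurableT (gs0 v) (mgs v) (gs0 (- v)) (mgs (- v))).
rewrite (gs v) (gs (- v)).
have : (\int[leb R n]_x (g x)%:E)%E = (c^-1)%:E.
  have := total; case: (\int[leb R n]_x (g x)%:E)%E => [r| |].
  - by rewrite -EFinM => -[cr]; congr EFin; rewrite -[r](mulKf (lt0r_neq0 c_gt0)) cr mulr1.
  - by rewrite gt0_muley ?lte_fin.
  - by rewrite gt0_muleNy ?lte_fin.
move=> ->; rewrite -EFinD -!EFinM lee_fin.
have ci : 0 < c^-1 by rewrite invr_gt0.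
have : 1 < expR (- 2^-1 * dot (A *m v) v).
  by rewrite expR_gt1 mulrC; nra.
nra.
Qed.

Lemma gaussian_cov_posdef : posdefmx S.
Proof.
have uS := gaussian_cov_unit.
rewrite -[S]invmxK; apply: posdef_inv; rewrite -/A; split=> // x x0.
rewrite lt_neqAle Aneg andbT; apply: contraNneq x0 => /esym Ax0.
have Ax : A *m x = 0.
  apply: dot_inj => w; rewrite dot0l.
  have /quadratic_le0_linear0 : forall h, (- (2 * dot (A *m x) w)) * h + (- dot (A *m w) w) * h ^+ 2 <= 0.
    move=> h; have := Aneg (x + h *: w).
    rewrite !(mulmxDr, =^~ scalemxAr) !(dotDl, dotDr, dotZl, dotZr) Ax0.
    have -> : dot (A *m w) x = dot (A *m x) w by rewrite dot_mull AT dotC.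
    lra.
  by move/eqP; rewrite oppr_eq0 mulf_eq0 pnatr_eq0 => /eqP.
by rewrite -(mulKVmx uS x) -/A Ax mulmx0.
Qed.

(** Complete the square: exp(p . x) times the density is exp((S p) . p / 2) times the density
    translated by S p. *)
Lemma integral_gaussian_expR p :
  (\int[mu]_x (expR (dot p x))%:E = (expR (2^-1 * dot (S *m p) p))%:E)%E.
Proof.
have uS := gaussian_cov_unit.
rewrite (ge0_integral_density (@measurable_gauss _ _ S) (@gauss_ge0 _ _ S) muS); last 2 first.
- apply/measurable_EFinP; apply: measurableT_comp => //.
  by apply: measurable_dotr => [i|]; [exact: measurable_cst|exact: measurable_coord].
- by move=> x; rewrite lee_fin expR_ge0.
have mgS : measurable_fun setT (fun x => (gauss S x)%:E).
  by apply/measurable_EFinP; exact: measurable_gauss.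
transitivity (\int[leb R n]_x ((expR (2^-1 * dot (S *m p) p))%:E * (gauss S (x + - (S *m p)))%:E))%E.
  apply: eq_integral => x _; rewrite -!EFinM /gauss -/A -/c; congr EFin.
  rewrite mulrCA [RHS]mulrCA -!expRD; congr (_ * expR _).
  rewrite !(mulmxDr, mulmxN) !(dotDl, dotDr, dotNl, dotNr).
  have -> : A *m (S *m p) = p by rewrite mulKmx.
  have -> : dot (A *m x) (S *m p) = dot p x.
    by rewrite dot_mull AT mulKmx// dotC.
  by rewrite (dotC (S *m p)); field.
rewrite ge0_integralZl_EFin ?expR_ge0//; last 2 first.
- by move=> x _; rewrite lee_fin gauss_ge0.
- apply/measurable_EFinP; apply: (@measurableT_comp _ _ _ _ _ _ (gauss S)).
    exact: measurable_gauss.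
  exact: measurable_shift.
rewrite (ge0_integral_leb_shift (- (S *m p)) mgS); last by move=> x; rewrite lee_fin gauss_ge0.
by rewrite -muS// probability_setT mule1.
Qed.

End gaussian.

Lemma is_derive_integral d (T : measurableType d) (R : realType)
    (mu : {measure set T -> \bar R}) (f f' : R -> T -> R) (G : T -> R) (a : R) :
  (forall x, mu.-integrable setT (EFin \o f x)) ->
  (forall x y, is_derive x (1 : R) (f ^~ y) (f' x y)) ->
  mu.-integrable setT (EFin \o G) ->
  (forall x y, `|x - a| < 1 -> `|f' x y| <= G y) ->
  is_derive a (1 : R) (fun x => \int[mu]_y f x y) (\int[mu]_y f' a y).
Proof.
move=> intf df intG fG.
have Ia : `]a - 1, a + 1[%classic a.
  by rewrite /= in_itv/= ltrDl ltr01 ltrBlDr ltrDl ltr01.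
have G0 y : 0 <= G y.
  by apply: le_trans (fG a y _); rewrite ?normr_ge0// subrr normr0.
have dE x y : derive1 (f^~ y) x = f' x y by rewrite derive1E; have [_ ->] := df x y.
have bd (x : R) (y : T) : `]a - 1, a + 1[%classic x -> setT y -> `|derive1 (f^~ y) x| <= G y.
  rewrite /= in_itv/= => /andP[h1 h2] _; rewrite dE; apply: fG.
  by rewrite ltr_norml; apply/andP; split; lra.
have i1 (x : R) : `]a - 1, a + 1[%classic x -> mu.-integrable setT (EFin \o f x) by [].
have d1 (x : R) (y : T) : `]a - 1, a + 1[%classic x -> setT y -> derivable (f^~ y) x 1.
  by move=> _ _; have [] := df x y.
have dF := derivable_under_integral measurableT Ia i1 d1 G0 intG bd.
split; first exact: dF.
have := differentiation_under_integral measurableT Ia i1 d1 G0 intG bd.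
rewrite derive1E => ->.
by apply: eq_Rintegral => y _; rewrite -dE.
Qed.

(** * Fourier transform of a Gaussian measure *)

Section gaussian_fourier.
Context {R : realType} {n : nat} (S : 'M[R]_n) (mu : probability 'cV[R]_n R).
Hypothesis ST : S^T = S.
Hypothesis muS : forall A, measurable A ->
  mu A = (\int[leb R n]_(x in A) (gauss S x)%:E)%E.

Lemma measurable_dotp (p : 'cV[R]_n) : measurable_fun setT (fun x : 'cV[R]_n => dot p x).
Proof.
by apply: measurable_dotr => [i|]; [exact: measurable_cst|exact: measurable_coord].
Qed.

Lemma integrable_gaussian_expR p : mu.-integrable setT (fun x => (expR (dot p x))%:E).
Proof.
apply/integrableP; split.
  by apply/measurable_EFinP; apply: measurableT_comp => //; exact: measurable_dotp.
under eq_integral do rewrite gee0_abs ?lee_fin ?expR_ge0//.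
by rewrite (integral_gaussian_expR ST muS) ltry.
Qed.

Lemma integral_density (f : 'cV[R]_n -> R) : measurable_fun setT f ->
  (\int[mu]_x (f x)%:E = \int[leb R n]_x (f x * gauss S x)%:E)%E.
Proof.
move=> mf; have mef : measurable_fun setT (EFin \o f) by exact/measurable_EFinP.
rewrite integralE [RHS]integralE.
rewrite !(ge0_integral_density (@measurable_gauss _ _ S) (@gauss_ge0 _ _ S) muS)//; last 2 first.
- exact: measurable_funeneg.
- exact: measurable_funepos.
congr (_ - _)%E; apply: eq_integral => x _.
  rewrite !funeposE/= -!EFin_max -EFinM maxr_pMl ?gauss_ge0//.
  by rewrite mul0r.
rewrite !funenegE/= -!EFin_max -EFinM maxr_pMl ?gauss_ge0//.
by rewrite mul0r mulNr.
Qed.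

(** Cameron-Martin formula: weighting by exp(p . x) amounts, up to a constant, to a translation by S
    p. *)
Lemma integral_gaussian_shift p (f : 'cV[R]_n -> R) : measurable_fun setT f ->
  (forall x, `|f x| <= 1) ->
  \int[mu]_x (expR (dot p x) * f x) =
  expR (2^-1 * dot (S *m p) p) * \int[mu]_x f (x + S *m p).
Proof.
move=> mf f1.
have uS := gaussian_cov_unit muS.
have mfs : measurable_fun setT (fun x : 'cV[R]_n => f (x + S *m p)).
  by apply: (@measurableT_comp _ _ _ _ _ _ f) => //; exact: measurable_shift.
rewrite /Rintegral integral_density; last first.
  by apply: measurable_funM => //; apply: measurableT_comp => //; exact: measurable_dotp.
rewrite integral_density//.
have mh : measurable_fun setT (fun x : 'cV[R]_n => (f (x + S *m p) * gauss S x)%:E).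
  apply/measurable_EFinP; apply: measurable_funM => //; exact: measurable_gauss.
rewrite -(integral_leb_shift (- (S *m p)) mh).
have e x : expR (dot p x) * f x * gauss S x =
    expR (2^-1 * dot (S *m p) p) * (f (x + - (S *m p) + S *m p) * gauss S (x + - (S *m p))).
  rewrite subrK mulrAC [RHS]mulrCA [RHS]mulrC; congr (_ * _).
  rewrite /gauss mulrCA [RHS]mulrCA -!expRD; congr (_ * expR _).
  rewrite !(mulmxDr, mulmxN) !(dotDl, dotDr, dotNl, dotNr).
  have -> : invmx S *m (S *m p) = p by rewrite mulKmx.
  have -> : dot (invmx S *m x) (S *m p) = dot p x.
    by rewrite dot_mull trmx_inv ST mulKmx// dotC.
  by rewrite (dotC (S *m p)); field.
have ih : (leb R n).-integrable setT (fun x : 'cV[R]_n => (f (x + - (S *m p) + S *m p) *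
    gauss S (x + - (S *m p)))%:E).
  have mgS : measurable_fun setT (fun x : 'cV[R]_n => (gauss S x)%:E).
    by apply/measurable_EFinP; exact: measurable_gauss.
  have mgs : measurable_fun setT (fun x : 'cV[R]_n => (gauss S (x + - (S *m p)))%:E).
    exact: (measurableT_comp mgS (measurable_shift _)).
  apply/integrableP; split.
    exact: (measurableT_comp mh (measurable_shift (- (S *m p)))).
  apply: (@le_lt_trans _ _ (\int[leb R n]_x (gauss S (x + - (S *m p)))%:E)%E).
    apply: ge0_le_integral => //.
    - apply: measurableT_comp => //; exact: (measurableT_comp mh (measurable_shift (- (S *m p)))).
    - by move=> x _; rewrite lee_fin normrM (ger0_norm (gauss_ge0 _ _)) -[leRHS]mul1r ler_wpM2r ?gauss_ge0.
  rewrite (ge0_integral_leb_shift (- (S *m p)) mgS); last by move=> x; rewrite lee_fin gauss_ge0.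
  by rewrite -muS// probability_setT ltry.
under eq_integral do rewrite e EFinM.
rewrite integralZl// fineM//.
exact: integrable_fin_num.
Qed.

Let cos1 (t : R) : `|cos t| <= 1. Proof. by rewrite ler_norml cos_geN1 cos_le1. Qed.
Let sin1 (t : R) : `|sin t| <= 1. Proof. by rewrite ler_norml sin_geN1 sin_le1. Qed.

Section fourier.
Variable q : 'cV[R]_n.
Let s := dot (S *m q) q.
Let w x := dot q x.

Let mw : measurable_fun setT w. Proof. exact: measurable_dotp. Qed.

(** Dominates w exp(r w) for |r| < 1, because |w| <= exp |w| and exp(2 |w|) is one of the two
    summands. *)
Let G x := expR (dot (2 *: q) x) + expR (dot (- 2 *: q) x).

Let intG : mu.-integrable setT (EFin \o G).
Proof.
rewrite (_ : _ \o _ = (fun x => (expR (dot (2 *: q) x))%:E + (expR (dot (- 2 *: q) x))%:E)%E)//.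
by apply: integrableD => //; exact: integrable_gaussian_expR.
Qed.

Let wG (r : R) x c : `|r| < 1 -> `|c| <= 1 -> `|w x * expR (r * w x) * c| <= G x.
Proof.
move=> r1 c1; rewrite normrM -[leRHS]mulr1; apply: ler_pM => //.
rewrite normrM (ger0_norm (expR_ge0 _)) /G !dotZl -/(w x).
apply: (@le_trans _ _ (expR (2 * `|w x|))).
  rewrite (_ : 2 * `|w x| = `|w x| + `|w x|); last by ring.
  rewrite expRD; apply: ler_pM => //; rewrite ?expR_ge0//.
    by apply: le_trans (expR_ge1Dx _); rewrite lerDr.
  rewrite ler_expR; apply: le_trans (ler_norm _) _; rewrite normrM.
  by rewrite -[leRHS]mul1r ler_wpM2r// ltW.
have [w0|w0] := ger0P (w x).
  by rewrite lerDl expR_ge0.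
by rewrite mulrN -mulNr lerDr expR_ge0.
Qed.

Let C h := \int[mu]_x cos (h * w x).
Let D h := \int[mu]_x sin (h * w x).
Let M1 h := \int[mu]_x (w x * cos (h * w x)).
Let M2 h := \int[mu]_x (w x * sin (h * w x)).

Let mcos (h c : R) : measurable_fun setT (fun x : 'cV[R]_n => cos (h * w x + c)).
Proof.
apply: measurableT_comp; last by apply: measurable_funD => //; exact: measurable_funM.
by apply: continuous_measurable_fun; exact: continuous_cos.
Qed.

Let msin (h c : R) : measurable_fun setT (fun x : 'cV[R]_n => sin (h * w x + c)).
Proof.
apply: measurableT_comp; last by apply: measurable_funD => //; exact: measurable_funM.
by apply: continuous_measurable_fun; exact: continuous_sin.
Qed.

Let inte (r : R) (f : 'cV[R]_n -> R) : measurable_fun setT f -> (forall x, `|f x| <= 1) ->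
  mu.-integrable setT (fun x => (expR (r * w x) * f x)%:E).
Proof.
move=> mf f1; apply: (le_integrable measurableT _ _ (integrable_gaussian_expR (r *: q))).
  apply/measurable_EFinP; apply: measurable_funM => //; apply: measurableT_comp => //.
  exact: measurable_funM.
move=> x _; rewrite /= lee_fin normrM !(ger0_norm (expR_ge0 _)) dotZl -/(w x).
by rewrite -[leRHS]mulr1 ler_wpM2l ?expR_ge0.
Qed.

Let intb (f : 'cV[R]_n -> R) : measurable_fun setT f -> (forall x, `|f x| <= 1) ->
  mu.-integrable setT (EFin \o f).
Proof.
move=> mf f1; have := inte 0 mf f1.
by congr (mu.-integrable _ _); apply/funext => x; rewrite mul0r expR0 mul1r.
Qed.

Let mcos0 h : measurable_fun setT (fun x : 'cV[R]_n => cos (h * w x)).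
Proof. by have := mcos h 0; congr measurable_fun; apply/funext => x; rewrite addr0. Qed.

Let msin0 h : measurable_fun setT (fun x : 'cV[R]_n => sin (h * w x)).
Proof. by have := msin h 0; congr measurable_fun; apply/funext => x; rewrite addr0. Qed.

Let int_cosD (h c : R) : \int[mu]_x cos (h * w x + c) = C h * cos c - D h * sin c.
Proof.
have ic := intb (mcos0 h) (fun x => cos1 _).
have isn := intb (msin0 h) (fun x => sin1 _).
under eq_Rintegral do rewrite cosD.
rewrite RintegralB//; last 2 first.
- have := integrableZr measurableT (cos c) ic.
  by congr (mu.-integrable _ _); apply/funext => x.
- have := integrableZr measurableT (sin c) isn.
  by congr (mu.-integrable _ _); apply/funext => x.
by rewrite !RintegralZr.
Qed.

(** Gaussian integration by parts: the integral of exp(r w) cos(h w + c) is differentiated at r = 0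
    in two ways, under the integral sign and after [integral_gaussian_shift] has made its dependence
    on r explicit. The phase c serves the sine and the cosine at once. *)
Let ME h c : \int[mu]_x (w x * cos (h * w x + c)) = - (h * s) * (C h * sin c + D h * cos c).
Proof.
have d1 : is_derive (0 : R) (1 : R)
    (fun r => \int[mu]_x (expR (r * w x) * cos (h * w x + c)))
    (\int[mu]_x (w x * cos (h * w x + c))).
  have -> : \int[mu]_x (w x * cos (h * w x + c)) =
      \int[mu]_x (w x * expR (0 * w x) * cos (h * w x + c)).
    by apply: eq_Rintegral => x _; rewrite mul0r expR0 mulr1.
  apply: (is_derive_integral _ _ intG (f' := fun r x => w x * expR (r * w x) * cos (h * w x + c))).
  - by move=> r; apply: inte => // x; exact: cos1.
  - by move=> r x; apply: is_derive_eq; rewrite /GRing.scale/=; ring.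
  - by move=> r x; rewrite subr0 => r1; exact: wG.
have E r : \int[mu]_x (expR (r * w x) * cos (h * w x + c)) =
    expR (2^-1 * r ^+ 2 * s) * (C h * cos (h * r * s + c) - D h * sin (h * r * s + c)).
  transitivity (\int[mu]_x (expR (dot (r *: q) x) * cos (h * w x + c))).
    by apply: eq_Rintegral => x _; rewrite dotZl.
  rewrite (integral_gaussian_shift (r *: q) (mcos h c)); last by move=> x; exact: cos1.
  rewrite -scalemxAr dotZl dotZr -/s; congr (expR _ * _); first by ring.
  rewrite -int_cosD; apply: eq_Rintegral => x _; congr cos.
  by rewrite /w dotDr dotZr (dotC q (S *m q)) -/s; ring.
have d2 : is_derive (0 : R) (1 : R)
    (fun r => \int[mu]_x (expR (r * w x) * cos (h * w x + c)))
    (- (h * s) * (C h * sin c + D h * cos c)).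
  rewrite (_ : (fun _ => _) = (fun r => expR (2^-1 * r ^+ 2 * s) * (C h * cos (h * r * s + c) - D h * sin (h * r * s + c)))).
    apply: is_derive_eq; rewrite /GRing.scale/= !(mulr0, mul0r, add0r) expr0n/= !(mulr0,mul0r) expR0; ring.
  by apply/funext => r; rewrite E.
by have [_ <-] := d1; have [_ <-] := d2.
Qed.

Let dC h : is_derive h (1 : R) C (- (h * s) * C h).
Proof.
have -> : - (h * s) * C h = \int[mu]_x (- (w x * sin (h * w x))).
  transitivity (\int[mu]_x (w x * cos (h * w x + pi / 2))).
    by rewrite ME sin_pihalf cos_pihalf; ring.
  by apply: eq_Rintegral => x _; rewrite cosDpihalf mulrN.
apply: (is_derive_integral _ _ intG (f' := fun h x => - (w x * sin (h * w x)))).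
- by move=> x; apply: intb => // y; exact: cos1.
- by move=> x y; apply: is_derive_eq; rewrite /GRing.scale/=; ring.
- move=> x y _; rewrite normrN; have := @wG 0 y (sin (x * w y)).
  by rewrite normr0 mul0r expR0 mulr1 ltr01 => /(_ isT (sin1 _)).
Qed.

Let dD h : is_derive h (1 : R) D (- (h * s) * D h).
Proof.
have -> : - (h * s) * D h = \int[mu]_x (w x * cos (h * w x)).
  transitivity (\int[mu]_x (w x * cos (h * w x + 0))).
    by rewrite ME sin0 cos0; ring.
  by apply: eq_Rintegral => x _; rewrite addr0.
apply: (is_derive_integral _ _ intG (f' := fun h x => w x * cos (h * w x))).
- by move=> x; apply: intb => // y; exact: sin1.
- by move=> x y; apply: is_derive_eq; rewrite /GRing.scale/=; ring.
- move=> x y _; have := @wG 0 y (cos (x * w y)).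
  by rewrite normr0 mul0r expR0 mulr1 ltr01 => /(_ isT (cos1 _)).
Qed.

(** The integrating factor is exp(h^2 s / 2). *)
Let gauss_ode (Y : R -> R) : (forall h, is_derive h (1 : R) Y (- (h * s) * Y h)) ->
  Y 1 = Y 0 * expR (- 2^-1 * s).
Proof.
move=> dY; pose Z h := Y h * expR (2^-1 * h ^+ 2 * s).
have dZ h : is_derive h (1 : R) Z 0.
  by apply: is_derive_eq; rewrite /GRing.scale/=; field.
have : Z 1 = Z 0 by apply: is_derive_0_is_cst => h; exact: dZ.
rewrite /Z expr0n expr1n/= mulr0 mul0r expR0 mulr1 mulr1 => <-.
by rewrite -mulrA -expRD (_ : _ + _ = 0) ?expR0 ?mulr1//; ring.
Qed.

Lemma integral_gaussian_cos c :
  \int[mu]_x cos (dot q x + c) = expR (- 2^-1 * dot (S *m q) q) * cos c.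
Proof.
transitivity (\int[mu]_x cos (1 * w x + c)).
  by apply: eq_Rintegral => x _; rewrite mul1r.
rewrite int_cosD (gauss_ode dC) (gauss_ode dD).
have -> : C 0 = 1.
  transitivity (\int[mu]_x (cst 1 x)).
    by apply: eq_Rintegral => x _; rewrite mul0r cos0.
  by rewrite Rintegral_cst//= mul1r probability_setT.
have -> : D 0 = 0.
  transitivity (\int[mu]_x (cst 0 x)).
    by apply: eq_Rintegral => x _; rewrite mul0r sin0.
  by rewrite /Rintegral integral0.
by rewrite -/s; ring.
Qed.

End fourier.

Lemma integral_gaussian_expR_cos p q c :
  \int[mu]_x (expR (dot p x) * cos (dot q x + c)) =
  expR (2^-1 * (dot (S *m p) p - dot (S *m q) q)) * cos (dot (S *m p) q + c).
Proof.
have mq : measurable_fun setT (fun x : 'cV[R]_n => cos (dot q x + c)).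
  have mq : measurable_fun setT (fun x : 'cV[R]_n => dot q x + c).
    by apply: measurable_funD => //; exact: measurable_dotp.
  apply: (measurableT_comp _ mq).
  by apply: continuous_measurable_fun; exact: continuous_cos.
rewrite (integral_gaussian_shift p mq (fun x => cos1 _)).
transitivity (expR (2^-1 * dot (S *m p) p) * \int[mu]_x cos (dot q x + (dot (S *m p) q + c))).
  by congr (_ * _); apply: eq_Rintegral => x _; rewrite dotDr (dotC q (S *m p)) addrA.
rewrite integral_gaussian_cos mulrA -expRD; congr (expR _ * _); ring.
Qed.

End gaussian_fourier.

(** * Integration by parts against test functions *)

Section borel_cV.
Context {R : realType} {n : nat}.

Let qbox (p : 'cV[rat]_n * nat) : set 'cV[R]_n :=
  [set x | forall i, `|ratr (p.1 i 0) - x i 0| < p.2.+1%:R^-1].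

Let measurable_qbox p : measurable (qbox p).
Proof.
have -> : qbox p = \big[setI/setT]_(i < n)
    ((fun x : 'cV[R]_n => x i 0) @^-1` [set t | `|ratr (p.1 i 0) - t| < p.2.+1%:R^-1]).
  rewrite -bigcap_seq; apply/seteqP; split => [x Ax i _|x Ax i]; first exact: Ax.
  by apply: Ax => /=; rewrite mem_index_enum.
apply: bigsetI_measurable => i _; rewrite -[X in measurable X]setTI.
apply: (@measurable_coord R n i) => //.
rewrite (_ : [set t | _] = `]ratr (p.1 i 0) - p.2.+1%:R^-1, ratr (p.1 i 0) + p.2.+1%:R^-1[%classic)//.
move: (p.2.+1%:R^-1 : R) (ratr (p.1 i 0) : R) => e r.
by apply/seteqP; split => t /=; rewrite in_itv/= ltr_norml => /andP[h1 h2];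
  apply/andP; split; lra.
Qed.

(** The sigma-algebra is generated by the coordinates; an open set is a countable union of cubes
    with rational centres and radii 1 / (k + 1). *)
Lemma open_measurable_cV (U : set 'cV[R]_n) : open U -> measurable U.
Proof.
move=> oU.
pose F k := if unpickle k is Some p then
  if `[< qbox p `<=` U >] then qbox p else set0 else set0.
have -> : U = \bigcup_k F k.
  apply/seteqP; split => [x Ux|x [k _]].
    have /nbhs_ballP[e /= e0 eU] : nbhs x U by exact: open_nbhs_nbhs.
    (* Half of e, because two points of a cube may be nearly twice its radius apart. *)
    have [k ke] : exists k, k.+1%:R^-1 < e / 2.
      have [k _ hk] := near_infty_natSinv_lt (PosNum (divr_gt0 e0 (ltr0n R 2))).
      by exists k; apply: hk => /=.
    have rx i : exists r : rat, `|ratr r - x i 0| < k.+1%:R^-1.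
      have /rat_in_itvoo[r] : x i 0 - k.+1%:R^-1 < x i 0 + k.+1%:R^-1.
        by rewrite ltrD2l gtrN// invr_gt0.
      rewrite in_itv/= => /andP[h1 h2]; exists r; move: h1 h2.
      by move: (k.+1%:R^-1 : R) (ratr r : R) => d a h1 h2; rewrite ltr_norml; apply/andP; split; lra.
    have [q hq] := choice rx.
    pose p : 'cV[rat]_n * nat := (\col_i q i, k).
    have px : qbox p x by move=> i; rewrite /= mxE; exact: hq.
    exists (pickle p) => //; rewrite /F pickleK asboolT// => y py.
    apply: eU; split => // i j; rewrite (ord1 j) /ball/=.
    have := px i; have := py i; rewrite /= !mxE => h1 h2.
    have -> : x i 0 - y i 0 = (ratr (q i) - y i 0) - (ratr (q i) - x i 0) by ring.
    apply: le_lt_trans (ler_normB _ _) _.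
    by move: h1 h2 ke; move: (k.+1%:R^-1 : R) => a h1 h2 ke; lra.
  rewrite /F; case: unpickle => [p|//]; case: ifPn => // /asboolP; exact.
apply: bigcup_measurable => k _; rewrite /F.
by case: unpickle => [p|//]; case: ifPn.
Qed.

Lemma continuous_measurable_cV (f : 'cV[R]_n -> R) :
  continuous f -> measurable_fun setT f.
Proof.
move=> cf; apply: (measurability _ (RGenOpens.measurableE R)).
move=> /= _ [_ [a [b ->]] <-]; rewrite setTI; apply: open_measurable_cV.
by apply: open_comp => //; move=> x _; exact: cf.
Qed.

End borel_cV.

Section compact_support.
Context {R : realType} {n : nat}.
Implicit Types (K : set 'cV[R]_n) (f g : 'cV[R]_n -> R).

Definition cbox (r : R) : set 'cV[R]_n := [set x | forall i, `[- r, r]%classic (x i 0)].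

Lemma measurable_cbox r : measurable (cbox r).
Proof.
have -> : cbox r = \big[setI/setT]_(i < n) ((fun x : 'cV[R]_n => x i 0) @^-1` `[- r, r]%classic).
  rewrite -bigcap_seq; apply/seteqP; split => [x Ax i _|x Ax i]; first exact: Ax.
  by apply: Ax => /=; rewrite mem_index_enum.
apply: bigsetI_measurable => i _; rewrite -[X in measurable X]setTI.
exact: (@measurable_coord R n i).
Qed.

Lemma leb_cbox_lty r : (leb R n (cbox r) < +oo)%E.
Proof.
rewrite (leb_box (A := fun=> `[- r, r]%classic)) => [|i]; last exact: measurable_itv.
rewrite ltey_eq; apply/orP; left.
apply: (big_ind (fun x : \bar R => x \is a fin_num)) => [//|x y|i _].
  exact: fin_numM.
by rewrite lebesgue_measure_itv/=; case: ifPn => _; rewrite -?EFinB.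
Qed.

Lemma compact_cbox K : compact K -> exists r, K `<=` cbox r.
Proof.
move=> /compact_bounded/ex_strict_bound_gt0[r r0 Kr]; exists r => x Kx i /=.
have := Kr _ Kx; rewrite /= [ltLHS]/Num.norm /= => h.
rewrite in_itv/= -ler_norml; apply: le_trans (ltW h).
by rewrite mx_normrE; apply/bigmax_geP; right; exists (i, 0).
Qed.

Lemma compact_support_bounded K f : continuous f -> compact K ->
  (forall x, ~ K x -> f x = 0) -> exists2 M, 0 <= M & forall x, `|f x| <= M.
Proof.
move=> cf cK f0.
have /compact_bounded/ex_strict_bound_gt0[M M0 KM] : compact (f @` K).
  by apply: continuous_compact => //; exact: continuous_subspaceT.
exists M => [|x]; first exact: ltW.
have [Kx|/f0 ->] := pselect (K x); last by rewrite normr0 ltW.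
by apply: ltW; apply: KM; exists x.
Qed.

Lemma integrable_cbox_cst r (M : R) :
  (leb R n).-integrable setT (EFin \o ((cst M) \_ (cbox r))).
Proof.
have mB := measurable_cbox r.
have : (leb R n).-integrable (cbox r) (EFin \o cst M).
  apply: measurable_bounded_integrable => //; first exact: leb_cbox_lty.
  by exists `|M|; split; [exact: num_real|move=> N MN x _; exact: ltW].
move/(integrable_mkcond _ mB); congr (_.-integrable _ _).
by apply/funext => x; rewrite /= /patch; case: ifP.
Qed.

Lemma integrable_support K f (M : R) : measurable_fun setT f -> compact K ->
  (forall x, ~ K x -> f x = 0) -> (forall x, `|f x| <= M) ->
  (leb R n).-integrable setT (EFin \o f).
Proof.
move=> mf /compact_cbox[r Kr] f0 fM.
apply: (le_integrable measurableT _ _ (integrable_cbox_cst r M)).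
  exact/measurable_EFinP.
move=> x _; rewrite /= lee_fin patchE; case: ifPn => xr.
  exact: le_trans (fM x) (ler_norm _).
by rewrite f0 ?normr0// => /Kr; rewrite -falseE -(negbTE xr) inE.
Qed.

Lemma is_derive_shift (g : 'cV[R]_n -> R) (v x : 'cV[R]_n) (h : R) :
  derivable g (x + h *: v) v ->
  is_derive h (1 : R) (fun h => g (x + h *: v)) ('D_v g (x + h *: v)).
Proof.
move=> dg.
have E : (fun k : R => k^-1 *: (((fun h => g (x + h *: v)) \o shift h) (k *: 1) - g (x + h *: v)))
   = (fun k : R => k^-1 *: ((g \o shift (x + h *: v)) (k *: v) - g (x + h *: v))).
  apply/funext => k /=; congr (_ *: (g _ - _)).
  have -> : k *: (1 : R) = k by rewrite /GRing.scale/= mulr1.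
  by rewrite scalerDl addrCA.
split; first by rewrite /derivable E.
by rewrite /derive E.
Qed.

(** By translation invariance the integral of g(x + h e_i) does not depend on h; its derivative at h
    = 0, taken under the integral sign, is the left side. *)
Lemma integral_partial0 (g : 'cV[R]_n -> R) K i : continuous g -> compact K ->
  (forall x, ~ K x -> g x = 0) ->
  (forall x, derivable g x (delta_mx i 0)) ->
  continuous (partial i g) -> (forall x, ~ K x -> partial i g x = 0) ->
  \int[leb R n]_x partial i g x = 0.
Proof.
move=> cg cK g0 dg cdg dg0.
have mg := continuous_measurable_cV cg.
have mdg := continuous_measurable_cV cdg.
have [M M0 gM] := compact_support_bounded cg cK g0.
have [M' M'0 gM'] := compact_support_bounded cdg cK dg0.
have [r Kr] := compact_cbox cK.
pose v : 'cV[R]_n := delta_mx i 0.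
have sh (f : 'cV[R]_n -> R) h : measurable_fun setT f ->
    \int[leb R n]_x f (x + h *: v) = \int[leb R n]_x f x.
  move=> mf; rewrite /Rintegral; congr fine.
  by apply: (integral_leb_shift (h *: v) (f := EFin \o f)); exact/measurable_EFinP.
have ig : (leb R n).-integrable setT (EFin \o g) by exact: (integrable_support mg cK g0 gM).
(* For |h| < 1 the translates of the support stay in the box enlarged by 1, which gives an
   integrable bound. *)
have := @is_derive_integral _ _ R (leb R n) (fun h x => g (x + h *: v))
  (fun h x => partial i g (x + h *: v)) ((cst M') \_ (cbox (r + 1))) 0.
have sK (h : R) (x : 'cV[R]_n) : `|h - 0| < 1 -> K (x + h *: v) -> cbox (r + 1) x.
  rewrite subr0 ltr_norml => /andP[h1 h2] /Kr xr k; have := xr k.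
  rewrite /= !in_itv/= !mxE => /andP[].
  by case: (k == i) => /=; rewrite ?mulr1 ?mulr0 => ? ?; apply/andP; split; lra.
have ish h : (leb R n).-integrable setT (EFin \o (fun x => g (x + h *: v))).
  apply/integrableP; split.
    by apply/measurable_EFinP; exact: (measurableT_comp mg (measurable_shift _)).
  have /integrableP[m1] := ig.
  rewrite -(ge0_integral_leb_shift (h *: v))//.
  exact: measurableT_comp.
move=> H; have := H ish (fun h x => is_derive_shift (dg _)) (integrable_cbox_cst _ _) _.
have -> : (fun h : R => \int[leb R n]_x g (x + h *: v)) = cst (\int[leb R n]_x g x).
  by apply/funext => h; rewrite sh.
rewrite sh// => {}H.
have [|_] := H _.
  move=> h x h1; rewrite patchE; have [xK|xK] := pselect (K (x + h *: v)).
    by rewrite mem_set//; exact: sK h1 xK.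
  by rewrite dg0// normr0; case: ifP.
by rewrite derive_cst.
Qed.

Lemma integration_by_parts_partial f f' psi K i : continuous f -> continuous f' ->
  (forall x, is_derive x (delta_mx i 0 : 'cV[R]_n) f (f' x)) ->
  compact K -> continuous psi -> continuous (partial i psi) ->
  (forall x, derivable psi x (delta_mx i 0)) ->
  (forall x, ~ K x -> psi x = 0) -> (forall x, ~ K x -> partial i psi x = 0) ->
  \int[leb R n]_x (f x * partial i psi x) = - \int[leb R n]_x (f' x * psi x).
Proof.
move=> cf cf' df cK cp cdp dp p0 dp0.
pose g x := f x * psi x.
have dg x : is_derive x (delta_mx i 0 : 'cV[R]_n) g (f x * partial i psi x + f' x * psi x).
  have h := is_deriveM (df x) (derivableP (dp x)).
  by apply: (is_derive_eq h); rewrite /GRing.scale/= /partial; ring.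
have pgE : partial i g = fun x => f x * partial i psi x + f' x * psi x.
  by apply/funext => x; have [_ <-] := dg x.
have c1 : continuous (fun x => f x * partial i psi x).
  by move=> x; exact: (cvgM (cf x) (cdp x)).
have c2 : continuous (fun x => f' x * psi x).
  by move=> x; exact: (cvgM (cf' x) (cp x)).
have z1 x : ~ K x -> f x * partial i psi x = 0 by move=> /dp0 ->; rewrite mulr0.
have z2 x : ~ K x -> f' x * psi x = 0 by move=> /p0 ->; rewrite mulr0.
have [M1 _ b1] := compact_support_bounded c1 cK z1.
have [M2 _ b2] := compact_support_bounded c2 cK z2.
have i1 := integrable_support (continuous_measurable_cV c1) cK z1 b1.
have i2 := integrable_support (continuous_measurable_cV c2) cK z2 b2.
have cg : continuous g by move=> x; exact: (cvgM (cf x) (cp x)).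
have g0 x : ~ K x -> g x = 0 by move=> /p0 px; rewrite /g px mulr0.
have dgx x : derivable g x (delta_mx i 0) by have [] := dg x.
have cpg : continuous (partial i g).
  by rewrite pgE => x; exact: (cvgD (c1 x) (c2 x)).
have pg0 x : ~ K x -> partial i g x = 0.
  by move=> nK; rewrite pgE (z1 _ nK) (z2 _ nK) addr0.
have := integral_partial0 cg cK g0 dgx cpg pg0.
by rewrite pgE RintegralD// => /eqP; rewrite addr_eq0 => /eqP.
Qed.

End compact_support.

(** * Complex exponentials and directional derivatives *)

Section directional.
Context {R : realType} {n : nat}.

Lemma is_derive_line (g : 'cV[R]_n -> R) (v x : 'cV[R]_n) (d : R) :
  is_derive (0 : R) (1 : R) (fun h => g (x + h *: v)) d -> is_derive x v g d.
Proof.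
move=> [dg dE].
have E : (fun k : R => k^-1 *: (((fun h => g (x + h *: v)) \o shift 0) (k *: 1) - g (x + 0 *: v)))
   = (fun k : R => k^-1 *: ((g \o shift x) (k *: v) - g x)).
  apply/funext => k /=; congr (_ *: (g _ - g _)).
  - have -> : k *: (1 : R) = k by rewrite /GRing.scale/= mulr1.
    by rewrite addr0 addrC.
  - by rewrite scale0r addr0.
split; first by move: dg; rewrite /derivable E.
by rewrite -dE /derive E.
Qed.

Lemma partial_eq0 (K : set 'cV[R]_n) (g : 'cV[R]_n -> R) i : closed K ->
  (forall x, ~ K x -> g x = 0) -> forall x, ~ K x -> partial i g x = 0.
Proof.
move=> cK g0 x nKx; rewrite /partial.
have oK : open (~` K) by exact: closed_openC.
have nK : nbhs x (~` K) by exact: open_nbhs_nbhs.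
rewrite -(derive_cst (0 : R) x (delta_mx i 0)).
apply: near_eq_derive.
by apply: filterS nK => y /g0.
Qed.

Lemma continuous_coord (j : 'I_n) : continuous (fun x : 'cV[R]_n => x j 0).
Proof. exact: coord_continuous. Qed.

Lemma is_derive_coord (x v : 'cV[R]_n) (j : 'I_n) :
  is_derive x v (fun x : 'cV[R]_n => x j 0) (v j 0).
Proof.
apply: is_derive_line; under eq_fun do rewrite !mxE.
by apply: is_derive_eq; rewrite /GRing.scale/=; ring.
Qed.

(** Real part of exp((a + i b) . x + c + i d). Replacing d by d - pi / 2 gives its imaginary part,
    so complex exponentials are handled as pairs of real functions differing by a phase. *)
Definition cexp (a b : 'cV[R]_n) (c d : R) (x : 'cV[R]_n) : R :=
  expR (dot a x + c) * cos (dot b x + d).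

Lemma continuous_dotr (a : 'cV[R]_n) : continuous (dot a).
Proof.
by apply: continuous_dot => i; [exact: cst_continuous|exact: continuous_coord].
Qed.

Lemma continuous_cexp a b c d : continuous (cexp a b c d).
Proof.
have h (p : 'cV[R]_n) (k : R) : continuous (fun x => dot p x + k).
  by move=> x; exact: (cvgD (@continuous_dotr p x) (cvg_cst k)).
have h1 : continuous (expR \o (fun x => dot a x + c)).
  by move=> x; apply: continuous_comp; [exact: h|exact: continuous_expR].
have h2 : continuous (cos \o (fun x => dot b x + d)).
  by move=> x; apply: continuous_comp; [exact: h|exact: continuous_cos].
by move=> x; exact: (cvgM (h1 x) (h2 x)).
Qed.

Lemma is_derive_cexp a b c d (x : 'cV[R]_n) i :
  is_derive x (delta_mx i 0 : 'cV[R]_n) (cexp a b c d)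
    (a i 0 * cexp a b c d x - b i 0 * cexp a b c (d - pi / 2) x).
Proof.
apply: is_derive_line; rewrite /cexp.
under eq_fun do rewrite !dotDr !dotZr !dot_delta.
apply: is_derive_eq; rewrite /GRing.scale/= !(mul0r, addr0) addrA cosBpihalf.
by ring.
Qed.

Lemma continuous_cexp_deriv (a b : 'cV[R]_n) (c d : R) i :
  continuous (fun x : 'cV[R]_n => a i 0 * cexp a b c d x - b i 0 * cexp a b c (d - pi / 2) x).
Proof.
move=> x; have h1 := @continuous_cexp a b c d x.
have h2 := @continuous_cexp a b c (d - pi / 2) x.
exact: (cvgB (cvgM (cvg_cst (a i 0)) h1) (cvgM (cvg_cst (b i 0)) h2)).
Qed.

End directional.

(** * Integration by parts of exponentials against a test function *)

Section test_functions.
Context {R : realType} {n : nat} (phi : 'cV[R]_n -> R).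
Hypothesis tphi : test_function phi.

Definition tsupp : set 'cV[R]_n := closure [set x | phi x != 0].
Local Notation K := tsupp.

Lemma compact_tsupp : compact K. Proof. by case: tphi. Qed.

Let closedK : closed K. Proof. exact: closed_closure. Qed.

Lemma test_continuous s : continuous (foldr partial phi s).
Proof. by have [/(_ s)[]] := tphi. Qed.

Lemma test_derivable s i x : derivable (foldr partial phi s) x (delta_mx i 0).
Proof. by have [/(_ s)[_ h] _] := tphi; exact: h. Qed.

Lemma test_eq0 s x : ~ K x -> foldr partial phi s x = 0.
Proof.
elim: s x => [|i s IH] x; last exact: partial_eq0.
move=> nK; apply/eqP/negPn/negP => px; apply: nK.
exact: subset_closure.
Qed.

Lemma is_derive_coordM i j x : is_derive x (delta_mx i 0 : 'cV[R]_n)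
  (fun x : 'cV[R]_n => x j 0 * phi x) ((j == i)%:R * phi x + x j 0 * partial i phi x).
Proof.
have := is_deriveM (is_derive_coord x (delta_mx i 0) j) (derivableP (@test_derivable [::] i x)).
by move=> h; apply: (is_derive_eq h); rewrite mxE eqxx andbT /GRing.scale/= /partial; ring.
Qed.

Lemma partial_coordM i j : partial i (fun x : 'cV[R]_n => x j 0 * phi x) =
  fun x => (j == i)%:R * phi x + x j 0 * partial i phi x.
Proof. by apply/funext => x; have [_ <-] := is_derive_coordM i j x. Qed.

Lemma continuous_partial_coordM i j :
  continuous (partial i (fun x : 'cV[R]_n => x j 0 * phi x)).
Proof.
rewrite partial_coordM => x.
have h1 := @test_continuous [::] x; have h2 := @test_continuous [:: i] x.
exact: (cvgD (cvgM (cvg_cst ((j == i)%:R : R)) h1) (cvgM (@continuous_coord R n j x) h2)).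
Qed.

Lemma partial_coordM_eq0 i j x : ~ K x -> partial i (fun x : 'cV[R]_n => x j 0 * phi x) x = 0.
Proof.
move=> nK; rewrite partial_coordM; have /= -> := @test_eq0 [::] x nK.
by have /= -> := @test_eq0 [:: i] x nK; rewrite !mulr0 addr0.
Qed.

Lemma IBP_cexp1 a b c d i s :
  \int[leb R n]_x (cexp a b c d x * partial i (foldr partial phi s) x) =
  - \int[leb R n]_x ((a i 0 * cexp a b c d x - b i 0 * cexp a b c (d - pi / 2) x)
      * foldr partial phi s x).
Proof.
have d0 x : derivable (foldr partial phi s) x (delta_mx i 0) := @test_derivable s i x.
have z0 x : ~ K x -> foldr partial phi s x = 0 := @test_eq0 s x.
have z1 x : ~ K x -> partial i (foldr partial phi s) x = 0 := @test_eq0 (i :: s) x.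
have c0 : continuous (foldr partial phi s) := @test_continuous s.
have c1 : continuous (partial i (foldr partial phi s)) := @test_continuous (i :: s).
exact: (integration_by_parts_partial (@continuous_cexp R n a b c d)
  (@continuous_cexp_deriv R n a b c d i) (fun x => @is_derive_cexp R n a b c d x i) compact_tsupp
  c0 c1 d0 z0 z1).
Qed.

Lemma IBP_cexp_coord a b c d i j :
  \int[leb R n]_x (cexp a b c d x * partial i (fun x : 'cV[R]_n => x j 0 * phi x) x) =
  - \int[leb R n]_x ((a i 0 * cexp a b c d x - b i 0 * cexp a b c (d - pi / 2) x)
      * (x j 0 * phi x)).
Proof.
have c0 : continuous (fun x : 'cV[R]_n => x j 0 * phi x).
  by move=> x; have h := @test_continuous [::] x; exact: (cvgM (@continuous_coord R n j x) h).
have d0 x : derivable (fun x : 'cV[R]_n => x j 0 * phi x) x (delta_mx i 0).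
  by have [] := is_derive_coordM i j x.
have z0 x : ~ K x -> x j 0 * phi x = 0.
  by move=> nK; have /= -> := @test_eq0 [::] x nK; rewrite mulr0.
exact: (integration_by_parts_partial (@continuous_cexp R n a b c d)
  (@continuous_cexp_deriv R n a b c d i) (fun x => @is_derive_cexp R n a b c d x i) compact_tsupp
  c0 (@continuous_partial_coordM i j) d0 z0 (@partial_coordM_eq0 i j)).
Qed.

Lemma integrable_tsupp (f psi : 'cV[R]_n -> R) : continuous f -> continuous psi ->
  (forall x, ~ K x -> psi x = 0) ->
  (leb R n).-integrable setT (EFin \o (fun x => f x * psi x)).
Proof.
move=> cf cp p0.
have c : continuous (fun x => f x * psi x) by move=> x; exact: (cvgM (cf x) (cp x)).
have z x : ~ K x -> f x * psi x = 0 by move=> /p0 ->; rewrite mulr0.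
have [M _ b] := compact_support_bounded c compact_tsupp z.
exact: integrable_support (continuous_measurable_cV c) compact_tsupp z b.
Qed.

Lemma IBP_cexp2 a b c d i j :
  \int[leb R n]_x (cexp a b c d x * partial j (partial i phi) x) =
  \int[leb R n]_x (((a i 0 * a j 0 - b i 0 * b j 0) * cexp a b c d x
    - (a i 0 * b j 0 + a j 0 * b i 0) * cexp a b c (d - pi / 2) x) * phi x).
Proof.
have c1 := @continuous_cexp R n a b c d; have c2 := @continuous_cexp R n a b c (d - pi / 2).
have i1 := integrable_tsupp c1 (@test_continuous [:: i]) (@test_eq0 [:: i]).
have i2 := integrable_tsupp c2 (@test_continuous [:: i]) (@test_eq0 [:: i]).
have c1' := @continuous_cexp_deriv R n a b c d i.
have c2' := @continuous_cexp_deriv R n a b c (d - pi / 2) i.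
have i3 := integrable_tsupp c1' (@test_continuous [::]) (@test_eq0 [::]).
have i4 := integrable_tsupp c2' (@test_continuous [::]) (@test_eq0 [::]).
have lin (r1 r2 : R) (f1 f2 : 'cV[R]_n -> R) :
    (leb R n).-integrable setT (EFin \o f1) -> (leb R n).-integrable setT (EFin \o f2) ->
    \int[leb R n]_x (r1 * f1 x - r2 * f2 x) =
    r1 * \int[leb R n]_x f1 x - r2 * \int[leb R n]_x f2 x.
  move=> if1 if2; rewrite RintegralB//; first by rewrite !RintegralZl.
    by have := integrableZl measurableT r1 if1; congr (_.-integrable _ _).
  by have := integrableZl measurableT r2 if2; congr (_.-integrable _ _).
rewrite (@IBP_cexp1 a b c d j [:: i]).
have -> : \int[leb R n]_x ((a j 0 * cexp a b c d x - b j 0 * cexp a b c (d - pi / 2) x)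
      * foldr partial phi [:: i] x) =
    \int[leb R n]_x (a j 0 * (cexp a b c d x * foldr partial phi [:: i] x)
      - b j 0 * (cexp a b c (d - pi / 2) x * foldr partial phi [:: i] x)).
  by apply: eq_Rintegral => x _; ring.
rewrite lin//= (@IBP_cexp1 a b c d i [::]) (@IBP_cexp1 a b c (d - pi / 2) i [::])/=.
transitivity (a j 0 * \int[leb R n]_x ((a i 0 * cexp a b c d x - b i 0 * cexp a b c (d - pi / 2) x) * phi x)
  - b j 0 * \int[leb R n]_x ((a i 0 * cexp a b c (d - pi / 2) x - b i 0 * cexp a b c (d - pi / 2 - pi / 2) x) * phi x)).
  by ring.
rewrite -lin//; apply: eq_Rintegral => x _.
have -> : cexp a b c (d - pi / 2 - pi / 2) x = - cexp a b c d x.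
  rewrite /cexp.
  have -> : dot b x + (d - pi / 2 - pi / 2) = (dot b x + d - pi / 2) - pi / 2 by rewrite !addrA.
  by rewrite cosBpihalf sinBpihalf mulrN.
by ring.
Qed.

End test_functions.

(** * Linearity of the integral, with integrability *)

Section has_int.
Context d (T : measurableType d) {R : realType} (m : {measure set T -> \bar R}).
Variables (D : set T) (mD : measurable D).
Implicit Types f g : T -> R.

(** Integrability travels with the value, so that linear identities between integrals are built by
    composing lemmas. *)
Definition has_int f (v : R) := m.-integrable D (EFin \o f) /\ \int[m]_(x in D) f x = v.

Lemma has_int_self f : m.-integrable D (EFin \o f) -> has_int f (\int[m]_(x in D) f x).
Proof. by []. Qed.

Lemma has_int_ext g f v : has_int f v -> (forall x, g x = f x) -> has_int g v.
Proof. by move=> hf gf; have -> : g = f by exact/funext. Qed.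

Lemma has_intZ k f v : has_int f v -> has_int (fun x => k * f x) (k * v).
Proof.
move=> [fi <-]; split; last exact: RintegralZl.
by have := integrableZl mD k fi; congr (_.-integrable _ _).
Qed.

Lemma has_intD f g v w : has_int f v -> has_int g w -> has_int (fun x => f x + g x) (v + w).
Proof.
move=> [fi <-] [gi <-]; split; last exact: RintegralD.
by have := integrableD mD fi gi; congr (_.-integrable _ _).
Qed.

Lemma has_intB f g v w : has_int f v -> has_int g w -> has_int (fun x => f x - g x) (v - w).
Proof.
move=> [fi <-] [gi <-]; split; last exact: RintegralB.
by have := integrableB mD fi gi; congr (_.-integrable _ _).
Qed.

Lemma has_int_sum (I : Type) (r : seq I) (f : I -> T -> R) (v : I -> R) :
  (forall l, has_int (f l) (v l)) ->
  has_int (fun x => \sum_(l <- r) f l x) (\sum_(l <- r) v l).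
Proof.
move=> hf; have [h1 h2] := @Rintegral_sumZ R _ _ m D _ r (fun=> 1) f mD (fun l => proj1 (hf l)).
split.
  by move: h1; congr (_.-integrable _ _); apply/funext => x/=; congr _%:E; apply: eq_bigr => l _; rewrite mul1r.
transitivity (\int[m]_(x in D) (\sum_(l <- r) 1 * f l x)).
  by apply: eq_Rintegral => x _; apply: eq_bigr => l _; rewrite mul1r.
by rewrite h2; apply: eq_bigr => l _; rewrite mul1r (proj2 (hf l)).
Qed.

End has_int.

(** * The operator on complex exponentials, in the sense of distributions *)

Section adjoint.
Context {R : realType} {n : nat} (Q B : 'M[R]_n).

Definition OU_weak (w phi : 'cV[R]_n -> R) : R :=
  2^-1 * (\sum_i \sum_j Q i j * \int[leb R n]_x (w x * partial j (partial i phi) x))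
  - \sum_i \sum_j B i j * \int[leb R n]_x (w x * partial i (fun x => x j 0 * phi x) x).

Lemma OU_distrE (u : 'cV[R]_n -> R[i]) phi :
  OU_distr Q B (distr_of u) phi =
  OU_weak (fun x => complex.Re (u x)) phi +i* OU_weak (fun x => complex.Im (u x)) phi.
Proof.
have cE (a b c : R) : a%:C * (b +i* c) = (a * b) +i* (a * c).
  by rewrite /real_complex_def; simpc.
have sE (F G : 'I_n -> R) : \sum_i (F i +i* G i) = (\sum_i F i) +i* (\sum_i G i) :> R[i].
  by elim/big_rec3: _ => // i x y z _ ->; simpc.
rewrite /OU_distr /distr_partial /distr_coord /distr_of /OU_weak.
under eq_bigr do under eq_bigr do rewrite opprK cE.
under eq_bigr do rewrite sE.
rewrite sE.
have nE (b c : R) : - (b +i* c) = (- b) +i* (- c) :> R[i] by simpc.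
under [X in _ + X = _]eq_bigr do under eq_bigr do rewrite nE cE.
under [X in _ + X = _]eq_bigr do rewrite sE.
rewrite sE.
have -> : 2^-1 = (2^-1 : R)%:C :> R[i] by rewrite fmorphV rmorphMn.
rewrite cE; simpc; congr (_ +i* _); congr (_ + _).
  by rewrite -sumrN; apply: eq_bigr => i _; rewrite -sumrN; apply: eq_bigr => j _; rewrite mulrN.
by rewrite -sumrN; apply: eq_bigr => i _; rewrite -sumrN; apply: eq_bigr => j _; rewrite mulrN.
Qed.

(** With alpha = a + i b, the operator multiplies exp(alpha . x) by (Q alpha) . alpha / 2 + alpha .
    (B x); the two brackets are the real and imaginary parts of this multiplier. *)
Lemma OU_weak_cexp (a b : 'cV[R]_n) (c d : R) phi : test_function phi ->
  OU_weak (cexp a b c d) phi =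
  \int[leb R n]_x (((2^-1 * (dot (Q *m a) a - dot (Q *m b) b) + dot a (B *m x)) * cexp a b c d x
    - (2^-1 * (dot (Q *m a) b + dot (Q *m b) a) + dot b (B *m x)) * cexp a b c (d - pi / 2) x) * phi x).
Proof.
move=> tphi; rewrite /OU_weak.
set e1 := cexp a b c d; set e2 := cexp a b c (d - pi / 2).
have ce1 : continuous e1 by exact: continuous_cexp.
have ce2 : continuous e2 by exact: continuous_cexp.
have cp := @test_continuous R n phi tphi [::].
have p0 := @test_eq0 R n phi [::].
have cpx j : continuous (fun x : 'cV[R]_n => x j 0 * phi x).
  by move=> x; exact: (cvgM (@continuous_coord R n j x) (cp x)).
have px0 j x : ~ tsupp phi x -> x j 0 * phi x = 0.
  by move=> /p0 /= ->; rewrite mulr0.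
have h1 := has_int_self (integrable_tsupp tphi ce1 cp p0).
have h2 := has_int_self (integrable_tsupp tphi ce2 cp p0).
have h1x j := has_int_self (integrable_tsupp tphi ce1 (cpx j) (@px0 j)).
have h2x j := has_int_self (integrable_tsupp tphi ce2 (cpx j) (@px0 j)).
have hQ i j := has_intB measurableT (has_intZ measurableT (a i 0 * a j 0 - b i 0 * b j 0) h1)
  (has_intZ measurableT (a i 0 * b j 0 + a j 0 * b i 0) h2).
have hB i j := has_intB measurableT (has_intZ measurableT (b i 0) (h2x j)) (has_intZ measurableT (a i 0) (h1x j)).
have EQ i j : \int[leb R n]_x (e1 x * partial j (partial i phi) x) =
    (a i 0 * a j 0 - b i 0 * b j 0) * \int[leb R n]_x (e1 x * phi x)
    - (a i 0 * b j 0 + a j 0 * b i 0) * \int[leb R n]_x (e2 x * phi x).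
  rewrite IBP_cexp2//; apply: (proj2 (has_int_ext (hQ i j) _)) => x.
  by rewrite /e1 /e2 /=; ring.
have EB i j : \int[leb R n]_x (e1 x * partial i (fun x => x j 0 * phi x) x) =
    b i 0 * \int[leb R n]_x (e2 x * (x j 0 * phi x))
    - a i 0 * \int[leb R n]_x (e1 x * (x j 0 * phi x)).
  rewrite IBP_cexp_coord// -[RHS]opprK; congr (- _); rewrite -[RHS]mulN1r.
  apply: (proj2 (has_int_ext (has_intZ measurableT (-1) (hB i j)) _)) => x.
  by rewrite /e1 /e2 /=; ring.
have := has_intB measurableT
  (has_intZ measurableT 2^-1 (has_int_sum measurableT (index_enum 'I_n) (fun i =>
    has_int_sum measurableT (index_enum 'I_n) (fun j => has_intZ measurableT (Q i j) (hQ i j)))))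
  (has_int_sum measurableT (index_enum 'I_n) (fun i =>
    has_int_sum measurableT (index_enum 'I_n) (fun j => has_intZ measurableT (B i j) (hB i j)))).
move=> h; transitivity (\int[leb R n]_x (2^-1 * (\sum_i \sum_j Q i j *
      ((a i 0 * a j 0 - b i 0 * b j 0) * (e1 x * phi x) - (a i 0 * b j 0 + a j 0 * b i 0) * (e2 x * phi x)))
    - \sum_i \sum_j B i j * (b i 0 * (e2 x * (x j 0 * phi x)) - a i 0 * (e1 x * (x j 0 * phi x))))).
  rewrite (proj2 h); congr (2^-1 * _ - _).
    by apply: eq_bigr => i _; apply: eq_bigr => j _; rewrite EQ.
  by apply: eq_bigr => i _; apply: eq_bigr => j _; rewrite EB.
apply: eq_Rintegral => x _.
have qE (p q : 'cV[R]_n) (M : 'M[R]_n) (k : R) :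
    dot (M *m p) q * k = \sum_i \sum_j M i j * (q i 0 * p j 0 * k).
  rewrite /dot big_distrl/=; apply: eq_bigr => i _; rewrite mxE !big_distrl/=.
  by apply: eq_bigr => j _; ring.
have -> : \sum_i \sum_j Q i j * ((a i 0 * a j 0 - b i 0 * b j 0) * (e1 x * phi x)
      - (a i 0 * b j 0 + a j 0 * b i 0) * (e2 x * phi x)) =
    dot (Q *m a) a * (e1 x * phi x) - dot (Q *m b) b * (e1 x * phi x)
    - (dot (Q *m a) b * (e2 x * phi x) + dot (Q *m b) a * (e2 x * phi x)).
  rewrite !qE -!sumrB -big_split -sumrB/=; apply: eq_bigr => i _.
  by rewrite -!sumrB -big_split -sumrB/=; apply: eq_bigr => j _; ring.
have -> : \sum_i \sum_j B i j * (b i 0 * (e2 x * (x j 0 * phi x)) - a i 0 * (e1 x * (x j 0 * phi x))) =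
    dot (B *m x) b * (e2 x * phi x) - dot (B *m x) a * (e1 x * phi x).
  rewrite !qE -!sumrB; apply: eq_bigr => i _.
  by rewrite -!sumrB; apply: eq_bigr => j _; ring.
rewrite (dotC a) (dotC b); ring.
Qed.

End adjoint.

(** * Integrals depending on a parameter *)

Section parameter_integral.
Context d1 d2 (T : measurableType d1) (X : measurableType d2) {R : realType}.
Variables (nu : {sigma_finite_measure set T -> \bar R}) (m : {sigma_finite_measure set X -> \bar R}).
Variables (D : set T) (g : T * X -> R).
Hypothesis mD : measurable D.
Hypothesis fD : (nu D < +oo)%E.
Hypothesis mg : measurable_fun setT g.
Hypothesis bg : forall x, exists M : R, forall s, D s -> `|g (s, x)| <= M.

Let mgx x : measurable_fun setT (fun s => g (s, x)).
Proof. by apply: (measurableT_comp mg); exact: measurable_pair2. Qed.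

Let mgs s : measurable_fun setT (fun x => g (s, x)).
Proof. by apply: (measurableT_comp mg); exact: measurable_pair1. Qed.

Lemma parameter_integrable x : nu.-integrable D (fun s => (g (s, x))%:E).
Proof.
have [M b] := bg x.
apply: measurable_bounded_integrable => //; first exact: measurable_funTS.
exists M; split; first by rewrite num_real.
by move=> y My s Ds /=; exact: (le_trans (b s Ds) (ltW My)).
Qed.

Let f (p : T * X) : \bar R := (g p * \1_D p.1)%:E.

Let mf : measurable_fun setT f.
Proof.
apply/measurable_EFinP; apply: measurable_funM => //.
by apply: measurableT_comp => //; exact: measurable_indic.
Qed.

Let f_in (h : T -> R) : (fun s => (h s * \1_D s)%:E) = (EFin \o h) \_ D.
Proof.
apply/funext => s; rewrite patchE indicE; case: ifP => _; first by rewrite mulr1.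
by rewrite mulr0.
Qed.

Let fG x : (\int[nu]_s f (s, x) = (\int[nu]_(s in D) g (s, x))%:E)%E.
Proof.
rewrite /Rintegral fineK; last exact: integrable_fin_num (parameter_integrable x).
by rewrite [RHS]integral_mkcond -f_in.
Qed.

Lemma measurable_parameter_integral :
  measurable_fun setT (fun x => \int[nu]_(s in D) g (s, x)).
Proof.
apply/measurable_EFinP.
rewrite (_ : _ \o _ = (fun x => \int[nu]_s (f^\+ (s, x)) - \int[nu]_s (f^\- (s, x)))%E).
  apply: emeasurable_funB.
  - exact: (@measurable_fun_fubini_tonelli_G _ _ T X R nu (f^\+)%E (measurable_funepos mf) (fun p => funepos_ge0 f p)).
  - exact: (@measurable_fun_fubini_tonelli_G _ _ T X R nu (f^\-)%E (measurable_funeneg mf) (fun p => funeneg_ge0 f p)).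
apply/funext => x /=; rewrite -fG integralE; congr (_ - _)%E; apply: eq_integral => s _; rewrite ?funeposE ?funenegE//.
Qed.

(** Cauchy-Schwarz against the constant 1: expand the integral of (g - k)^2 >= 0 with k the mean
    value of g. *)
Lemma parameter_integral_sqr (x : X) : (nu D != 0)%E ->
  (\int[nu]_(s in D) g (s, x)) ^+ 2 <= fine (nu D) * \int[nu]_(s in D) (g (s, x) ^+ 2).
Proof.
move=> D0; have L0 : 0 < fine (nu D) by rewrite fine_gt0// fD andbT lt0e D0 measure_ge0.
set L := fine (nu D); set I := \int[nu]_(s in D) g (s, x); pose k := I / L.
have h1 := has_int_self (parameter_integrable x).
have i2 : nu.-integrable D (EFin \o (fun s => g (s, x) ^+ 2)).
  have [M b] := bg x.
  apply: measurable_bounded_integrable => //.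
    by apply: measurable_funTS; apply: measurable_funX.
  exists (M ^+ 2); split; first by rewrite num_real.
  move=> y My s Ds /=; apply: le_trans (ltW My).
  by rewrite normrX lerXn2r ?nnegrE ?(le_trans _ (b s Ds))//; exact: b.
have hc : has_int nu D (fun=> k ^+ 2) (k ^+ 2 * L).
  split; last by rewrite Rintegral_cst.
  apply: measurable_bounded_integrable => //.
  exists (`|k ^+ 2|); split; first by rewrite num_real.
  by move=> y ? s _ /=; exact: ltW.
have := has_intD mD (has_intB mD (has_int_self i2) (has_intZ mD (2 * k) h1)) hc.
rewrite -/I; move=> [_ e].
have : 0 <= \int[nu]_(s in D) (g (s, x) ^+ 2 - 2 * k * g (s, x) + k ^+ 2).
  apply: Rintegral_ge0 => s _; have := sqr_ge0 (g (s, x) - k).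
  by rewrite sqrrB; congr (_ <= _); ring.
rewrite e => le0.
rewrite -subr_ge0 (_ : _ - _ = L * (\int[nu]_(x0 in D) g (x0, x) ^+ 2 - 2 * k * I + k ^+ 2 * L)).
  by rewrite mulr_ge0// ltW.
rewrite /k; field; exact: lt0r_neq0.
Qed.

Lemma ge0_tonelli_param (h : T * X -> R) (M : R) : measurable_fun setT h ->
  (forall p, 0 <= h p) ->
  (forall s, D s -> (\int[m]_x (h (s, x))%:E <= M%:E)%E) ->
  (\int[m]_x \int[nu]_(s in D) (h (s, x))%:E <= M%:E * nu D)%E.
Proof.
move=> mh h0 hM.
pose k (p : T * X) : \bar R := (h p * \1_D p.1)%:E.
have mk : measurable_fun setT k.
  apply/measurable_EFinP; apply: measurable_funM => //.
  by apply: measurableT_comp => //; exact: measurable_indic.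
have k0 p : (0 <= k p)%E by rewrite lee_fin mulr_ge0.
under eq_integral do rewrite integral_mkcond -f_in.
have := @fubini_tonelli _ _ T X R nu m k mk k0; rewrite /k/= => <-.
rewrite -integral_cst// [leRHS]integral_mkcond.
apply: ge0_le_integral => //=.
- by move=> s _; apply: integral_ge0 => x _; exact: (k0 (s, x)).
- exact: (@measurable_fun_fubini_tonelli_F _ _ T X R m k mk k0).
- by apply/(measurable_restrictT _ mD).1; exact: measurable_cst.
- move=> s _; rewrite patchE; case: ifPn => sD.
    under eq_integral do rewrite /k indicE sD mulr1.
    by apply: hM; exact: set_mem.
  under eq_integral do rewrite /k indicE (negbTE sD) mulr0.
  by rewrite integral0.
Qed.

(** As D has finite measure, a bound on the L^1 norms in x that is uniform in the parameter makes g
    integrable on the product. *)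
Lemma fubini_param (M : R) :
  (forall s, D s -> (\int[m]_x `|(g (s, x))%:E| <= M%:E)%E) ->
  [/\ forall s, D s -> m.-integrable setT (fun x => (g (s, x))%:E),
   has_int m setT (fun x => \int[nu]_(s in D) g (s, x)) (\int[nu]_(s in D) \int[m]_x g (s, x))
   & nu.-integrable D (fun s => (\int[m]_x g (s, x))%:E)].
Proof.
move=> hM0; have hM s : D s -> (\int[m]_x `|(g (s, x))%:E| <= `|M|%:E)%E.
  by move=> /hM0/le_trans; apply; rewrite lee_fin ler_norm.
have is1 s : D s -> m.-integrable setT (fun x => (g (s, x))%:E).
  move=> Ds; apply/integrableP; split; first exact/measurable_EFinP.
  by apply: le_lt_trans (hM s Ds) _; rewrite ltry.
have fF s : (\int[m]_x f (s, x) = ((fun s => (\int[m]_x g (s, x))%:E) \_ D) s)%E.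
  rewrite patchE; case: ifPn => sD.
    rewrite /Rintegral fineK; last by apply: integrable_fin_num => //; exact: is1 (set_mem sD).
    by apply: eq_integral => x _; rewrite /f indicE sD mulr1.
  rewrite -[RHS](integral0 m setT); apply: eq_integral => x _.
  by rewrite /f indicE (negbTE sD) mulr0.
have iF : (nu \x m)%E.-integrable setT f.
  apply/(integrable12ltyP nu m mf).
  apply: (@le_lt_trans _ _ (\int[nu]_s ((cst `|M|%:E \_ D) s))%E); last first.
    by rewrite -integral_mkcond integral_cst// lte_mul_pinfty//.
  apply: ge0_le_integral => //=.
  - by move=> s _; exact: integral_ge0.
  - have mk : measurable_fun setT (fun p => `|f p|%E) by exact: measurableT_comp.
    exact: (@measurable_fun_fubini_tonelli_F _ _ T X R m _ mk (fun p => abse_ge0 (f p))).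
  - by apply/(measurable_restrictT _ mD).1; exact: measurable_cst.
  - move=> s _; rewrite patchE; case: ifPn => sD.
      by under eq_integral do rewrite /f indicE sD mulr1; exact: hM (set_mem sD).
    under eq_integral do rewrite /f indicE (negbTE sD) mulr0 /= normr0.
    by rewrite integral0.
split=> //; last first.
  by apply/(integrable_mkcond _ mD); rewrite -(funext fF); exact: integrable_fubini_F.
have iG : m.-integrable setT (EFin \o (fun x => \int[nu]_(s in D) g (s, x))).
  apply/integrableP; split; first by apply/measurable_EFinP; exact: measurable_parameter_integral.
  have mn : measurable_fun setT (fun p => `|g p|) by exact: measurableT_comp.
  have hn s : D s -> (\int[m]_x (`|g (s, x)|)%:E <= `|M|%:E)%E by exact: hM.
  apply: (@le_lt_trans _ _ (`|M|%:E * nu D)%E); last by rewrite lte_mul_pinfty.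
  apply: le_trans (ge0_tonelli_param mn (fun p => normr_ge0 (g p)) hn).
  apply: ge0_le_integral => //=.
  - apply/measurable_EFinP; apply: measurableT_comp => //; exact: measurable_parameter_integral.
  - under eq_fun do rewrite integral_mkcond.
    pose k (p : T * X) : \bar R := (`|g p| * \1_D p.1)%:E.
    have mk : measurable_fun setT k.
      apply/measurable_EFinP; apply: measurable_funM => //.
      by apply: measurableT_comp => //; exact: measurable_indic.
    have k0 p : (0 <= k p)%E by rewrite lee_fin mulr_ge0.
    rewrite (_ : (fun _ => _) = fubini_G nu k); last first.
      by apply/funext => x; rewrite /fubini_G -f_in.
    exact: (@measurable_fun_fubini_tonelli_G _ _ T X R nu k mk k0).
  - move=> x _; have i1 := parameter_integrable x.
    apply: (@le_trans _ _ (\int[nu]_(s in D) `|g (s, x)|)%:E).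
      by rewrite lee_fin; exact: le_normr_Rintegral.
    rewrite /Rintegral fineK//; apply: integrable_fin_num => //.
    by have := integrable_abse i1; congr (_.-integrable _ _).
split=> //; rewrite /Rintegral; congr fine.
under eq_integral do rewrite -fG.
rewrite -(Fubini iF) [RHS]integral_mkcond.
by apply: eq_integral => s _; rewrite fF.
Qed.

End parameter_integral.

(** * Wave packets *)

Section nice.
Context {R : realType} {n : nat}.
Local Notation Omega := (measurableTypeR R * measurableTypeR R)%type.
Implicit Types F G : Omega * 'cV[R]_n -> R.

(** A class closed under all operations that build the packets. Joint measurability is for Fubini; a
    bound local in x suffices, as x is either fixed or confined to the compact support of a test
    function. *)
Definition nice F := measurable_fun setT F /\
  forall L : R, exists M : R, forall (s tau : R) (x : 'cV[R]_n), `|s| <= 1 -> `|tau| <= 1 ->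
    (forall i, `|x i 0| <= L) -> `|F ((s, tau), x)| <= M.

Lemma nice_ext F G : nice F -> F =1 G -> nice G.
Proof. by move=> nF /funext <-. Qed.

Lemma nice_cst c : nice (fun=> c).
Proof. by split=> [//|L]; exists `|c|. Qed.

Lemma niceD F G : nice F -> nice G -> nice (fun p => F p + G p).
Proof.
move=> [mF bF] [mG bG]; split=> [|L]; first exact: measurable_funD.
have [M1 b1] := bF L; have [M2 b2] := bG L; exists (M1 + M2) => s tau x hs ht hx.
by apply: le_trans (ler_normD _ _) _; rewrite lerD ?b1 ?b2.
Qed.

Lemma niceM F G : nice F -> nice G -> nice (fun p => F p * G p).
Proof.
move=> [mF bF] [mG bG]; split=> [|L]; first exact: measurable_funM.
have [M1 b1] := bF L; have [M2 b2] := bG L; exists (M1 * M2) => s tau x hs ht hx.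
by rewrite normrM ler_pM ?b1 ?b2.
Qed.

Lemma niceN F : nice F -> nice (fun p => - F p).
Proof.
by move=> nF; apply: nice_ext (niceM (nice_cst (-1)) nF) _ => p; rewrite mulN1r.
Qed.

Lemma niceB F G : nice F -> nice G -> nice (fun p => F p - G p).
Proof. by move=> nF nG; exact: niceD nF (niceN nG). Qed.

Lemma nice_sum (I : Type) (r : seq I) (F : I -> Omega * 'cV[R]_n -> R) :
  (forall i, nice (F i)) -> nice (fun p => \sum_(i <- r) F i p).
Proof.
move=> nF; elim: r => [|i r IH].
  by apply: nice_ext (nice_cst 0) _ => p; rewrite big_nil.
by apply: nice_ext (niceD (nF i) IH) _ => p; rewrite big_cons.
Qed.

Lemma continuous_bounded_itv (h : R -> R) : continuous h ->
  exists M : R, forall s, `|s| <= 1 -> `|h s| <= M.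
Proof.
move=> ch; have ch' : continuous (fun x => `|h x|).
  by move=> x; apply: (continuous_comp (ch x)); exact: norm_continuous.
have le11 : (-1 : R) <= 1 by rewrite -subr_ge0 opprK addr_ge0.
have [c _ hc] := EVT_max le11 (continuous_subspaceT ch').
by exists `|h c| => s hs; apply: hc; rewrite in_itv/= -ler_norml.
Qed.

Lemma nice_param1 (h : R -> R) : continuous h -> nice (fun p => h p.1.1).
Proof.
move=> ch; split.
  apply: measurableT_comp; first exact: continuous_measurable_fun.
  by apply: measurableT_comp.
by move=> L; have [M hM] := continuous_bounded_itv ch; exists M => s tau x hs _ _; exact: hM.
Qed.

Lemma nice_param2 (h : R -> R) : continuous h -> nice (fun p => h p.1.2).
Proof.
move=> ch; split.
  apply: measurableT_comp; first exact: continuous_measurable_fun.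
  by apply: measurableT_comp.
by move=> L; have [M hM] := continuous_bounded_itv ch; exists M => s tau x _ ht _; exact: hM.
Qed.

Lemma nice_s : nice (fun z : Omega * 'cV[R]_n => z.1.1).
Proof. by apply: (nice_param1 (h := id)); move=> x; exact: cvg_id. Qed.

Lemma nice_tau : nice (fun z : Omega * 'cV[R]_n => z.1.2).
Proof. by apply: (nice_param2 (h := id)); move=> x; exact: cvg_id. Qed.

Lemma nice_coord i : nice (fun p => p.2 i 0).
Proof.
split; last by move=> L; exists L => s tau x _ _; exact.
by apply: (measurableT_comp (measurable_coord i)).
Qed.

Lemma nice_expR F : nice F -> nice (fun p => expR (F p)).
Proof.
move=> [mF bF]; split=> [|L]; first exact: measurableT_comp.
have [M b] := bF L; exists (expR M) => s tau x hs ht hx.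
by rewrite ger0_norm ?expR_ge0// ler_expR (le_trans (ler_norm _))// b.
Qed.

Lemma nice_cos F : nice F -> nice (fun p => cos (F p)).
Proof.
move=> [mF bF]; split=> [|L].
  by apply: measurableT_comp mF; apply: continuous_measurable_fun; exact: continuous_cos.
by exists 1 => s tau x _ _ _; rewrite ler_norml cos_geN1 cos_le1.
Qed.

Lemma nice_dot (f g : Omega * 'cV[R]_n -> 'cV[R]_n) :
  (forall i, nice (fun p => f p i 0)) -> (forall i, nice (fun p => g p i 0)) ->
  nice (fun p => dot (f p) (g p)).
Proof. by move=> nf ng; apply: nice_sum => i; exact: niceM. Qed.

Lemma nice_mulmx (A : 'M[R]_n) (f : Omega * 'cV[R]_n -> 'cV[R]_n) :
  (forall i, nice (fun p => f p i 0)) -> forall i, nice (fun p => (A *m f p) i 0).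
Proof.
move=> nf i; apply: (nice_ext (F := fun p => \sum_j A i j * f p j 0)).
  by apply: nice_sum => j; apply: niceM => //; exact: nice_cst.
by move=> p; rewrite mxE.
Qed.

End nice.

(** * The packets and their evolution equation *)

Section quasimode.
Context {R : realType} {n : nat} (Q B S : 'M[R]_n) (p r vp vr : 'cV[R]_n).
Variables (t lam th c0 : R).
Hypothesis ST : S^T = S.
Hypothesis lyap : B *m S + S *m B^T = - Q.
Hypothesis t0 : 0 <= t.
Local Notation Omega := (measurableTypeR R * measurableTypeR R)%type.

Let G s : 'M[R]_n := expmx (s *: B^T).

(* real and imaginary parts of [e^{s B^T} (alpha + y v)], for alpha = p + i r,
   v = vp + i vr and y = s / 2 + i tau *)
Definition orbit_re s tau := G s *m (p + (s / 2) *: vp - tau *: vr).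
Definition orbit_im s tau := G s *m (r + (s / 2) *: vr + tau *: vp).

(* real and imaginary parts of
   [s tr B / 2 + t (lam i s - 2 i tau + th y^2 / 2 - beta^T S beta / 2)], beta
   being the orbit point; the term in [lam] and [tau] is [s (1 + i lam) - 2 y] *)
Definition amp s tau := s * \tr B / 2 + t * (- 2^-1 * (dot (S *m orbit_re s tau) (orbit_re s tau)
  - dot (S *m orbit_im s tau) (orbit_im s tau)) + 2^-1 * th * (s ^+ 2 / 4 - tau ^+ 2)) + c0.

Definition phase s tau := t * (- dot (S *m orbit_re s tau) (orbit_im s tau)
  + lam * s - 2 * tau + 2^-1 * th * s * tau).

(* [kappa = 0] gives the real part of the complex wave packet and
   [kappa = - pi / 2] its imaginary part *)
Definition packet kappa s tau : 'cV[R]_n -> R :=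
  cexp (Num.sqrt t *: orbit_re s tau) (Num.sqrt t *: orbit_im s tau)
    (amp s tau) (phase s tau + kappa).

Let orbit_re_s s tau := B^T *m orbit_re s tau + 2^-1 *: (G s *m vp).
Let orbit_im_s s tau := B^T *m orbit_im s tau + 2^-1 *: (G s *m vr).
Let orbit_re_tau s := - (G s *m vr).
Let orbit_im_tau s := G s *m vp.

Lemma is_derive_dot (f g : R -> 'cV[R]_n) (f' g' : 'cV[R]_n) (x : R) :
  (forall i, is_derive x (1 : R) (fun y => f y i 0) (f' i 0)) ->
  (forall i, is_derive x (1 : R) (fun y => g y i 0) (g' i 0)) ->
  is_derive x (1 : R) (fun y => dot (f y) (g y)) (dot f' (g x) + dot (f x) g').
Proof.
move=> df dg; rewrite /dot -big_split/=; apply: is_derive_sumr => i.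
by have h := is_deriveM (df i) (dg i); apply: (is_derive_eq h); rewrite /GRing.scale/=; ring.
Qed.

Lemma is_derive_mulmxl (A : 'M[R]_n) (f : R -> 'cV[R]_n) (f' : 'cV[R]_n) (x : R) :
  (forall i, is_derive x (1 : R) (fun y => f y i 0) (f' i 0)) ->
  forall i, is_derive x (1 : R) (fun y => (A *m f y) i 0) ((A *m f') i 0).
Proof.
move=> df i; have h := @is_derive_mulmx R n n 1 (fun=> A) f 0 f' x _ _ i 0.
rewrite mul0mx add0r in h; apply: h => // k l; last by rewrite (ord1 l); exact: df.
by rewrite mxE; exact: is_derive_cst.
Qed.

Lemma is_derive_cexp_param (f g : R -> 'cV[R]_n) (c d : R -> R) (f' g' : 'cV[R]_n) (c' d' : R) q (x : 'cV[R]_n) (y : R) :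
  (forall i, is_derive y (1 : R) (fun y => f y i 0) (f' i 0)) ->
  (forall i, is_derive y (1 : R) (fun y => g y i 0) (g' i 0)) ->
  is_derive y (1 : R) c c' -> is_derive y (1 : R) d d' ->
  is_derive y (1 : R) (fun y => cexp (q *: f y) (q *: g y) (c y) (d y) x)
   ((q * dot f' x + c') * cexp (q *: f y) (q *: g y) (c y) (d y) x
    - (q * dot g' x + d') * cexp (q *: f y) (q *: g y) (c y) (d y - pi / 2) x).
Proof.
move=> df dg dc dd.
have cx i : is_derive y (1 : R) (fun=> x i 0) ((0 : 'cV[R]_n) i 0) by rewrite mxE; exact: is_derive_cst.
have hf := is_derive_dot df cx; have hg := is_derive_dot dg cx.
rewrite dot0r addr0 in hf; rewrite dot0r addr0 in hg.
rewrite /cexp; under eq_fun do rewrite !dotZl.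
apply: is_derive_eq.
rewrite /GRing.scale/= !dotZl addrA cosBpihalf.
by ring.
Qed.

Let dG s i j : is_derive s (1 : R) (fun s => G s i j) ((B^T *m G s) i j).
Proof. exact: is_derive_expmx. Qed.

Let dre_s tau s i : is_derive s (1 : R) (fun s => orbit_re s tau i 0) (orbit_re_s s tau i 0).
Proof.
have h := @is_derive_mulmx R n n 1 G (fun s => p + (s / 2) *: vp - tau *: vr) (B^T *m G s) (2^-1 *: vp) s (dG s) _ i 0.
apply: (is_derive_eq (h _)) => [k l|].
  under eq_fun do rewrite !mxE.
  by apply: is_derive_eq; rewrite mxE /GRing.scale/=; ring.
by rewrite /orbit_re_s /orbit_re -mulmxA -scalemxAr.
Qed.

Let dim_s tau s i : is_derive s (1 : R) (fun s => orbit_im s tau i 0) (orbit_im_s s tau i 0).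
Proof.
have h := @is_derive_mulmx R n n 1 G (fun s => r + (s / 2) *: vr + tau *: vp) (B^T *m G s) (2^-1 *: vr) s (dG s) _ i 0.
apply: (is_derive_eq (h _)) => [k l|].
  under eq_fun do rewrite !mxE.
  by apply: is_derive_eq; rewrite mxE /GRing.scale/=; ring.
by rewrite /orbit_im_s /orbit_im -mulmxA -scalemxAr.
Qed.

Let dre_tau s tau i : is_derive tau (1 : R) (fun tau => orbit_re s tau i 0) (orbit_re_tau s i 0).
Proof.
have h := @is_derive_mulmxl (G s) (fun tau => p + (s / 2) *: vp - tau *: vr) (- vr) tau _ i.
apply: (is_derive_eq (h _)) => [k|].
  under eq_fun do rewrite !mxE.
  by apply: is_derive_eq; rewrite mxE /GRing.scale/=; ring.
by rewrite /orbit_re_tau mulmxN.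
Qed.

Let dim_tau s tau i : is_derive tau (1 : R) (fun tau => orbit_im s tau i 0) (orbit_im_tau s i 0).
Proof.
have h := @is_derive_mulmxl (G s) (fun tau => r + (s / 2) *: vr + tau *: vp) vp tau _ i.
apply: (is_derive_eq (h _)) => [k|//].
under eq_fun do rewrite !mxE.
by apply: is_derive_eq; rewrite /GRing.scale/=; ring.
Qed.

Let amp_s s tau := \tr B / 2 + t * (- (dot (S *m orbit_re_s s tau) (orbit_re s tau)
  - dot (S *m orbit_im_s s tau) (orbit_im s tau)) + th * s / 4).
Let amp_tau s tau := t * (- (dot (S *m orbit_re_tau s) (orbit_re s tau)
  - dot (S *m orbit_im_tau s) (orbit_im s tau)) - th * tau).
Let phase_s s tau := t * (- dot (S *m orbit_re_s s tau) (orbit_im s tau)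
  - dot (S *m orbit_re s tau) (orbit_im_s s tau) + lam + 2^-1 * th * tau).
Let phase_tau s tau := t * (- dot (S *m orbit_re_tau s) (orbit_im s tau)
  - dot (S *m orbit_re s tau) (orbit_im_tau s) - 2 + 2^-1 * th * s).

Let Ssym a b : dot (S *m a) b = dot (S *m b) a.
Proof. by rewrite dot_mull ST dotC. Qed.

Let damp_s tau s : is_derive s (1 : R) (fun s => amp s tau) (amp_s s tau).
Proof.
have h1 := is_derive_dot (is_derive_mulmxl S (dre_s tau s)) (dre_s tau s).
have h2 := is_derive_dot (is_derive_mulmxl S (dim_s tau s)) (dim_s tau s).
rewrite /amp; apply: is_derive_eq; rewrite /amp_s /GRing.scale/=.
rewrite (Ssym (orbit_re s tau) (orbit_re_s s tau)) (Ssym (orbit_im s tau) (orbit_im_s s tau)).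
by field.
Qed.

Let damp_tau s tau : is_derive tau (1 : R) (fun tau => amp s tau) (amp_tau s tau).
Proof.
have h1 := is_derive_dot (is_derive_mulmxl S (dre_tau s tau)) (dre_tau s tau).
have h2 := is_derive_dot (is_derive_mulmxl S (dim_tau s tau)) (dim_tau s tau).
rewrite /amp; apply: is_derive_eq; rewrite /amp_tau /GRing.scale/=.
rewrite (Ssym (orbit_re s tau) (orbit_re_tau s)) (Ssym (orbit_im s tau) (orbit_im_tau s)).
by field.
Qed.

Let dphase_s tau s : is_derive s (1 : R) (fun s => phase s tau) (phase_s s tau).
Proof.
have h1 := is_derive_dot (is_derive_mulmxl S (dre_s tau s)) (dim_s tau s).
rewrite /phase; apply: is_derive_eq; rewrite /phase_s /GRing.scale/=.
by field.
Qed.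

Let dphase_tau s tau : is_derive tau (1 : R) (fun tau => phase s tau) (phase_tau s tau).
Proof.
have h1 := is_derive_dot (is_derive_mulmxl S (dre_tau s tau)) (dim_tau s tau).
rewrite /phase; apply: is_derive_eq; rewrite /phase_tau /GRing.scale/=.
by field.
Qed.

Let q := Num.sqrt t.

Definition packet_s kappa s tau x :=
  (q * dot (orbit_re_s s tau) x + amp_s s tau) * packet kappa s tau x
  - (q * dot (orbit_im_s s tau) x + phase_s s tau) * packet (kappa - pi / 2) s tau x.
Definition packet_tau kappa s tau x :=
  (q * dot (orbit_re_tau s) x + amp_tau s tau) * packet kappa s tau x
  - (q * dot (orbit_im_tau s) x + phase_tau s tau) * packet (kappa - pi / 2) s tau x.

Lemma is_derive_packet_s kappa tau x s :
  is_derive s (1 : R) (fun s => packet kappa s tau x) (packet_s kappa s tau x).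
Proof.
have dk : is_derive s (1 : R) (fun s => phase s tau + kappa) (phase_s s tau).
  by have h := dphase_s tau s; apply: is_derive_eq; rewrite addr0.
have := is_derive_cexp_param q x (dre_s tau s) (dim_s tau s) (damp_s tau s) dk.
by rewrite /packet_s /packet (addrA (phase s tau)).
Qed.

Lemma is_derive_packet_tau kappa s x tau :
  is_derive tau (1 : R) (fun tau => packet kappa s tau x) (packet_tau kappa s tau x).
Proof.
have dk : is_derive tau (1 : R) (fun tau => phase s tau + kappa) (phase_tau s tau).
  by have h := dphase_tau s tau; apply: is_derive_eq; rewrite addr0.
have := is_derive_cexp_param q x (dre_tau s tau) (dim_tau s tau) (damp_tau s tau) dk.
by rewrite /packet_tau /packet (addrA (phase s tau)).
Qed.

Lemma packet_pi kappa s tau x : packet (kappa - pi / 2 - pi / 2) s tau x = - packet kappa s tau x.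
Proof.
rewrite /packet /cexp !addrA cosBpihalf.
by rewrite sinBpihalf mulrN.
Qed.

(* The left-hand side is [P] applied to the packet, so the packet [E] satisfies
   [(d_s + (i / 2) d_tau) E = (P - z) E]. *)
Lemma packet_evolution kappa s tau x :
  (2^-1 * (dot (Q *m (q *: orbit_re s tau)) (q *: orbit_re s tau)
      - dot (Q *m (q *: orbit_im s tau)) (q *: orbit_im s tau)) + dot (q *: orbit_re s tau) (B *m x))
    * packet kappa s tau x
  - (2^-1 * (dot (Q *m (q *: orbit_re s tau)) (q *: orbit_im s tau)
      + dot (Q *m (q *: orbit_im s tau)) (q *: orbit_re s tau)) + dot (q *: orbit_im s tau) (B *m x))
    * packet (kappa - pi / 2) s tau x =
  packet_s kappa s tau x - 2^-1 * packet_tau (kappa - pi / 2) s tau x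
  - (\tr B / 2 + t) * packet kappa s tau x + t * lam * packet (kappa - pi / 2) s tau x.
Proof.
(* By the Lyapunov equation the exponent -(S beta) . beta / 2, carried along beta' = C beta, has the
   derivative (Q beta) . beta / 2, which is the second-order part of P. *)
have QE a b : dot (Q *m a) b = - dot (S *m (B^T *m a)) b - dot (S *m a) (B^T *m b).
  rewrite -[Q]opprK -lyap mulNmx dotNl mulmxDl dotDl -!mulmxA.
  by rewrite (dot_mull B) opprD addrC.
have qq : q * q = t by rewrite -expr2 sqr_sqrtr.
have QZ a b : dot (Q *m (q *: a)) (q *: b) = t * dot (Q *m a) b.
  by rewrite -scalemxAr dotZl dotZr mulrA qq.
rewrite !QZ !QE /packet_s /packet_tau packet_pi.
rewrite !dotZl !(dot_mulr B) /orbit_re_s /orbit_im_s /amp_s /amp_tau /phase_s /phase_tau.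
rewrite /orbit_re_s /orbit_im_s /orbit_re_tau /orbit_im_tau.
rewrite !(dotDl, dotDr, dotNl, dotNr, dotZl, dotZr, mulmxDr, mulmxN) -!scalemxAr.
rewrite !(dotDl, dotDr, dotNl, dotNr, dotZl, dotZr).
set a := orbit_re s tau; set b := orbit_im s tau.
rewrite ?(Ssym a (B^T *m a)) ?(Ssym b (B^T *m b)) ?(Ssym a (B^T *m b)) ?(Ssym b (B^T *m a)).
rewrite ?(Ssym a (G s *m vp)) ?(Ssym a (G s *m vr)) ?(Ssym b (G s *m vp)) ?(Ssym b (G s *m vr)).
by field.
Qed.

Let cG i j : continuous (fun s => G s i j).
Proof. exact: is_derive_continuous (fun x => dG x i j). Qed.

Let nice_G (f : Omega * 'cV[R]_n -> 'cV[R]_n) : (forall i, nice (fun z => f z i 0)) ->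
  forall i, nice (fun z => (G z.1.1 *m f z) i 0).
Proof.
move=> nf i; apply: (nice_ext (F := fun z => \sum_j G z.1.1 i j * f z j 0)).
  by apply: nice_sum => j; apply: niceM => //; apply: (@nice_param1 R n (fun s => G s i j)).
by move=> z; rewrite mxE.
Qed.

Lemma nice_orbit_re i : nice (fun z : Omega * 'cV[R]_n => orbit_re z.1.1 z.1.2 i 0).
Proof.
apply: nice_G => j.
apply: (nice_ext (F := fun z => p j 0 + z.1.1 * 2^-1 * vp j 0 - z.1.2 * vr j 0)).
  by do ![apply: niceD|apply: niceN|apply: niceM|exact: nice_cst|exact: nice_s|exact: nice_tau].
by move=> z; rewrite !mxE.
Qed.

Lemma nice_orbit_im i : nice (fun z : Omega * 'cV[R]_n => orbit_im z.1.1 z.1.2 i 0).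
Proof.
apply: nice_G => j.
apply: (nice_ext (F := fun z => r j 0 + z.1.1 * 2^-1 * vr j 0 + z.1.2 * vp j 0)).
  by do ![apply: niceD|apply: niceN|apply: niceM|exact: nice_cst|exact: nice_s|exact: nice_tau].
by move=> z; rewrite !mxE.
Qed.

Let vnice (f : Omega * 'cV[R]_n -> 'cV[R]_n) := forall i, nice (fun z => f z i 0).

Let vniceZ k f : vnice f -> vnice (fun z => k *: f z).
Proof.
move=> nf i; apply: (nice_ext (F := fun z => k * f z i 0)); last by move=> z; rewrite mxE.
by apply: niceM => //; exact: nice_cst.
Qed.

Let vniceD f g : vnice f -> vnice g -> vnice (fun z => f z + g z).
Proof.
move=> nf ng i; apply: (nice_ext (F := fun z => f z i 0 + g z i 0)); last by move=> z; rewrite mxE.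
exact: niceD.
Qed.

Let vniceN f : vnice f -> vnice (fun z => - f z).
Proof.
move=> nf i; apply: (nice_ext (F := fun z => - f z i 0)); last by move=> z; rewrite mxE.
exact: niceN.
Qed.

Let vnice_cst v : vnice (fun=> v).
Proof. by move=> i; exact: nice_cst. Qed.

Let vnice_dot f g : vnice f -> vnice g -> nice (fun z => dot (f z) (g z)).
Proof. exact: nice_dot. Qed.

Let vnice_mulmx A f : vnice f -> vnice (fun z => A *m f z).
Proof. exact: nice_mulmx. Qed.

Let vnice_G f : vnice f -> vnice (fun z => G z.1.1 *m f z).
Proof. exact: nice_G. Qed.

Let vnice_x : vnice snd. Proof. exact: nice_coord. Qed.
Let vnice_re : vnice (fun z => orbit_re z.1.1 z.1.2). Proof. exact: nice_orbit_re. Qed.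
Let vnice_im : vnice (fun z => orbit_im z.1.1 z.1.2). Proof. exact: nice_orbit_im. Qed.

Ltac nice_tac := repeat match goal with
  | |- nice (fun z => @?f z + @?g z) => apply: (@niceD R n f g)
  | |- nice (fun z => @?f z * @?g z) => apply: (@niceM R n f g)
  | |- nice (fun z => - @?f z) => apply: (@niceN R n f)
  | |- nice (fun z => dot (@?f z) (@?g z)) => apply: (@vnice_dot f g)
  | |- nice (fun z => ?v) => exact: (@nice_cst R n v)
  | |- vnice (fun z => ?v) => exact: (@vnice_cst v)
  | |- nice _ => first [exact: nice_s | exact: nice_tau | apply: niceM]
  | |- vnice _ => first [exact: vnice_x | exact: vnice_re | exact: vnice_im | apply: vnice_G
     | apply: vnice_mulmx | apply: vniceD | apply: vniceZ | apply: vniceN]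
  end.

Let nice_amp : nice (fun z : Omega * 'cV[R]_n => amp z.1.1 z.1.2).
Proof. by rewrite /amp; nice_tac. Qed.

Let nice_phase : nice (fun z : Omega * 'cV[R]_n => phase z.1.1 z.1.2).
Proof. by rewrite /phase; nice_tac. Qed.

(* half the logarithm of the squared norm of the complex packet *)
Definition level s tau := amp s tau + t * dot (S *m orbit_re s tau) (orbit_re s tau).

Lemma nice_level : nice (fun z : Omega * 'cV[R]_n => level z.1.1 z.1.2).
Proof.
apply: niceD nice_amp (niceM (nice_cst t) _).
exact: (vnice_dot (@vnice_mulmx S _ vnice_re) vnice_re).
Qed.

(** Up to a constant, the logarithm of the bound used for the L^1 norm of a packet times the
    conjugate of the coherent state. *)
Lemma nice_pairing_level : nice (fun z : Omega * 'cV[R]_n =>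
  2^-1 * t * dot (S *m (orbit_re z.1.1 z.1.2 + p)) (orbit_re z.1.1 z.1.2 + p) + amp z.1.1 z.1.2).
Proof.
have h : vnice (fun z => orbit_re z.1.1 z.1.2 + p) by exact: (vniceD vnice_re (@vnice_cst p)).
exact: niceD (niceM (nice_cst (2^-1 * t)) (vnice_dot (@vnice_mulmx S _ h) h)) nice_amp.
Qed.

Lemma nice_packet kappa : nice (fun z : Omega * 'cV[R]_n => packet kappa z.1.1 z.1.2 z.2).
Proof.
rewrite /packet /cexp; apply: niceM.
  by apply: nice_expR; apply: niceD; [nice_tac|exact: nice_amp].
apply: nice_cos; apply: niceD; last by apply: niceD; [exact: nice_phase|exact: nice_cst].
by nice_tac.
Qed.

Lemma nice_packet_s kappa : nice (fun z : Omega * 'cV[R]_n => packet_s kappa z.1.1 z.1.2 z.2).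
Proof.
rewrite /packet_s; apply: niceB; (apply: niceM; last exact: nice_packet).
  by rewrite /amp_s /orbit_re_s /orbit_im_s; nice_tac.
by rewrite /phase_s /orbit_re_s /orbit_im_s; nice_tac.
Qed.

Lemma nice_packet_tau kappa : nice (fun z : Omega * 'cV[R]_n => packet_tau kappa z.1.1 z.1.2 z.2).
Proof.
rewrite /packet_tau; apply: niceB; (apply: niceM; last exact: nice_packet).
  by rewrite /amp_tau /orbit_re_tau /orbit_im_tau; nice_tac.
by rewrite /phase_tau /orbit_re_tau /orbit_im_tau; nice_tac.
Qed.

Let cre tau i : continuous (fun s => orbit_re s tau i 0) := is_derive_continuous (fun s => dre_s tau s i).
Let cim tau i : continuous (fun s => orbit_im s tau i 0) := is_derive_continuous (fun s => dim_s tau s i).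
Let cre' s i : continuous (fun tau => orbit_re s tau i 0) := is_derive_continuous (fun tau => dre_tau s tau i).
Let cim' s i : continuous (fun tau => orbit_im s tau i 0) := is_derive_continuous (fun tau => dim_tau s tau i).

Let cD (f g : R -> R) : continuous f -> continuous g -> continuous (fun y => f y + g y).
Proof. by move=> cf cg x; exact: (cvgD (cf x) (cg x)). Qed.
Let cM (f g : R -> R) : continuous f -> continuous g -> continuous (fun y => f y * g y).
Proof. by move=> cf cg x; exact: (cvgM (cf x) (cg x)). Qed.
Let cN (f : R -> R) : continuous f -> continuous (fun y => - f y).
Proof. by move=> cf x; exact: (cvgN (cf x)). Qed.
Let cC (k : R) : continuous (fun _ : R => k).
Proof. by move=> x; exact: cvg_cst. Qed.
Let cI : continuous (fun x : R => x).
Proof. by move=> x; exact: cvg_id. Qed.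
Let vcont (f : R -> 'cV[R]_n) := forall i, continuous (fun x => f x i 0).
Let cdot f g : vcont f -> vcont g -> continuous (fun x => dot (f x) (g x)).
Proof. exact: continuous_dot. Qed.
Let cmul (A : 'M[R]_n) f : vcont f -> vcont (fun x => A *m f x).
Proof.
move=> cf i; under eq_fun do rewrite mxE.
by apply: continuous_sumr => j; apply: cM => //; exact: cC.
Qed.
Let cvD f g : vcont f -> vcont g -> vcont (fun x => f x + g x).
Proof. by move=> cf cg i; under eq_fun do rewrite mxE; exact: cD. Qed.
Let cvZ k f : vcont f -> vcont (fun x => k *: f x).
Proof. by move=> cf i; under eq_fun do rewrite mxE; apply: cM => //; exact: cC. Qed.
Let cvG v : vcont (fun s => G s *m v).
Proof.
move=> i; under eq_fun do rewrite mxE.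
by apply: continuous_sumr => j; apply: cM => //; exact: cC.
Qed.
Let cvC v : vcont (fun=> v).
Proof. move=> i; exact: cC. Qed.
Let cvre tau : vcont (fun s => orbit_re s tau). Proof. by move=> i; exact: cre. Qed.
Let cvim tau : vcont (fun s => orbit_im s tau). Proof. by move=> i; exact: cim. Qed.
Let cvre' s : vcont (fun tau => orbit_re s tau). Proof. by move=> i; exact: cre'. Qed.
Let cvim' s : vcont (fun tau => orbit_im s tau). Proof. by move=> i; exact: cim'. Qed.

Ltac cont_tac := repeat match goal with
  | |- continuous (fun z => @?f z + @?g z) => apply: (@cD f g)
  | |- continuous (fun z => @?f z * @?g z) => apply: (@cM f g)
  | |- continuous (fun z => - @?f z) => apply: (@cN f)
  | |- continuous (fun z => dot (@?f z) (@?g z)) => apply: (@cdot f g)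
  | |- continuous (fun z => ?v) => exact: (@cC v)
  | |- continuous (fun z => z) => exact: cI
  | |- vcont (fun z => ?v) => exact: (@cvC v)
  | |- vcont (fun z => orbit_re (@?a z) (@?b z)) => first [exact: cvre | exact: cvre']
  | |- vcont (fun z => orbit_im (@?a z) (@?b z)) => first [exact: cvim | exact: cvim']
  | |- vcont (fun z => G z *m ?v) => exact: (@cvG v)
  | |- vcont (fun z => ?A *m @?f z) => apply: (@cmul A f)
  | |- vcont (fun z => ?k *: @?f z) => apply: (@cvZ k f)
  | |- vcont (fun z => @?f z + @?g z) => apply: (@cvD f g)
  end.

Lemma continuous_packet_s kappa tau x : continuous (fun s => packet_s kappa s tau x).
Proof.
have cp k := is_derive_continuous (is_derive_packet_s k tau x).
apply: cD; [|apply: cN]; (apply: cM; last exact: cp).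
  by rewrite /amp_s /orbit_re_s /orbit_im_s; cont_tac.
by rewrite /phase_s /orbit_re_s /orbit_im_s; cont_tac.
Qed.

Lemma continuous_packet_tau kappa s x : continuous (fun tau => packet_tau kappa s tau x).
Proof.
have cp k := is_derive_continuous (is_derive_packet_tau k s x).
have hre v : continuous (fun tau => dot v (orbit_re s tau)) := cdot (@cvC v) (@cvre' s).
have him v : continuous (fun tau => dot v (orbit_im s tau)) := cdot (@cvC v) (@cvim' s).
have hre' v : continuous (fun tau => dot (S *m orbit_re s tau) v) := cdot (@cmul S _ (@cvre' s)) (@cvC v).
apply: cD; [|apply: cN]; (apply: cM; last exact: cp).
  exact: (cD (@cC _) (cM (@cC t) (cD (cN (cD (hre _) (cN (him _)))) (cN (cM (@cC th) cI))))).
exact: (cD (@cC _) (cM (@cC t) (cD (cD (cD (cN (him _)) (cN (hre' _))) (@cC (- 2))) (@cC (2^-1 * th * s))))).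
Qed.

End quasimode.

(** * Superpositions of packets over a parameter set *)

Section nice_integral.
Context d (T : measurableType d) {R : realType} {n : nat}.
Local Notation Omega := (measurableTypeR R * measurableTypeR R)%type.
Variables (nu : {sigma_finite_measure set T -> \bar R}) (D : set T).
Variables (gam : T -> Omega).
Hypothesis mD : measurable D.
Hypothesis fD : (nu D < +oo)%E.
Hypothesis mgam : measurable_fun setT gam.
Hypothesis gamD : forall s, D s -> `|(gam s).1| <= 1 /\ `|(gam s).2| <= 1.
Implicit Types F : Omega * 'cV[R]_n -> R.

(** The map [gam] lets one construction cover the square (identity) and its four sides (a frozen
    coordinate). *)
Definition sweep F x : R := \int[nu]_(s in D) F (gam s, x).

Lemma measurable_sweep_fun F : nice F ->
  measurable_fun setT (fun z : T * 'cV[R]_n => F (gam z.1, z.2)).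
Proof.
move=> [mF _]; apply: (measurableT_comp mF); apply: measurable_fun_pair => //.
by apply: (measurableT_comp mgam).
Qed.

Lemma sweep_fun_bounded F (L : R) : nice F -> exists M : R, forall s (x : 'cV[R]_n), D s ->
  (forall i, `|x i 0| <= L) -> `|F (gam s, x)| <= M.
Proof.
move=> [_ /(_ L)[M hM]]; exists M => s x Ds hx.
by have [h1 h2] := gamD Ds; rewrite (surjective_pairing (gam s)); exact: hM.
Qed.

Lemma coord_bounded (x : 'cV[R]_n) : exists L : R, forall i, `|x i 0| <= L.
Proof.
exists (\sum_i `|x i 0|) => i; rewrite (bigD1 i)//= lerDl; exact: sumr_ge0.
Qed.

Lemma sweep_fun_pt_bounded F x : nice F -> exists M : R, forall s, D s ->
  `|F (gam s, x)| <= M.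
Proof.
move=> nF; have [L hL] := coord_bounded x.
by have [M hM] := sweep_fun_bounded L nF; exists M => s Ds; exact: hM.
Qed.

Lemma sweep_has_int F x : nice F -> has_int nu D (fun s => F (gam s, x)) (sweep F x).
Proof.
move=> nF; apply: has_int_self.
by apply: (parameter_integrable mD fD (measurable_sweep_fun nF)) => y; exact: sweep_fun_pt_bounded.
Qed.

Lemma measurable_sweep F : nice F -> measurable_fun setT (sweep F).
Proof.
move=> nF.
apply: (@measurable_parameter_integral _ _ _ _ _ nu D _ mD fD (measurable_sweep_fun nF)) => y; exact: sweep_fun_pt_bounded.
Qed.

Lemma sweep_sqr F x : nice F -> (nu D != 0)%E ->
  sweep F x ^+ 2 <= fine (nu D) * \int[nu]_(s in D) (F (gam s, x) ^+ 2).
Proof.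
move=> nF D0.
by apply: (parameter_integral_sqr mD fD (measurable_sweep_fun nF)) => // y; exact: sweep_fun_pt_bounded.
Qed.

Lemma sweep_test F (K : set 'cV[R]_n) psi : nice F -> compact K -> continuous psi ->
  (forall x, ~ K x -> psi x = 0) ->
  has_int (leb R n) setT (fun x => sweep F x * psi x)
    (\int[nu]_(s in D) \int[leb R n]_x (F (gam s, x) * psi x)) /\
  nu.-integrable D (fun s => (\int[leb R n]_x (F (gam s, x) * psi x))%:E).
Proof.
move=> nF cK cp p0.
have mp := continuous_measurable_cV cp.
have [L KL] := compact_cbox cK.
have [M hM] := sweep_fun_bounded L nF.
have [Mp Mp0 hMp] := compact_support_bounded cp cK p0.
have ip := integrable_support mp cK p0 hMp.
pose g (z : T * 'cV[R]_n) := F (gam z.1, z.2) * psi z.2.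
have mg : measurable_fun setT g.
  by apply: measurable_funM; [exact: measurable_sweep_fun|exact: (measurableT_comp mp)].
have bg x : exists M0 : R, forall s, D s -> `|g (s, x)| <= M0.
  have [M0 b] := sweep_fun_pt_bounded x nF; exists (M0 * `|psi x|) => s Ds.
  by rewrite normrM ler_wpM2r// b.
have hg s : D s -> (\int[leb R n]_x `|(g (s, x))%:E| <=
    (fine (`|M|%:E * \int[leb R n]_x `|(psi x)%:E|))%:E)%E.
  move=> Ds; have ia := integrable_abse ip.
  rewrite fineK; last first.
    by apply: fin_numM => //; exact: integrable_fin_num.
  rewrite -ge0_integralZl//; last by apply: measurableT_comp => //; exact/measurable_EFinP.
  apply: ge0_le_integral => //.
  - apply: measurableT_comp => //; apply/measurable_EFinP.
    by apply: (measurableT_comp mg); exact: measurable_pair1.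
  - apply: measurable_funeM; by apply: measurableT_comp => //; exact/measurable_EFinP.
  - move=> x _; rewrite /= -EFinM lee_fin normrM.
    have [Kx|/p0 ->] := pselect (K x); last by rewrite normr0 !mulr0.
    rewrite ler_wpM2r//; apply: le_trans (ler_norm _); apply: hM => // i.
    by have /= := KL x Kx i; rewrite in_itv/= -ler_norml.
have [_ h1 h2] := fubini_param mD fD mg bg hg.
split=> //; apply: (has_int_ext h1) => x.
rewrite /g/= RintegralZr//; exact: (proj1 (sweep_has_int x nF)).
Qed.

Section gaussian.
Variable m : {sigma_finite_measure set 'cV[R]_n -> \bar R}.

(** Cauchy-Schwarz in the parameter followed by Tonelli: the L^2 norm of a superposition is at most
    the measure of D times a uniform bound on the norms of its members. *)
Lemma sweep_sqr_integral F (M : R) : nice F -> (nu D != 0)%E ->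
  (forall s, D s -> (\int[m]_x (F (gam s, x) ^+ 2)%:E <= M%:E)%E) ->
  (\int[m]_x (sweep F x ^+ 2)%:E <= (fine (nu D) ^+ 2 * M)%:E)%E.
Proof.
move=> nF D0 hM.
have nF2 : nice (fun z => F z ^+ 2) by apply: (nice_ext (niceM nF nF)) => z; rewrite expr2.
have L0 : 0 <= fine (nu D) by exact: fine_ge0.
have EL : (fine (nu D))%:E = nu D by rewrite fineK// ge0_fin_numE.
have h := ge0_tonelli_param nu (m := m) mD (measurable_sweep_fun nF2) (fun z => sqr_ge0 _) hM.
have E x : (\int[nu]_(s in D) (F (gam s, x) ^+ 2)%:E = (sweep (fun z => F z ^+ 2) x)%:E)%E.
  have [i2 _] := sweep_has_int x nF2.
  by rewrite /sweep /Rintegral fineK//; exact: integrable_fin_num.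
have m2 := measurable_sweep nF2.
have q0 x : 0 <= sweep (fun z => F z ^+ 2) x by apply: Rintegral_ge0 => s _; exact: sqr_ge0.
apply: (@le_trans _ _ (\int[m]_x ((fine (nu D))%:E * (sweep (fun z => F z ^+ 2) x)%:E))%E).
  apply: ge0_le_integral => //.
  - by move=> x _; rewrite lee_fin sqr_ge0.
  - by apply/measurable_EFinP; apply: measurable_funX; exact: measurable_sweep.
  - by apply: measurable_funeM; exact/measurable_EFinP.
  - by move=> x _; rewrite -EFinM lee_fin; exact: sweep_sqr.
rewrite ge0_integralZl//; [|exact/measurable_EFinP|by move=> x _; rewrite lee_fin].
apply: (@le_trans _ _ ((fine (nu D))%:E * (M%:E * nu D))%E).
  apply: lee_wpmul2l; first by rewrite lee_fin.
  by apply: le_trans h; rewrite le_eqVlt; apply/orP; left; apply/eqP; apply: eq_integral => x _; rewrite -E.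
by rewrite -EL -!EFinM lee_fin (_ : _ * (_ * _) = fine (nu D) ^+ 2 * M)//; ring.
Qed.

Lemma sweep_pairing F (k : 'cV[R]_n -> R) (M : R) : nice F -> nice (fun z => F z * k z.2) ->
  (forall s, D s -> (\int[m]_x `|(F (gam s, x) * k x)%:E| <= M%:E)%E) ->
  has_int m setT (fun x => sweep F x * k x)
    (\int[nu]_(s in D) \int[m]_x (F (gam s, x) * k x)).
Proof.
move=> nF nk hM.
have bg x : exists M0 : R, forall s, D s -> `|F (gam s, x) * k x| <= M0.
  by have [M0 b] := sweep_fun_pt_bounded x nk; exists M0 => s Ds; exact: (b s Ds).
have [_ h _] := fubini_param mD fD (measurable_sweep_fun nk) bg hM.
apply: (has_int_ext h) => x /=.
by rewrite RintegralZr//; exact: (proj1 (sweep_has_int x nF)).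
Qed.

End gaussian.
End nice_integral.

(** * The parameter square and iterated integrals over it *)

Section box.
Context {R : realType}.
Local Notation Omega := (measurableTypeR R * measurableTypeR R)%type.
Local Notation leb1 := (@lebesgue_measure R).
Definition lebR : {sigma_finite_measure set (measurableTypeR R) -> \bar R} := @lebesgue_measure R.

Definition seg (eps : R) : set (measurableTypeR R) := `[- eps, eps]%classic.
Definition sqr eps : set Omega := seg eps `*` seg eps.

Lemma measurable_seg eps : measurable (seg eps). Proof. exact: measurable_itv. Qed.
Lemma measurable_sqr eps : measurable (sqr eps).
Proof. by apply: measurableX; exact: measurable_seg. Qed.

Lemma leb_seg eps : 0 <= eps -> lebR (seg eps) = (2 * eps)%:E.
Proof.
rewrite le_eqVlt => /predU1P[<-|eps0].
  by rewrite /lebR /seg /= lebesgue_measure_itv/= lte_fin oppr0 ltxx mulr0.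
rewrite /lebR /seg /= lebesgue_measure_itv/= lte_fin ifT; last by lra.
by rewrite -EFinB; congr _%:E; ring.
Qed.

Lemma lebX_sqr eps : 0 <= eps -> (lebR \x lebR)%E (sqr eps) = ((2 * eps) ^+ 2)%:E.
Proof.
move=> eps0.
have E : ((lebR \x lebR) (sqr eps) = lebR (seg eps) * lebR (seg eps))%E.
  by apply: product_measure1E; exact: measurable_seg.
by rewrite E leb_seg// -EFinM expr2.
Qed.

Let sigma_finite_lebX : sigma_finite setT (lebR \x lebR)%E.
Proof.
exists (fun k => sqr k%:R).
  apply/esym/seteqP; split=> // -[x y] _ /=.
  exists (Num.bound (`|x| + `|y|)) => //=.
  have := archi_boundP (addr_ge0 (normr_ge0 x) (normr_ge0 y)).
  set N := (_)%:R => h; rewrite /sqr /seg /= !in_itv/= -!ler_norml.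
  by split; apply: le_trans (ltW h); rewrite ?lerDl ?lerDr.
by move=> k; split; [exact: measurable_sqr|rewrite lebX_sqr// ltry].
Qed.

Let lebX : {measure set Omega -> \bar R} := (lebR \x lebR)%E.
Let lebX_sigma_finite := Measure_isSigmaFinite.Build _ _ _ lebX sigma_finite_lebX.

(* the canonical sigma-finite structure on product measures only covers
   subprobabilities *)
Definition area : {sigma_finite_measure set Omega -> \bar R} :=
  HB.pack (lebX : set Omega -> \bar R) lebX lebX_sigma_finite.

Lemma area_sqr eps : 0 <= eps -> area (sqr eps) = ((2 * eps) ^+ 2)%:E.
Proof. exact: lebX_sqr. Qed.

Variable eps : R.
Hypothesis eps0 : 0 < eps.

Let box_integrable (g : Omega -> R) (M : R) : measurable_fun setT g ->
  (forall p, sqr eps p -> `|g p| <= M) -> area.-integrable setT ((EFin \o g) \_ (sqr eps)).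
Proof.
move=> mg bg; have fA : (area (sqr eps) < +oo)%E by rewrite area_sqr ?ltry// ltW.
apply/(integrable_mkcond _ (measurable_sqr _)).
apply: measurable_bounded_integrable; [exact: measurable_sqr|exact: fA|exact: measurable_funTS|].
exists M; split; first exact: num_real.
by move=> N MN x Dx; exact: le_trans (bg x Dx) (ltW MN).
Qed.

Lemma box_integral_iter1 (g : Omega -> R) (h : R -> R) (M : R) : measurable_fun setT g ->
  (forall p, sqr eps p -> `|g p| <= M) ->
  (forall s, seg eps s -> (\int[lebR]_(tau in seg eps) (g (s, tau))%:E = (h s)%:E)%E) ->
  \int[area]_(p in sqr eps) g p = \int[lebR]_(s in seg eps) h s.
Proof.
move=> mg bg gh.
pose f := (EFin \o g) \_ (sqr eps); have fi := box_integrable mg bg.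
rewrite /Rintegral; congr fine.
rewrite integral_mkcond -/f -(integral12_prod_meas1 fi) [RHS]integral_mkcond.
apply: eq_integral => s _; rewrite /fubini_F [RHS]patchE; case: ifPn => sI.
  transitivity (\int[lebR]_(tau in seg eps) (g (s, tau))%:E)%E; last exact: gh (set_mem sI).
  rewrite [RHS]integral_mkcond.
  apply: eq_integral => tau _; rewrite /f !patchE.
  by rewrite in_setX sI.
by apply: integral0_eq => tau _; rewrite /f patchE in_setX (negbTE sI).
Qed.

Lemma box_integral_iter2 (g : Omega -> R) (h : R -> R) (M : R) : measurable_fun setT g ->
  (forall p, sqr eps p -> `|g p| <= M) ->
  (forall tau, seg eps tau -> (\int[lebR]_(s in seg eps) (g (s, tau))%:E = (h tau)%:E)%E) ->
  \int[area]_(p in sqr eps) g p = \int[lebR]_(tau in seg eps) h tau.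
Proof.
move=> mg bg gh.
pose f := (EFin \o g) \_ (sqr eps); have fi := box_integrable mg bg.
rewrite /Rintegral; congr fine.
rewrite integral_mkcond -/f -(integral21_prod_meas1 fi) [RHS]integral_mkcond.
apply: eq_integral => tau _; rewrite /fubini_G [RHS]patchE; case: ifPn => tI.
  transitivity (\int[lebR]_(s in seg eps) (g (s, tau))%:E)%E; last exact: gh (set_mem tI).
  rewrite [RHS]integral_mkcond.
  apply: eq_integral => s _; rewrite /f !patchE.
  by rewrite in_setX tI andbT.
by apply: integral0_eq => s _; rewrite /f patchE in_setX (negbTE tI) andbF.
Qed.

End box.

(** * The quasimode and its boundary terms *)

Lemma nice_slice {R : realType} {n : nat} F (x : 'cV[R]_n) : nice F ->
  measurable_fun setT (fun z : measurableTypeR R * measurableTypeR R => F (z, x)).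
Proof. by move=> [mF _]; apply: (measurableT_comp mF); exact: measurable_pair2. Qed.

Section quasimode_box.
Context {R : realType} {n : nat} (Q B S : 'M[R]_n) (p r vp vr : 'cV[R]_n).
Variables (t lam th c0 : R).
Hypothesis ST : S^T = S.
Hypothesis lyap : B *m S + S *m B^T = - Q.
Hypothesis t0 : 0 <= t.
Variable eps : R.
Hypothesis eps0 : 0 < eps.
Hypothesis eps1 : eps <= 1.
Local Notation Omega := (measurableTypeR R * measurableTypeR R)%type.
Local Notation pk := (packet B S p r vp vr t lam th c0).
Local Notation pks := (packet_s B S p r vp vr t lam th c0).
Local Notation pkt := (packet_tau B S p r vp vr t lam th c0).

Definition boxmode kappa : 'cV[R]_n -> R :=
  sweep area (sqr eps) id (fun z => pk kappa z.1.1 z.1.2 z.2).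
Definition edge_s kappa a : 'cV[R]_n -> R :=
  sweep lebR (seg eps) (fun tau => (a, tau)) (fun z => pk kappa z.1.1 z.1.2 z.2).
Definition edge_tau kappa a : 'cV[R]_n -> R :=
  sweep lebR (seg eps) (fun s => (s, a)) (fun z => pk kappa z.1.1 z.1.2 z.2).
(** Real part, in the phase kappa, of the integral of (d_s + (i / 2) d_tau) E over the square. The
    sides of constant tau enter with i E / 2, and multiplication by i is minus the packet of phase
    kappa - pi / 2. *)
Definition boundary kappa x := edge_s kappa eps x - edge_s kappa (- eps) x
  - 2^-1 * (edge_tau (kappa - pi / 2) eps x - edge_tau (kappa - pi / 2) (- eps) x).

Lemma fin_sqr : (area (sqr eps) < +oo)%E.
Proof. by rewrite area_sqr ?ltry// ltW. Qed.

Lemma fin_seg : (lebR (seg eps) < +oo)%E.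
Proof. by rewrite leb_seg ?ltry// ltW. Qed.

Lemma seg_le1 s : seg eps s -> `|s| <= 1.
Proof. by rewrite /seg/= in_itv/= -ler_norml => h; exact: le_trans h eps1. Qed.

Lemma sqr_le1 (z : Omega) : sqr eps z -> `|z.1| <= 1 /\ `|z.2| <= 1.
Proof. by move=> [/seg_le1 h1 /seg_le1 h2]. Qed.

Lemma edge_s_le1 a : `|a| <= 1 -> forall s, seg eps s ->
  `|((a, s) : Omega).1| <= 1 /\ `|((a, s) : Omega).2| <= 1.
Proof. by move=> a1 s /seg_le1. Qed.

Lemma edge_tau_le1 a : `|a| <= 1 -> forall s, seg eps s ->
  `|((s, a) : Omega).1| <= 1 /\ `|((s, a) : Omega).2| <= 1.
Proof. by move=> a1 s /seg_le1. Qed.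

Lemma epsN1 : `|eps| <= 1 /\ `|- eps| <= 1.
Proof. by rewrite normrN ger0_norm// ltW. Qed.

Lemma measurable_edge_s a : measurable_fun setT (fun tau : measurableTypeR R => (a, tau) : Omega).
Proof. exact: measurable_pair1. Qed.

Lemma measurable_edge_tau a : measurable_fun setT (fun s : measurableTypeR R => (s, a) : Omega).
Proof. exact: measurable_pair2. Qed.

Let nk := nice_packet B S p r vp vr t lam th c0.
Let nks := nice_packet_s B S p r vp vr t lam th c0.
Let nkt := nice_packet_tau B S p r vp vr t lam th c0.

Lemma sweep_packet_s kappa x :
  sweep area (sqr eps) id (fun z => pks kappa z.1.1 z.1.2 z.2) x =
  edge_s kappa eps x - edge_s kappa (- eps) x.
Proof.
have [e1 e2] := epsN1.
have h1 := sweep_has_int (measurable_seg eps) fin_seg (measurable_edge_s eps) (edge_s_le1 e1) x (nk kappa).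
have h2 := sweep_has_int (measurable_seg eps) fin_seg (measurable_edge_s (- eps)) (edge_s_le1 e2) x (nk kappa).
have [_ <-] := has_intB (measurable_seg eps) h1 h2.
have mid : measurable_fun setT (@id Omega) by [].
have [M bM] := sweep_fun_pt_bounded sqr_le1 x (nks kappa).
have mg := nice_slice x (nks kappa).
apply: (box_integral_iter2 eps0 (g := fun z : Omega => pks kappa z.1 z.2 x) mg bM) => tau _.
have e : - eps < eps by rewrite gtrN.
exact: (FTC_line (fun s => is_derive_packet_s B p r vp vr t lam th c0 ST kappa tau x s)
  (@continuous_packet_s R n B S p r vp vr t lam th c0 ST kappa tau x) e).
Qed.

Lemma sweep_packet_tau kappa x :
  sweep area (sqr eps) id (fun z => pkt kappa z.1.1 z.1.2 z.2) x =
  edge_tau kappa eps x - edge_tau kappa (- eps) x.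
Proof.
have [e1 e2] := epsN1.
have h1 := sweep_has_int (measurable_seg eps) fin_seg (measurable_edge_tau eps) (edge_tau_le1 e1) x (nk kappa).
have h2 := sweep_has_int (measurable_seg eps) fin_seg (measurable_edge_tau (- eps)) (edge_tau_le1 e2) x (nk kappa).
have [_ <-] := has_intB (measurable_seg eps) h1 h2.
have mid : measurable_fun setT (@id Omega) by [].
have [M bM] := sweep_fun_pt_bounded sqr_le1 x (nkt kappa).
have mg := nice_slice x (nkt kappa).
apply: (box_integral_iter1 eps0 (g := fun z : Omega => pkt kappa z.1 z.2 x) mg bM) => s _.
have e : - eps < eps by rewrite gtrN.
exact: (FTC_line (fun tau => is_derive_packet_tau B p r vp vr t lam th c0 ST kappa s x tau)
  (@continuous_packet_tau R n B S p r vp vr t lam th c0 ST kappa s x) e).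
Qed.

(** The operator falls on the packets under the integral, the evolution equation replaces it by
    multiplication by z plus derivatives in the parameters, and these integrate to the sides of the
    square. Multiplication by z mixes real and imaginary parts, whence the two phases. *)
Lemma OU_weak_boxmode kappa phi : test_function phi ->
  OU_weak Q B (boxmode kappa) phi =
  \int[leb R n]_x ((- (\tr B / 2 + t) * boxmode kappa x + t * lam * boxmode (kappa - pi / 2) x
    + boundary kappa x) * phi x).
Proof.
move=> tphi.
have cK := compact_tsupp tphi.
have mid : measurable_fun setT (@id Omega) by [].
have ST2 F psi := @sweep_test _ _ _ n area _ _ (measurable_sqr eps) fin_sqr mid sqr_le1 F _ psi ^~ cK.
have c0' := @test_continuous R n phi tphi [::]; have z0 := @test_eq0 R n phi [::].
have hQ i j := ST2 _ _ (nk kappa) (@test_continuous R n phi tphi [:: j; i]) (@test_eq0 R n phi [:: j; i]).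
have hB i j := ST2 _ _ (nk kappa) (@continuous_partial_coordM R n phi tphi i j) (@partial_coordM_eq0 R n phi tphi i j).
pose V (z : Omega * 'cV[R]_n) := pks kappa z.1.1 z.1.2 z.2
  - 2^-1 * pkt (kappa - pi / 2) z.1.1 z.1.2 z.2
  - (\tr B / 2 + t) * pk kappa z.1.1 z.1.2 z.2 + t * lam * pk (kappa - pi / 2) z.1.1 z.1.2 z.2.
have nV : nice V.
  apply: niceD; [apply: niceB; [apply: niceB|]|].
  - exact: nks.
  - by apply: niceM; [exact: nice_cst|exact: nkt].
  - by apply: niceM; [exact: nice_cst|exact: nk].
  - by apply: niceM; [exact: nice_cst|exact: nk].
have mS := measurable_sqr eps.
have EV x : sweep area (sqr eps) id V x = - (\tr B / 2 + t) * boxmode kappa x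
    + t * lam * boxmode (kappa - pi / 2) x + boundary kappa x.
  have hs F nF := @sweep_has_int _ _ _ _ area _ _ mS fin_sqr mid sqr_le1 F x nF.
  have [_] := has_intD mS (has_intB mS (has_intB mS (hs _ (nks kappa))
    (has_intZ mS 2^-1 (hs _ (nkt (kappa - pi / 2))))) (has_intZ mS (\tr B / 2 + t) (hs _ (nk kappa))))
    (has_intZ mS (t * lam) (hs _ (nk (kappa - pi / 2)))).
  rewrite sweep_packet_s sweep_packet_tau -/(boxmode _) /boundary => E.
  by rewrite /sweep E -!/(boxmode _ _) /boxmode; ring.
have [[_ EVi] _] := ST2 _ _ nV c0' z0.
transitivity (\int[area]_(z in sqr eps) \int[leb R n]_x (V (z, x) * phi x)); last first.
  by rewrite -EVi; apply: eq_Rintegral => x _; rewrite EV.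
have vQ i j : has_int area (sqr eps)
    (fun z => \int[leb R n]_x (pk kappa z.1 z.2 x * partial j (partial i phi) x))
    (\int[leb R n]_x (boxmode kappa x * partial j (partial i phi) x)).
  by have [[_ e] h] := hQ i j; split=> //; rewrite -e.
have vB i j : has_int area (sqr eps)
    (fun z => \int[leb R n]_x (pk kappa z.1 z.2 x * partial i (fun x => x j 0 * phi x) x))
    (\int[leb R n]_x (boxmode kappa x * partial i (fun x => x j 0 * phi x) x)).
  by have [[_ e] h] := hB i j; split=> //; rewrite -e.
have [_ <-] : has_int area (sqr eps) (fun z => OU_weak Q B (pk kappa z.1 z.2) phi)
    (OU_weak Q B (boxmode kappa) phi).
  apply: has_intB => //; first apply: has_intZ => //.
    by apply: has_int_sum => // i; apply: has_int_sum => // j; exact: has_intZ (vQ i j).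
  by apply: has_int_sum => // i; apply: has_int_sum => // j; exact: has_intZ (vB i j).
apply: eq_Rintegral => z _.
rewrite OU_weak_cexp//; apply: eq_Rintegral => x _; congr (_ * _).
rewrite -addrA; exact: (packet_evolution p r vp vr lam th c0 ST lyap t0).
Qed.

End quasimode_box.

(** * Estimates in L2 *)

Section L2norm.
Context {R : realType} {n : nat} (mu : probability 'cV[R]_n R).
Implicit Types u : 'cV[R]_n -> R[i].

Lemma L2normE u : (L2norm mu u =
  (\int[mu]_x (complex.Re (u x) ^+ 2 + complex.Im (u x) ^+ 2)%:E) `^ 2^-1)%E.
Proof.
rewrite /L2norm unlock; congr (_ `^ _)%E; apply: eq_integral => x _.
transitivity ((`|Normc.normc (u x)|%:E) `^ 2)%E; first by [].
rewrite poweR_EFin powR_mulrn//; congr _%:E.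
by case: (u x) => a b /=; rewrite ger0_norm ?sqrtr_ge0// sqr_sqrtr// addr_ge0 ?sqr_ge0.
Qed.

Let I_ge0 u : (0 <= \int[mu]_x (complex.Re (u x) ^+ 2 + complex.Im (u x) ^+ 2)%:E)%E.
Proof. by apply: integral_ge0 => x _; rewrite lee_fin addr_ge0 ?sqr_ge0. Qed.

Let sqrtE (r : R) : 0 <= r -> (r%:E = (r ^+ 2)%:E `^ 2^-1)%E.
Proof.
move=> r0; rewrite poweR_EFin -powR_mulrn// -powRrM divff// powRr1//.
Qed.

Lemma L2norm_le u (r : R) : 0 <= r ->
  (\int[mu]_x (complex.Re (u x) ^+ 2 + complex.Im (u x) ^+ 2)%:E <= (r ^+ 2)%:E)%E ->
  (L2norm mu u <= r%:E)%E.
Proof.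
move=> r0 h; rewrite L2normE (sqrtE r0).
apply: gt0_ler_poweR => //; first by rewrite in_itv/= I_ge0 leey.
by rewrite in_itv/= lee_fin sqr_ge0 leey.
Qed.

Lemma L2norm_ge u (r : R) : 0 <= r ->
  ((r ^+ 2)%:E <= \int[mu]_x (complex.Re (u x) ^+ 2 + complex.Im (u x) ^+ 2)%:E)%E ->
  (r%:E <= L2norm mu u)%E.
Proof.
move=> r0 h; rewrite L2normE (sqrtE r0).
apply: gt0_ler_poweR => //; last by rewrite in_itv/= I_ge0 leey.
by rewrite in_itv/= lee_fin sqr_ge0 leey.
Qed.

End L2norm.

(** * Gaussian integrals of complex exponentials *)

Section cexp_integral.
Context {R : realType} {n : nat} (S : 'M[R]_n) (mu : probability 'cV[R]_n R).
Hypothesis ST : S^T = S.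
Hypothesis muS : forall A, measurable A ->
  mu A = (\int[leb R n]_(x in A) (gauss S x)%:E)%E.
Implicit Types a b : 'cV[R]_n.

Lemma integral_gaussian_expRD a (c : R) :
  (\int[mu]_x (expR (dot a x + c))%:E = (expR (2^-1 * dot (S *m a) a + c))%:E)%E.
Proof.
under eq_integral do rewrite expRD mulrC EFinM.
rewrite ge0_integralZl ?lee_fin ?expR_ge0//.
  by rewrite (integral_gaussian_expR ST muS) -EFinM mulrC -expRD.
by apply/measurable_EFinP; apply: measurableT_comp => //; exact: measurable_dotp.
Qed.

Lemma cexp_sqr_le a b (c d : R) x : cexp a b c d x ^+ 2 <= expR (dot (2 *: a) x + 2 * c).
Proof.
rewrite /cexp exprMn -expRM_natr dotZl.
rewrite (_ : (_ + c) * 2 = 2 * dot a x + 2 * c); last by ring.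
by rewrite ler_piMr ?expR_ge0// -(cos2Dsin2 (dot b x + d)) lerDl sqr_ge0.
Qed.

Lemma norm_cexp_le a b (c d : R) x : `|cexp a b c d x| <= expR (dot a x + c).
Proof.
rewrite /cexp normrM ger0_norm ?expR_ge0// ler_piMr ?expR_ge0//.
by rewrite ler_norml cos_geN1 cos_le1.
Qed.

Lemma measurable_cexp a b (c d : R) : measurable_fun setT (cexp a b c d).
Proof. by apply: continuous_measurable_cV; exact: continuous_cexp. Qed.

Lemma integral_cexp_sqr_le a b (c d : R) :
  (\int[mu]_x (cexp a b c d x ^+ 2)%:E <= (expR (2 * (dot (S *m a) a + c)))%:E)%E.
Proof.
have -> : 2 * (dot (S *m a) a + c) = 2^-1 * dot (S *m (2 *: a)) (2 *: a) + 2 * c.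
  by rewrite -scalemxAr dotZl dotZr; field.
rewrite -integral_gaussian_expRD; apply: ge0_le_integral => //.
- by move=> x _; rewrite lee_fin sqr_ge0.
- by apply/measurable_EFinP; apply: measurable_funX; exact: measurable_cexp.
- apply/measurable_EFinP; apply: measurableT_comp => //.
  by apply: measurable_funD => //; exact: measurable_dotp.
- by move=> x _; rewrite lee_fin cexp_sqr_le.
Qed.

Lemma integral_norm_cexp_le a b (c d : R) :
  (\int[mu]_x `|(cexp a b c d x)%:E| <= (expR (2^-1 * dot (S *m a) a + c))%:E)%E.
Proof.
rewrite -integral_gaussian_expRD; apply: ge0_le_integral => //.
- by apply: measurableT_comp => //; apply/measurable_EFinP; exact: measurable_cexp.
- apply/measurable_EFinP; apply: measurableT_comp => //.
  by apply: measurable_funD => //; exact: measurable_dotp.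
- by move=> x _; rewrite lee_fin norm_cexp_le.
Qed.

Lemma Rintegral_cexp a b (c d : R) :
  \int[mu]_x cexp a b c d x =
  expR (2^-1 * (dot (S *m a) a - dot (S *m b) b) + c) * cos (dot (S *m a) b + d).
Proof.
have ic : mu.-integrable setT (EFin \o (fun x => expR (dot a x) * cos (dot b x + d))).
  have : mu.-integrable setT (EFin \o cexp a b 0 d).
    apply/integrableP; split; first by apply/measurable_EFinP; exact: measurable_cexp.
    by apply: le_lt_trans (integral_norm_cexp_le _ _ _ _) _; rewrite ltry.
  by congr (_.-integrable _ _); apply/funext => x /=; rewrite /cexp addr0.
transitivity (\int[mu]_x (expR c * (expR (dot a x) * cos (dot b x + d)))).
  by apply: eq_Rintegral => x _; rewrite /cexp expRD mulrA [expR c * _]mulrC.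
rewrite RintegralZl// (integral_gaussian_expR_cos ST muS) expRD; ring.
Qed.

End cexp_integral.

(** * Square integrability with explicit bounds *)

Section square_integrable.
Context d (T : measurableType d) {R : realType} (mu : {measure set T -> \bar R}).
Implicit Types f g : T -> R.

Definition sqint f (M : R) :=
  measurable_fun setT f /\ (\int[mu]_x (f x ^+ 2)%:E <= M%:E)%E.

Let msqr f : measurable_fun setT f -> measurable_fun setT (fun x => (f x ^+ 2)%:E).
Proof. by move=> mf; apply/measurable_EFinP; exact: measurable_funX. Qed.

Lemma sqintZ k f M : sqint f M -> sqint (fun x => k * f x) (k ^+ 2 * M).
Proof.
move=> [mf fM]; split; first exact: measurable_funM.
under eq_integral do rewrite exprMn EFinM.
rewrite ge0_integralZl//; [|exact: msqr|by move=> x _; rewrite lee_fin sqr_ge0|by rewrite lee_fin sqr_ge0].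
by rewrite [leRHS]EFinM lee_wpmul2l// lee_fin sqr_ge0.
Qed.

Lemma sqint_sum (I : Type) (r : seq I) (c : I -> R) f (F : I -> T -> R) (M : I -> R) :
  measurable_fun setT f -> (forall i, 0 <= c i) ->
  (forall i, sqint (F i) (M i)) ->
  (forall x, f x ^+ 2 <= \sum_(i <- r) c i * F i x ^+ 2) ->
  sqint f (\sum_(i <- r) c i * M i).
Proof.
move=> mf c0 hF hf; split=> //.
apply: (@le_trans _ _ (\int[mu]_x (\sum_(i <- r) (c i * F i x ^+ 2)%:E))%E).
  apply: ge0_le_integral => //.
  - by move=> x _; rewrite lee_fin sqr_ge0.
  - exact: msqr.
  - apply: emeasurable_sum => i; apply/measurable_EFinP; apply: measurable_funM => //.
    by apply: measurable_funX; case: (hF i).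
  - by move=> x _; rewrite sumEFin lee_fin.
rewrite ge0_integral_sum//; last 2 first.
- move=> i; apply/measurable_EFinP; apply: measurable_funM => //.
  by apply: measurable_funX; case: (hF i).
- by move=> i x _; rewrite lee_fin mulr_ge0// sqr_ge0.
rewrite -sumEFin; apply: lee_sum => i _.
have [mF FM] := hF i.
under eq_integral do rewrite EFinM.
rewrite ge0_integralZl//; [|exact: msqr|by move=> x _; rewrite lee_fin sqr_ge0|by rewrite lee_fin].
by rewrite [leRHS]EFinM lee_wpmul2l// lee_fin.
Qed.

Lemma sqintD f g M N : sqint f M -> sqint g N -> sqint (fun x => f x + g x) (2 * M + 2 * N).
Proof.
move=> hf hg; have [mf _] := hf; have [mg _] := hg.
have := @sqint_sum bool [:: true; false] (fun=> 2) (fun x => f x + g x)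
  (fun b => if b then f else g) (fun b => if b then M else N).
rewrite !big_cons big_nil addr0; apply=> //; first exact: measurable_funD.
  by case.
move=> x; rewrite !big_cons big_nil addr0 -subr_ge0.
by rewrite (_ : _ - _ = (f x - g x) ^+ 2) ?sqr_ge0//; ring.
Qed.

Lemma integrable_sqint f M : sqint f M -> mu.-integrable setT (EFin \o (fun x => f x ^+ 2)).
Proof.
move=> [mf fM]; apply/integrableP; split; first exact: msqr.
under eq_integral do rewrite /= ger0_norm ?sqr_ge0//.
by apply: le_lt_trans fM _; rewrite ltry.
Qed.

End square_integrable.

Lemma sqr_boundary_le {R : realType} (a b c e : R) :
  (a - b - 2^-1 * (c - e)) ^+ 2 <= 4 * a ^+ 2 + (4 * b ^+ 2 + (4 * c ^+ 2 + 4 * e ^+ 2)).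
Proof.
have a1 := sqr_ge0 (a + b); have a2 := sqr_ge0 (c + e).
have a3 := sqr_ge0 (a - b + 2^-1 * (c - e)); have a4 := sqr_ge0 c; have a5 := sqr_ge0 e.
nra.
Qed.

(** * Lower bound of the quasimode and upper bound of its boundary terms *)

Section quasimode_L2.
Context {R : realType} {n : nat} (Q B S : 'M[R]_n) (p r vp vr : 'cV[R]_n).
Variables (t lam th c0 : R) (mu : probability 'cV[R]_n R).
Hypothesis ST : S^T = S.
Hypothesis muS : forall A, measurable A ->
  mu A = (\int[leb R n]_(x in A) (gauss S x)%:E)%E.
Hypothesis lyap : B *m S + S *m B^T = - Q.
Hypothesis t0 : 0 <= t.
Variable eps : R.
Hypothesis eps0 : 0 < eps.
Hypothesis eps1 : eps <= 1.
Local Notation Omega := (measurableTypeR R * measurableTypeR R)%type.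
Local Notation pk := (packet B S p r vp vr t lam th c0).
Local Notation lev := (level B S p r vp vr t th c0).
Local Notation w := (boxmode B S p r vp vr t lam th c0 eps).
Local Notation bd := (boundary B S p r vp vr t lam th c0 eps).
Local Notation es := (edge_s B S p r vp vr t lam th c0 eps).
Local Notation et := (edge_tau B S p r vp vr t lam th c0 eps).
Let nk := nice_packet B S p r vp vr t lam th c0.
Let mS := measurable_sqr eps.
Let mI := measurable_seg eps.
Let fS := fin_sqr eps0.
Let fI := fin_seg eps0.
Let mid : measurable_fun setT (@id Omega). Proof. by []. Qed.
Let S1 := sqr_le1 eps1.

Lemma integral_packet_sqr kappa s tau :
  (\int[mu]_x (pk kappa s tau x ^+ 2)%:E <= (expR (2 * lev s tau))%:E)%E.
Proof.
apply: le_trans (integral_cexp_sqr_le ST muS _ _ _ _) _.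
rewrite lee_fin ler_expR /level -scalemxAr dotZl dotZr mulrA -expr2 sqr_sqrtr//.
by rewrite [t * _ + _]addrC.
Qed.

Let area_neq0 : (area (sqr eps) != 0)%E.
Proof.
by rewrite area_sqr ?ltW// eqe; apply: lt0r_neq0; rewrite exprn_gt0// mulr_gt0.
Qed.

Let seg_neq0 : (lebR (seg eps) != 0)%E.
Proof. by rewrite leb_seg ?ltW// eqe; apply: lt0r_neq0; rewrite mulr_gt0. Qed.

Lemma sqint_boxmode kappa : exists M, sqint mu (w kappa) M.
Proof.
(* [level] does not involve x, so niceness evaluated at x = 0 bounds it over the whole square. *)
have [_ /(_ 1)[M hM]] := nice_expR (niceM (nice_cst 2) (nice_level B S p r vp vr t th c0)).
eexists; split; first by exact: (measurable_sweep mS fS mid S1 (nk kappa)).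
apply: (sweep_sqr_integral mS fS mid S1 (m := mu) (M := M) (nk kappa) area_neq0) => z Dz.
apply: le_trans (integral_packet_sqr _ _ _) _; rewrite lee_fin.
have [h1 h2] := S1 Dz.
have h3 i : `|(0 : 'cV[R]_n) i 0| <= 1 by rewrite mxE normr0.
exact: le_trans (ler_norm _) (hM z.1 z.2 0 h1 h2 h3).
Qed.

Lemma boxmode_pi kappa x : w (kappa - pi / 2 - pi / 2) x = - w kappa x.
Proof.
have [_] := has_intZ mS (-1) (sweep_has_int mS fS mid S1 x (nk kappa)).
rewrite mulN1r => <-.
by rewrite /boxmode /sweep; apply: eq_Rintegral => z _; rewrite packet_pi mulN1r.
Qed.

(* log-modulus and argument of the scalar product of the packet with the coherent
   state at [sqrt t (p + i r)], which is [probe] below up to a constant phase *)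
Definition pair_amp s tau := t * (dot (S *m orbit_re B p vp vr s tau) p
  + dot (S *m orbit_im B r vp vr s tau) r + 2^-1 * th * (s ^+ 2 / 4 - tau ^+ 2))
  + s * \tr B / 2 + c0.

Definition pair_phase s tau := t * (dot (S *m p) (orbit_im B r vp vr s tau)
  - dot (S *m orbit_re B p vp vr s tau) r + lam * s - 2 * tau + 2^-1 * th * s * tau).

(** Real part of the scalar product of the quasimode with the coherent state, the integral in x
    having been computed inside the one over the square. *)
Definition pairing := \int[area]_(z in sqr eps) (expR (pair_amp z.1 z.2) * cos (pair_phase z.1 z.2)).

Let probe kappa : 'cV[R]_n -> R :=
  cexp (Num.sqrt t *: p) (Num.sqrt t *: r)
    (- (t / 2) * (dot (S *m p) p - dot (S *m r) r)) (- t * dot (S *m p) r + kappa).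

(** The real part of a packet times the conjugate of [probe] is again of the form [cexp], by the
    formula for the cosine of a difference, so its Gaussian integral is explicit. *)
Let paired s tau : 'cV[R]_n -> R := cexp (Num.sqrt t *: (orbit_re B p vp vr s tau + p))
  (Num.sqrt t *: (orbit_im B r vp vr s tau - r))
  (amp B S p r vp vr t th c0 s tau - (t / 2) * (dot (S *m p) p - dot (S *m r) r))
  (phase B S p r vp vr t lam th s tau + t * dot (S *m p) r).

Let pairedE s tau x : pk 0 s tau x * probe 0 x + pk (0 - pi / 2) s tau x * probe (0 - pi / 2) x
  = paired s tau x.
Proof.
rewrite /packet /probe /paired.
move: (amp _ _ _ _ _ _ _ _ _ _ _) (phase _ _ _ _ _ _ _ _ _ _ _) => c e.
rewrite /cexp !addrA !addr0 !cosBpihalf !scalerDr scalerN !dotDl dotNl.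
set a := dot (_ *: orbit_re _ _ _ _ _ _) x; set b := dot (_ *: orbit_im _ _ _ _ _ _) x.
set a' := dot (_ *: p) x; set b' := dot (_ *: r) x.
set k := dot (S *m p) p - _; set l := dot (S *m p) r.
have -> : a + a' + c - t / 2 * k = (a + c) + (a' + - (t / 2) * k) by ring.
have -> : b - b' + e + t * l = (b + e) - (b' + - t * l) by ring.
by rewrite (expRD (a + c)) cosB; ring.
Qed.

Let probe_sqr x : probe 0 x ^+ 2 + probe (0 - pi / 2) x ^+ 2 =
  expR (dot ((2 * Num.sqrt t) *: p) x - t * (dot (S *m p) p - dot (S *m r) r)).
Proof.
rewrite /probe /cexp !addrA !addr0 cosBpihalf !exprMn -mulrDr cos2Dsin2 mulr1 -expRM_natr.
by congr expR; rewrite !dotZl; field.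
Qed.

Let integral_probe_sqr : (\int[mu]_x (probe 0 x ^+ 2 + probe (0 - pi / 2) x ^+ 2)%:E =
  (expR (t * (dot (S *m p) p + dot (S *m r) r)))%:E)%E.
Proof.
under eq_integral do rewrite probe_sqr.
rewrite (integral_gaussian_expRD ST muS); congr (expR _)%:E.
have st : Num.sqrt t * Num.sqrt t = t by rewrite -expr2 sqr_sqrtr.
rewrite -scalemxAr dotZl dotZr.
transitivity (2 * (Num.sqrt t * Num.sqrt t) * dot (S *m p) p - t * (dot (S *m p) p - dot (S *m r) r)); first by field.
by rewrite st; ring.
Qed.

Let Ssym a b : dot (S *m a) b = dot (S *m b) a.
Proof. by rewrite dot_mull ST dotC. Qed.

Let Rintegral_paired s tau : \int[mu]_x paired s tau x =
  expR (pair_amp s tau) * cos (pair_phase s tau).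
Proof.
rewrite /paired (Rintegral_cexp ST muS).
have st : Num.sqrt t * Num.sqrt t = t by rewrite -expr2 sqr_sqrtr.
have SZ a b : dot (S *m (Num.sqrt t *: a)) (Num.sqrt t *: b) = t * dot (S *m a) b.
  by rewrite -scalemxAr dotZl dotZr mulrA st.
rewrite !SZ /pair_amp /pair_phase /amp /phase.
set a := orbit_re _ _ _ _ _ _; set b := orbit_im _ _ _ _ _ _.
rewrite !(mulmxDr, mulmxN) !(dotDl, dotDr, dotNl, dotNr) (Ssym p a) (Ssym r b).
congr (expR _ * cos _); by field.
Qed.

Let pair_integrable : has_int mu setT
  (fun x => w 0 x * probe 0 x + w (0 - pi / 2) x * probe (0 - pi / 2) x) pairing.
Proof.
pose F (z : Omega * 'cV[R]_n) := pk 0 z.1.1 z.1.2 z.2 * probe 0 z.2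
  + pk (0 - pi / 2) z.1.1 z.1.2 z.2 * probe (0 - pi / 2) z.2.
have nprobe k : nice (fun z : Omega * 'cV[R]_n => probe k z.2).
  have nx : forall i, nice (fun z : Omega * 'cV[R]_n => z.2 i 0) by move=> i; exact: nice_coord.
  rewrite /probe /cexp; apply: niceM.
    apply: nice_expR; apply: niceD; last exact: nice_cst.
    by apply: nice_dot => // i; exact: nice_cst.
  apply: nice_cos; apply: niceD; last exact: nice_cst.
  by apply: nice_dot => // i; exact: nice_cst.
have nF : nice F by apply: niceD; (apply: niceM; [exact: nk|exact: nprobe]).
have [_ /(_ 1)[M hM]] := nice_expR (niceD (nice_pairing_level B S p r vp vr t th c0)
  (nice_cst (- (t / 2 * (dot (S *m p) p - dot (S *m r) r))))).
have nF1 : nice (fun z => F z * 1) by apply: (nice_ext nF) => z; rewrite mulr1.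
have bF z : sqr eps z -> (\int[mu]_x `|(F (z, x) * 1)%:E| <= M%:E)%E.
  move=> Dz; under eq_integral do rewrite mulr1 /F /= pairedE.
  apply: le_trans (integral_norm_cexp_le ST muS _ _ _ _) _; rewrite lee_fin.
  have [h1 h2] := S1 Dz.
  have h3 i : `|(0 : 'cV[R]_n) i 0| <= 1 by rewrite mxE normr0.
  have := le_trans (ler_norm _) (hM z.1 z.2 0 h1 h2 h3); apply: le_trans.
  rewrite ler_expR /= -scalemxAr dotZl dotZr [in leLHS]mulrA -expr2 mulrA sqr_sqrtr//.
  by rewrite -!addrA lexx.
have [h e] := sweep_pairing mS fS mid S1 (m := mu) (k := fun=> 1) nF nF1 bF.
have E x : sweep area (sqr eps) id F x * 1 =
    w 0 x * probe 0 x + w (0 - pi / 2) x * probe (0 - pi / 2) x.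
  have hs k := sweep_has_int mS fS mid S1 x (nk k).
  have [_] := has_intD mS (has_intZ mS (probe 0 x) (hs 0)) (has_intZ mS (probe (0 - pi / 2) x) (hs (0 - pi / 2))).
  rewrite mulr1 [w 0 x * _]mulrC [w (0 - pi / 2) x * _]mulrC => <-.
  by apply: eq_Rintegral => z _; rewrite /F/=; ring.
split; first by move: h; congr (_.-integrable _ _); apply/funext => x; rewrite /= E.
transitivity (\int[mu]_x (sweep area (sqr eps) id F x * 1)); first by apply: eq_Rintegral => x _; rewrite E.
rewrite e; apply: eq_Rintegral => z _.
transitivity (\int[mu]_x paired z.1 z.2 x); last by rewrite Rintegral_paired.
by apply: eq_Rintegral => x _; rewrite mulr1 /F/= pairedE.
Qed.

(** Cauchy-Schwarz between the quasimode and the coherent state, whose squared norm is the inverse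
    of the exponential factor. *)
Lemma pairing_sqr_le : 0 < pairing ->
  ((pairing ^+ 2 * expR (- (t * (dot (S *m p) p + dot (S *m r) r))))%:E <=
   \int[mu]_x (w 0 x ^+ 2 + w (0 - pi / 2) x ^+ 2)%:E)%E.
Proof.
move=> P0; set K := t * _.
have [M0 hM0] := sqint_boxmode 0; have [M1 hM1] := sqint_boxmode (0 - pi / 2).
have i0 := has_int_self (integrable_sqint hM0); have i1 := has_int_self (integrable_sqint hM1).
have iU := has_intD measurableT i0 i1.
set U := (X in has_int _ _ _ X) in iU.
have iK : has_int mu setT (fun x => probe 0 x ^+ 2 + probe (0 - pi / 2) x ^+ 2) (expR K).
  split; last by rewrite /Rintegral integral_probe_sqr.
  have mp k : measurable_fun setT (fun x => probe k x ^+ 2).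
    by apply: measurable_funX; exact: measurable_cexp.
  apply/integrableP; split; first by apply/measurable_EFinP; exact: measurable_funD.
  under eq_integral do rewrite gee0_abs ?lee_fin ?addr_ge0 ?sqr_ge0//.
  by rewrite integral_probe_sqr ltry.
(* The weight for which eta U / 2 + exp(K) / (2 eta) >= [pairing] becomes exp(K) U >=
   [pairing]^2. *)
pose eta := expR K / pairing.
have eta0 : 0 < eta by rewrite divr_gt0 ?expR_gt0.
have [_ e] := has_intB measurableT (has_intD measurableT (has_intZ measurableT (eta / 2) iU)
  (has_intZ measurableT (2 * eta)^-1 iK)) pair_integrable.
have : 0 <= eta / 2 * U + (2 * eta)^-1 * expR K - pairing.
  rewrite -e; apply: Rintegral_ge0 => x _.
  move: (w 0 x) (w (0 - pi / 2) x) (probe 0 x) (probe (0 - pi / 2) x) => a b c g.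
  have -> : eta / 2 * (a ^+ 2 + b ^+ 2) + (2 * eta)^-1 * (c ^+ 2 + g ^+ 2) - (a * c + b * g) =
      (2 * eta)^-1 * ((eta * a - c) ^+ 2 + (eta * b - g) ^+ 2).
    by field; rewrite lt0r_neq0.
  by rewrite mulr_ge0 ?invr_ge0 ?addr_ge0 ?sqr_ge0// mulr_ge0// ltW.
have -> : eta / 2 * U + (2 * eta)^-1 * expR K - pairing = (2 * pairing)^-1 * (expR K * U - pairing ^+ 2).
  by rewrite /eta; field; rewrite !lt0r_neq0 ?expR_gt0.
rewrite pmulr_rge0 ?invr_gt0 ?mulr_gt0// subr_ge0 => h.
have -> : (\int[mu]_x (w 0 x ^+ 2 + w (0 - pi / 2) x ^+ 2)%:E = U%:E)%E.
  by case: iU => iU <-; rewrite /Rintegral fineK//; exact: integrable_fin_num.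
by rewrite lee_fin expRN ler_pdivrMr ?expR_gt0// mulrC.
Qed.

Section edges.
Variable m : R.
Hypothesis edge_level : forall s tau, `|s| <= eps -> `|tau| <= eps ->
  `|s| = eps \/ `|tau| = eps -> lev s tau <= m.

Let seg_abs s : seg eps s -> `|s| <= eps.
Proof. by rewrite /seg/= in_itv/= -ler_norml. Qed.

Let edge_bound : fine (lebR (seg eps)) ^+ 2 * expR (2 * m) <= 4 * expR (2 * m).
Proof.
have -> : fine (lebR (seg eps)) = 2 * eps by rewrite leb_seg ?ltW.
apply: ler_wpM2r; first exact: expR_ge0.
rewrite exprMn -natrX -[leRHS]mulr1; apply: ler_wpM2l => //.
by rewrite expr_le1// ltW.
Qed.

Lemma sqint_edge_s kappa a : `|a| = eps -> sqint mu (es kappa a) (4 * expR (2 * m)).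
Proof.
move=> ae; have a1 : `|a| <= 1 by rewrite ae.
split; first by exact: (measurable_sweep mI fI (measurable_edge_s a) (edge_s_le1 eps1 a1) (nk kappa)).
apply: (@le_trans _ _ ((fine (lebR (seg eps)) ^+ 2 * expR (2 * m))%:E)).
  apply: (sweep_sqr_integral mI fI (measurable_edge_s a) (edge_s_le1 eps1 a1) (m := mu) (M := expR (2 * m)) (nk kappa) seg_neq0) => tau Dt.
  apply: le_trans (integral_packet_sqr _ _ _) _.
  rewrite lee_fin ler_expR ler_wpM2l//; apply: edge_level => //=; [by rewrite ae|exact: seg_abs|by left].
by rewrite lee_fin edge_bound.
Qed.

Lemma sqint_edge_tau kappa a : `|a| = eps -> sqint mu (et kappa a) (4 * expR (2 * m)).
Proof.
move=> ae; have a1 : `|a| <= 1 by rewrite ae.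
split; first by exact: (measurable_sweep mI fI (measurable_edge_tau a) (edge_tau_le1 eps1 a1) (nk kappa)).
apply: (@le_trans _ _ ((fine (lebR (seg eps)) ^+ 2 * expR (2 * m))%:E)).
  apply: (sweep_sqr_integral mI fI (measurable_edge_tau a) (edge_tau_le1 eps1 a1) (m := mu) (M := expR (2 * m)) (nk kappa) seg_neq0) => tau Dt.
  apply: le_trans (integral_packet_sqr _ _ _) _.
  rewrite lee_fin ler_expR ler_wpM2l//; apply: edge_level => //=; [exact: seg_abs|by rewrite ae|by right].
by rewrite lee_fin edge_bound.
Qed.

(** Four sides, each with weight 4 from [sqr_boundary_le] and squared norm at most 4 exp(2 m), its
    length being at most 2. *)
Lemma sqint_boundary kappa : sqint mu (bd kappa) (64 * expR (2 * m)).
Proof.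
have e1 : `|eps| = eps by rewrite ger0_norm// ltW.
have e2 : `|- eps| = eps by rewrite normrN.
have h1 := sqint_edge_s kappa e1; have h2 := sqint_edge_s kappa e2.
have h3 := sqint_edge_tau (kappa - pi / 2) e1; have h4 := sqint_edge_tau (kappa - pi / 2) e2.
pose F (i : bool * bool) := if i.1 then es kappa (if i.2 then eps else - eps)
  else et (kappa - pi / 2) (if i.2 then eps else - eps).
have := @sqint_sum _ _ R mu (bool * bool) [:: (true, true); (true, false); (false, true); (false, false)]
  (fun=> 4) (bd kappa) F (fun=> 4 * expR (2 * m)).
rewrite !big_cons !big_nil addr0 => h.
have -> : 64 * expR (2 * m) = 4 * (4 * expR (2 * m)) + (4 * (4 * expR (2 * m)) +
   (4 * (4 * expR (2 * m)) + 4 * (4 * expR (2 * m)))) by ring.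
apply: h => //.
- apply: measurable_funB; first by apply: measurable_funB; [case: h1|case: h2].
  by apply: measurable_funM => //; apply: measurable_funB; [case: h3|case: h4].
- by case=> -[] []; [exact: h1|exact: h2|exact: h3|exact: h4].
move=> x; rewrite !big_cons !big_nil addr0 /F/= /boundary.
exact: sqr_boundary_le.
Qed.


Let z0 : R[i] := - ((\tr B / 2)%:C + t%:C * (1 +i* lam)).

Let z0E : z0 = (- (\tr B / 2 + t)) +i* (- (t * lam)).
Proof.
rewrite /z0 /real_complex_def; apply/eqP; rewrite eq_complex /=; apply/andP.
by split; apply/eqP; ring.
Qed.

Let u x : R[i] := w 0 x +i* w (0 - pi / 2) x.
Let f x : R[i] := bd 0 x +i* bd (0 - pi / 2) x.
(** The value of P u, prescribed as z u plus the boundary terms; that it is P u is then checked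
    against test functions. *)
Let v x : R[i] := z0 * u x + f x.

Let vRe x : complex.Re (v x) = - (\tr B / 2 + t) * w 0 x + t * lam * w (0 - pi / 2) x + bd 0 x.
Proof. by rewrite /v z0E /=; ring. Qed.

Let vIm x : complex.Im (v x) =
  - (\tr B / 2 + t) * w (0 - pi / 2) x + t * lam * w (0 - pi / 2 - pi / 2) x + bd (0 - pi / 2) x.
Proof. by rewrite /v z0E boxmode_pi /=; ring. Qed.

Let inL2_sqint (g : 'cV[R]_n -> R[i]) M N : sqint mu (fun x => complex.Re (g x)) M ->
  sqint mu (fun x => complex.Im (g x)) N -> inL2 mu g.
Proof.
move=> h1 h2; have [m1 _] := h1; have [m2 _] := h2; split=> //.
rewrite L2normE poweR_lty//.
have /integrableP[_] := integrableD measurableT (integrable_sqint h1) (integrable_sqint h2).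
apply: le_lt_trans; apply: ge0_le_integral => //.
- by move=> x _; rewrite lee_fin addr_ge0 ?sqr_ge0.
- by apply/measurable_EFinP; apply: measurable_funD; exact: measurable_funX.
- by apply: measurableT_comp => //; apply/measurable_EFinP; apply: measurable_funD; exact: measurable_funX.
- by move=> x _; exact: lee_abs.
Qed.

(** If z is in the spectrum the norm is +oo by convention. Otherwise u is admissible in the
    supremum, since the real and the imaginary part of (P - z) u contribute 64 exp(2 m) each to its
    squared norm, and |u| is bounded below by its pairing with the coherent state. *)
Lemma resolvent_norm_ge : 128 * expR (2 * m) <= 1 -> 0 < pairing ->
  ((pairing * expR (- (t / 2) * (dot (S *m p) p + dot (S *m r) r)))%:E <=
   resolvent_norm mu (OU_L2 mu Q B) z0)%E.
Proof.
move=> m1 P0; rewrite /resolvent_norm; case: asboolP => [_|_]; last by rewrite leey.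
apply: (@le_trans _ _ (L2norm mu u)).
  apply: L2norm_ge; first by rewrite mulr_ge0 ?expR_ge0// ltW.
  apply: le_trans (pairing_sqr_le P0).
  rewrite lee_fin exprMn -expRM_natr.
  by rewrite (_ : _ * 2%:R = - (t * (dot (S *m p) p + dot (S *m r) r))) ?lexx//; field.
apply: ereal_sup_ubound; exists u, v.
have [M0 h0] := sqint_boxmode 0; have [M1 h1] := sqint_boxmode (0 - pi / 2).
have [M2 h2] := sqint_boxmode (0 - pi / 2 - pi / 2).
have b0 := sqint_boundary 0; have b1 := sqint_boundary (0 - pi / 2).
split; last reflexivity.
- split.
  + exact: (@inL2_sqint u _ _ h0 h1).
  + apply: inL2_sqint.
      under eq_fun do rewrite vRe.
      exact: (sqintD (sqintD (sqintZ (- (\tr B / 2 + t)) h0) (sqintZ (t * lam) h1)) b0).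
    under eq_fun do rewrite vIm.
    exact: (sqintD (sqintD (sqintZ (- (\tr B / 2 + t)) h1) (sqintZ (t * lam) h2)) b1).
  + move=> phi tphi; rewrite OU_distrE /distr_of; congr (_ +i* _).
      rewrite (OU_weak_boxmode p r vp vr lam th c0 ST lyap t0 eps0 eps1 0 tphi).
      by apply: eq_Rintegral => x _; rewrite vRe.
    rewrite (OU_weak_boxmode p r vp vr lam th c0 ST lyap t0 eps0 eps1 (0 - pi / 2) tphi).
    by apply: eq_Rintegral => x _; rewrite vIm.
- have -> : (fun x => v x - z0 * u x) = f by apply/funext => x; rewrite /v addrC addKr.
  apply: L2norm_le => //; rewrite expr1n.
  apply: (@le_trans _ _ (64 * expR (2 * m) + 64 * expR (2 * m))%:E); last first.
    by rewrite lee_fin (le_trans _ m1)// -mulrDl -natrD.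
  have [mb0 ib0] := b0; have [mb1 ib1] := b1.
  have := leeD ib0 ib1.
  rewrite -(ge0_integralD mu measurableT); last 4 first.
  + by move=> x _; rewrite lee_fin sqr_ge0.
  + by apply/measurable_EFinP; exact: measurable_funX.
  + by move=> x _; rewrite lee_fin sqr_ge0.
  + by apply/measurable_EFinP; exact: measurable_funX.
  by rewrite -EFinD.
Qed.

End edges.
End quasimode_L2.

(** * Expansion of the exponents *)

Section bigO.
Context {R : realType}.
Implicit Types f g : R -> R -> R.

(** Order of vanishing at the origin, with one constant on the whole unit square, so that bounds add
    and multiply and a later choice of eps sees no parameter t. *)
Definition bigO2 k f := exists2 M, 0 <= M &
  forall s tau, `|s| <= 1 -> `|tau| <= 1 -> `|f s tau| <= M * (`|s| + `|tau|) ^+ k.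

Lemma bigO2_ext k f g : bigO2 k f -> (forall s tau, g s tau = f s tau) -> bigO2 k g.
Proof. by move=> [M M0 h] e; exists M => // s tau hs ht; rewrite e h. Qed.

Lemma bigO2D k f g : bigO2 k f -> bigO2 k g -> bigO2 k (fun s tau => f s tau + g s tau).
Proof.
move=> [M M0 h] [N N0 h']; exists (M + N); first exact: addr_ge0.
move=> s tau hs ht; apply: le_trans (ler_normD _ _) _.
by rewrite mulrDl lerD ?h ?h'.
Qed.

Lemma bigO2M j k f g : bigO2 j f -> bigO2 k g -> bigO2 (j + k) (fun s tau => f s tau * g s tau).
Proof.
move=> [M M0 h] [N N0 h']; exists (M * N); first exact: mulr_ge0.
move=> s tau hs ht; rewrite normrM exprD mulrACA.
by rewrite ler_pM ?h ?h'.
Qed.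

Lemma bigO2_cst c : bigO2 0 (fun _ _ => c).
Proof. by exists `|c| => // s tau _ _; rewrite expr0 mulr1. Qed.

Lemma bigO2Z c k f : bigO2 k f -> bigO2 k (fun s tau => c * f s tau).
Proof. exact: (bigO2M (bigO2_cst c)). Qed.

Lemma bigO2N k f : bigO2 k f -> bigO2 k (fun s tau => - f s tau).
Proof. by move=> h; apply: (bigO2_ext (bigO2Z (-1) h)) => s tau; rewrite mulN1r. Qed.

Lemma bigO2_s : bigO2 1 (fun s _ => s).
Proof. by exists 1 => // s tau _ _; rewrite expr1 mul1r lerDl. Qed.

Lemma bigO2_tau : bigO2 1 (fun _ tau => tau).
Proof. by exists 1 => // s tau _ _; rewrite expr1 mul1r lerDr. Qed.

Lemma bigO2W k f : bigO2 k.+1 f -> bigO2 k f.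
Proof.
move=> [M M0 h]; exists (M * 2); first exact: mulr_ge0.
move=> s tau hs ht; apply: le_trans (h s tau hs ht) _.
rewrite exprS mulrA ler_wpM2r ?exprn_ge0 ?addr_ge0// ler_wpM2l//.
by rewrite (_ : 2 = 1 + 1)// lerD.
Qed.

Lemma bigO2_sum k (I : Type) (r : seq I) (F : I -> R -> R -> R) :
  (forall i, bigO2 k (F i)) -> bigO2 k (fun s tau => \sum_(i <- r) F i s tau).
Proof.
move=> hF; elim: r => [|i r IH].
  by exists 0 => // s tau _ _; rewrite big_nil normr0 mul0r.
by apply: (bigO2_ext (bigO2D (hF i) IH)) => s tau; rewrite big_cons.
Qed.

(** Mean value theorem between 0 and s. *)
Lemma bigO2_primitive k (f h : R -> R) : f 0 = 0 ->
  (forall s, is_derive s (1 : R) f (h s)) ->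
  bigO2 k (fun s _ => h s) -> bigO2 k.+1 (fun s _ => f s).
Proof.
move=> f0 df [M M0 hM]; exists M => // s tau hs _.
have cf := is_derive_continuous df.
have hb c : `|c| <= `|s| -> `|h c| <= M * `|s| ^+ k.
  move=> cs; have h1 : `|(0 : R)| <= 1 by rewrite normr0.
  have := hM c 0 (le_trans cs hs) h1; rewrite normr0 addr0.
  by move=> /le_trans; apply; rewrite ler_wpM2l// lerXn2r ?nnegrE.
apply: (@le_trans _ _ (M * `|s| ^+ k.+1)); last first.
  by rewrite ler_wpM2l// lerXn2r ?nnegrE ?addr_ge0// lerDl.
have [s0|s0] := leP 0 s.
  have [c cs] := MVT_segment s0 (fun x _ => df x) (continuous_subspaceT cf).
  rewrite f0 !subr0 => ->; rewrite normrM exprSr mulrA ler_wpM2r//; apply: hb.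
  by move: cs; rewrite in_itv/= => /andP[c0 c1]; rewrite !ger0_norm.
have [c cs] := MVT_segment (ltW s0) (fun x _ => df x) (continuous_subspaceT cf).
rewrite f0 !sub0r => /eqP; rewrite eqr_oppLR => /eqP ->.
rewrite normrN normrM normrN exprSr mulrA ler_wpM2r//; apply: hb.
move: cs; rewrite in_itv/= => /andP[c0 c1].
by rewrite !ler0_norm ?lerN2// ltW.
Qed.

Lemma bigO2_small k f (eta : R) : bigO2 k.+1 f -> 0 < eta ->
  exists2 eps, 0 < eps <= 1 & forall s tau, `|s| <= eps -> `|tau| <= eps ->
    `|f s tau| <= eta * (`|s| + `|tau|) ^+ k.
Proof.
(* On the small square |s| + |tau| <= 2 eps, so one order of vanishing pays for eta; M + 1 avoids
   dividing by 0. *)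
move=> [M M0 h] eta0; pose eps := Num.min 1 (eta / (2 * (M + 1))).
have M1 : 0 < 2 * (M + 1) by rewrite mulr_gt0// ltr_wpDl.
have e0 : 0 < eps by rewrite lt_min ltr01 divr_gt0.
have e1 : eps <= 1 by rewrite ge_min lexx.
exists eps; first by rewrite e0 e1.
move=> s tau hs ht; apply: le_trans (h s tau (le_trans hs e1) (le_trans ht e1)) _.
rewrite exprS mulrA ler_wpM2r ?exprn_ge0 ?addr_ge0//.
have h1 : `|s| + `|tau| <= 2 * eps by rewrite mulrDl mul1r lerD.
have h2 : eps * (2 * (M + 1)) <= eta by rewrite -ler_pdivlMr// ge_min lexx orbT.
apply: le_trans h2; apply: (@le_trans _ _ (M * (2 * eps))); first by rewrite ler_wpM2l.
rewrite [leRHS](_ : _ = M * (2 * eps) + 2 * eps); last by ring.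
by rewrite lerDl mulr_ge0// ltW.
Qed.

End bigO.

(** * Remainders of vector functions and of the matrix exponential *)

Section vector_bigO.
Context {R : realType} {n : nat}.
Implicit Types (f g : R -> R -> 'cV[R]_n) (C : 'M[R]_n).

Definition vbigO2 k f := forall i, bigO2 k (fun s tau => f s tau i 0).

Lemma vbigO2_ext k f g : vbigO2 k f -> (forall s tau, g s tau = f s tau) -> vbigO2 k g.
Proof. by move=> h e i; apply: (bigO2_ext (h i)) => s tau; rewrite e. Qed.

Lemma vbigO2D k f g : vbigO2 k f -> vbigO2 k g -> vbigO2 k (fun s tau => f s tau + g s tau).
Proof. by move=> h h' i; apply: (bigO2_ext (bigO2D (h i) (h' i))) => s tau; rewrite mxE. Qed.

Lemma vbigO2Z j k (c : R -> R -> R) f : bigO2 j c -> vbigO2 k f ->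
  vbigO2 (j + k) (fun s tau => c s tau *: f s tau).
Proof. by move=> hc h i; apply: (bigO2_ext (bigO2M hc (h i))) => s tau; rewrite mxE. Qed.

Lemma vbigO2W k f : vbigO2 k.+1 f -> vbigO2 k f.
Proof. by move=> h i; exact: bigO2W. Qed.

Lemma vbigO2_cst v : vbigO2 0 (fun _ _ => v).
Proof. by move=> i; exact: bigO2_cst. Qed.

Lemma bigO2_dot j k f g : vbigO2 j f -> vbigO2 k g -> bigO2 (j + k) (fun s tau => dot (f s tau) (g s tau)).
Proof. by move=> hf hg; apply: bigO2_sum => i; exact: bigO2M. Qed.

Lemma vbigO2_mulmx k (A : 'M[R]_n) f : vbigO2 k f -> vbigO2 k (fun s tau => A *m f s tau).
Proof.
move=> h i; apply: (bigO2_ext (bigO2_sum (index_enum 'I_n) (fun j => bigO2Z (A i j) (h j)))).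
by move=> s tau; rewrite mxE.
Qed.

Lemma vbigO2_mulmxr k (A : R -> R -> 'M[R]_n) (v : 'cV[R]_n) :
  (forall i j, bigO2 k (fun s tau => A s tau i j)) -> vbigO2 k (fun s tau => A s tau *m v).
Proof.
move=> h i; apply: (bigO2_ext (bigO2_sum (index_enum 'I_n) (fun j => bigO2Z (v j 0) (h i j)))).
by move=> s tau; rewrite mxE; apply: eq_bigr => j _; rewrite mulrC.
Qed.

Section expmx.
Variable C : 'M[R]_n.
Let G s := expmx (s *: C).

(** The derivative of a Taylor remainder of exp(s C) is C times the previous remainder, so each
    integration gains one order. *)
Let step k (A A' : R -> 'M[R]_n) : A 0 = 0 ->
  (forall s i j, is_derive s (1 : R) (fun s => A s i j) ((C *m A' s) i j)) ->
  (forall i j, bigO2 k (fun s _ => A' s i j)) -> forall i j, bigO2 k.+1 (fun s _ => A s i j).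
Proof.
move=> A0 dA hA' i j.
have h0 : A 0 i j = 0 by rewrite A0 mxE.
have h1 : bigO2 k (fun s _ => (C *m A' s) i j).
  apply: (bigO2_ext (bigO2_sum (index_enum 'I_n) (fun l => bigO2Z (C i l) (hA' l j)))).
  by move=> s _; rewrite mxE.
exact: (bigO2_primitive h0 (fun s => dA s i j) h1).
Qed.

Let G0 : G 0 = 1%:M. Proof. exact: expmx0. Qed.

Lemma expmx_bigO0 i j : bigO2 0 (fun s _ => G s i j).
Proof.
have cg := is_derive_continuous (fun s => is_derive_expmx C s i j).
have [M hM] := continuous_bounded_itv cg; exists `|M| => // s tau hs _.
by rewrite expr0 mulr1 (le_trans (hM s hs))// ler_norm.
Qed.

Lemma expmx_bigO1 i j : bigO2 1 (fun s _ => (G s - 1%:M) i j).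
Proof.
apply: (step (A' := G)); [by rewrite G0 subrr| |exact: expmx_bigO0].
move=> s {}i {}j; have h := is_derive_expmx C s i j; under eq_fun do rewrite !mxE.
by apply: is_derive_eq; rewrite subr0.
Qed.

Lemma expmx_bigO2 i j : bigO2 2 (fun s _ => (G s - 1%:M - s *: C) i j).
Proof.
apply: (step (A' := fun s => G s - 1%:M)); [by rewrite G0 subrr scale0r subrr| |exact: expmx_bigO1].
move=> s {}i {}j; have h := is_derive_expmx C s i j.
under eq_fun do rewrite !mxE.
by apply: is_derive_eq; rewrite mulmxBr mulmx1 !mxE /GRing.scale/=; ring.
Qed.

Lemma expmx_bigO3 i j : bigO2 3 (fun s _ => (G s - 1%:M - s *: C - (2^-1 * s ^+ 2) *: (C *m C)) i j).
Proof.
apply: (step (A' := fun s => G s - 1%:M - s *: C)); last exact: expmx_bigO2.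
  by rewrite G0 subrr scale0r expr0n mulr0 scale0r !subrr.
move=> s {}i {}j; have h := is_derive_expmx C s i j.
under eq_fun do rewrite !mxE.
apply: is_derive_eq; rewrite mulmxBr mulmxBr mulmx1 -scalemxAr !mxE /GRing.scale/=.
by field.
Qed.

Lemma expmx_expansion (x0 x1 x2 : 'cV[R]_n) :
  vbigO2 3 (fun s tau => G s *m (x0 + s *: x1 + tau *: x2) -
    (x0 + (s *: (C *m x0 + x1) + tau *: x2)
     + (s ^+ 2 *: (2^-1 *: (C *m (C *m x0)) + C *m x1) + (s * tau) *: (C *m x2)))).
Proof.
have h1 := vbigO2_mulmxr x0 expmx_bigO3.
have h2 := vbigO2Z bigO2_s (vbigO2_mulmxr x1 expmx_bigO2).
have h3 := vbigO2Z bigO2_tau (vbigO2_mulmxr x2 expmx_bigO2).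
apply: (vbigO2_ext (vbigO2D h1 (vbigO2D h2 h3))) => s tau.
rewrite !mulmxDr !mulmxBl !mul1mx -!scalemxAl -!scalemxAr -mulmxA.
move: (G s *m x0) (G s *m x1) (G s *m x2) (C *m (C *m x0)) (C *m x0) (C *m x1) (C *m x2).
move=> g0 g1 g2 c2 c0 c1 c3; apply/matrixP => i j; rewrite !mxE; ring.
Qed.

End expmx.
End vector_bigO.

(** * Second-order expansion of the norm and of the pairing *)

Section exponents.
Context {R : realType} {n : nat} (Q B S : 'M[R]_n) (p r vp vr : 'cV[R]_n) (lam : R).
Hypothesis ST : S^T = S.
Hypothesis lyap : B *m S + S *m B^T = - Q.
Hypothesis Svp : S *m vp = Q *m p.
Hypothesis Svr : S *m vr = Q *m r.
Hypothesis QT : Q^T = Q.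
Local Notation C := B^T.

(** When S v = Q x this is Y = S^-1 N x / 2, by the Lyapunov equation: C x = Y - X with X = v /
    2. *)
Definition skew_part (x v : 'cV[R]_n) := C *m x + 2^-1 *: v.
Local Notation yp := (skew_part p vp).
Local Notation yr := (skew_part r vr).

(* With [X = v / 2] and [Y] the skew part, [cross] is [Re <X, Y>_S] and
   [curvature] is [4 (|X|^2 + Re <X, Y>)]: this choice cancels the
   quadratic part of [overlap_phase] below. *)
Definition cross := 2^-1 * (dot (S *m vp) yp + dot (S *m vr) yr).
Definition curvature := dot (S *m vp) vp + dot (S *m vr) vr + 4 * cross.

Hypothesis q1E : dot (Q *m p) p + dot (Q *m r) r = 2.
Hypothesis q2E : dot (S *m yp) r * 2 = lam.

Local Notation a := (orbit_re B p vp vr).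
Local Notation b := (orbit_im B r vp vr).
Local Notation th := curvature.

(** The part of [level] proportional to t, shifted by a constant so as to vanish at the origin. *)
Definition growth s tau := 2^-1 * (dot (S *m a s tau) (a s tau) + dot (S *m b s tau) (b s tau))
  + 2^-1 * th * (s ^+ 2 / 4 - tau ^+ 2) - 2^-1 * (dot (S *m p) p + dot (S *m r) r).

Let Ssym x y : dot (S *m x) y = dot (S *m y) x.
Proof. by rewrite dot_mull ST dotC. Qed.

(** For the scalar product of S, X is symmetric and Y skew, so the adjoint of C = Y - X is -(Y +
    X). *)
Let SC x v w : S *m v = Q *m x -> dot (S *m x) (C *m w) = - dot (S *m (skew_part x v + 2^-1 *: v)) w.
Proof.
move=> Sv; rewrite -dot_mull mulmxA (_ : B *m S = - Q - S *m C); last by rewrite -lyap addrK.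
rewrite mulmxBl mulNmx -mulmxA -Sv /skew_part.
by rewrite !(mulmxDr, dotDl, dotBl, dotNl) -!scalemxAr !dotZl; field.
Qed.

(** This and the next three facts spell out on p and r that Y is skew and X symmetric for S. *)
Let pyp : dot (S *m p) yp = 0.
Proof.
have := SC p Svp; rewrite /skew_part !(mulmxDr, dotDl, dotDr) -!scalemxAr !(dotZl, dotZr).
by rewrite (Ssym (C *m p) p) (Ssym vp p) => h; lra.
Qed.

Let ryr : dot (S *m r) yr = 0.
Proof.
have := SC r Svr; rewrite /skew_part !(mulmxDr, dotDl, dotDr) -!scalemxAr !(dotZl, dotZr).
by rewrite (Ssym (C *m r) r) (Ssym vr r) => h; lra.
Qed.

Let pvr : dot (S *m p) vr = dot (S *m r) vp.
Proof. by rewrite (Ssym p) (Ssym r) Svr Svp dot_mull QT dotC. Qed.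

Let pyr : dot (S *m p) yr = - dot (S *m r) yp.
Proof.
have := SC r Svp; rewrite /skew_part !(mulmxDr, dotDl, dotDr) -!scalemxAr !(dotZl, dotZr).
rewrite (Ssym (C *m p) r) (Ssym vp r) pvr => h; lra.
Qed.

Let ryp : 2 * dot (S *m r) yp = lam.
Proof. by rewrite Ssym mulrC q2E. Qed.

Let pvp : dot (S *m p) vp + dot (S *m r) vr = 2.
Proof. by rewrite (Ssym p) (Ssym r) Svp Svr. Qed.

(** Real part of the linear term s Y + 2 i tau X of the orbit. [Lb] is its imaginary part, [Qa] and
    [Qb] the quadratic terms, [Ea] and [Eb] the remainders of order 3. *)
Let La s tau := s *: yp + tau *: (- vr).
Let Lb s tau := s *: yr + tau *: vp.
Let Qa s tau := s ^+ 2 *: (2^-1 *: (C *m (C *m p)) + C *m (2^-1 *: vp)) + (s * tau) *: (C *m (- vr)).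
Let Qb s tau := s ^+ 2 *: (2^-1 *: (C *m (C *m r)) + C *m (2^-1 *: vr)) + (s * tau) *: (C *m vp).
Let Ea s tau := a s tau - (p + La s tau + Qa s tau).
Let Eb s tau := b s tau - (r + Lb s tau + Qb s tau).

Let ea3 : vbigO2 3 Ea.
Proof.
apply: (vbigO2_ext (expmx_expansion C p (2^-1 *: vp) (- vr))) => s tau.
rewrite /Ea /orbit_re /La /Qa addrA; congr (_ *m (_ + _ + _) - _); first by rewrite scalerA.
by rewrite scalerN.
Qed.

Let eb3 : vbigO2 3 Eb.
Proof.
apply: (vbigO2_ext (expmx_expansion C r (2^-1 *: vr) vp)) => s tau.
rewrite /Eb /orbit_im /Lb /Qb addrA; congr (_ *m (_ + _ + _) - _); by rewrite scalerA.
Qed.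

Let linear1 (u v : 'cV[R]_n) : vbigO2 1 (fun s tau => s *: u + tau *: v).
Proof.
exact: vbigO2D (vbigO2Z bigO2_s (vbigO2_cst u)) (vbigO2Z bigO2_tau (vbigO2_cst v)).
Qed.

Let quadratic2 (u v : 'cV[R]_n) : vbigO2 2 (fun s tau => s ^+ 2 *: u + (s * tau) *: v).
Proof.
exact: vbigO2D (vbigO2Z (bigO2M bigO2_s bigO2_s) (vbigO2_cst u))
  (vbigO2Z (bigO2M bigO2_s bigO2_tau) (vbigO2_cst v)).
Qed.

Let Ra2 : vbigO2 2 (fun s tau => Qa s tau + Ea s tau).
Proof. exact: vbigO2D (quadratic2 _ _) (vbigO2W ea3). Qed.

Let Rb2 : vbigO2 2 (fun s tau => Qb s tau + Eb s tau).
Proof. exact: vbigO2D (quadratic2 _ _) (vbigO2W eb3). Qed.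

Let aE s tau : a s tau = p + La s tau + (Qa s tau + Ea s tau).
Proof. by rewrite /Ea addrA [RHS]addrC subrK. Qed.

Let bE s tau : b s tau = r + Lb s tau + (Qb s tau + Eb s tau).
Proof. by rewrite /Eb addrA [RHS]addrC subrK. Qed.

Let SQa s tau (x v : 'cV[R]_n) : S *m v = Q *m x -> dot (S *m x) (Qa s tau) =
  - s ^+ 2 * (2^-1 * dot (S *m (skew_part x v + 2^-1 *: v)) (yp + 2^-1 *: vp))
  + s * tau * dot (S *m (skew_part x v + 2^-1 *: v)) vr.
Proof.
move=> Sv; rewrite /Qa !(dotDr, dotZr) !(SC _ Sv).
have -> : C *m p = yp - 2^-1 *: vp by rewrite /skew_part addrK.
by rewrite !(dotDr, dotZr, dotNr); field.
Qed.

Let SQb s tau (x v : 'cV[R]_n) : S *m v = Q *m x -> dot (S *m x) (Qb s tau) =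
  - s ^+ 2 * (2^-1 * dot (S *m (skew_part x v + 2^-1 *: v)) (yr + 2^-1 *: vr))
  - s * tau * dot (S *m (skew_part x v + 2^-1 *: v)) vp.
Proof.
move=> Sv; rewrite /Qb !(dotDr, dotZr) !(SC _ Sv).
have -> : C *m r = yr - 2^-1 *: vr by rewrite /skew_part addrK.
by rewrite !(dotDr, dotZr, dotNr); field.
Qed.

(** The linear terms vanish by the symmetries of X and Y. In the quadratic ones, [curvature] trades
    the terms in |X|^2 of either sign for multiples of [cross] alone. *)
Lemma growth_expansion : bigO2 3 (fun s tau => growth s tau + (2^-1 * cross * s ^+ 2 + 2 * cross * tau ^+ 2)).
Proof.
have h1 := bigO2_dot (vbigO2_cst (S *m p)) ea3.
have h2 := bigO2_dot (vbigO2_cst (S *m r)) eb3.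
have h3 := bigO2_dot (vbigO2_mulmx S (linear1 yp (- vr))) Ra2.
have h4 := bigO2_dot (vbigO2_mulmx S (linear1 yr vp)) Rb2.
have h5 := bigO2Z 2^-1 (bigO2W (bigO2_dot (vbigO2_mulmx S Ra2) Ra2)).
have h6 := bigO2Z 2^-1 (bigO2W (bigO2_dot (vbigO2_mulmx S Rb2) Rb2)).
apply: (bigO2_ext (bigO2D (bigO2D h1 h2) (bigO2D (bigO2D h3 h4) (bigO2D h5 h6)))) => s tau.
rewrite -/(La s tau) -/(Lb s tau) /growth aE bE.
move: (Ea s tau) (Eb s tau) => e f.
have dE (x l w : 'cV[R]_n) : dot (S *m (x + l + w)) (x + l + w) = dot (S *m x) x + dot (S *m l) l
    + 2 * dot (S *m x) l + 2 * dot (S *m x) w + 2 * dot (S *m l) w + dot (S *m w) w.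
  rewrite !(mulmxDr, dotDl, dotDr) (Ssym l x) (Ssym w x) (Ssym w l); ring.
rewrite !dE [dot (S *m p) (Qa s tau + e)]dotDr [dot (S *m r) (Qb s tau + f)]dotDr.
rewrite (SQa _ _ Svp) (SQb _ _ Svr).
(* All products of order at least 3 have been set aside; what remains is an exact identity between
   the terms of degree 1 and 2. *)
suff E : dot (S *m La s tau) (La s tau) + dot (S *m Lb s tau) (Lb s tau)
   + 2 * dot (S *m p) (La s tau) + 2 * dot (S *m r) (Lb s tau)
   + 2 * (- s ^+ 2 * (2^-1 * dot (S *m (yp + 2^-1 *: vp)) (yp + 2^-1 *: vp))
        + s * tau * dot (S *m (yp + 2^-1 *: vp)) vr)
   + 2 * (- s ^+ 2 * (2^-1 * dot (S *m (yr + 2^-1 *: vr)) (yr + 2^-1 *: vr))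
        - s * tau * dot (S *m (yr + 2^-1 *: vr)) vp)
   + th * (s ^+ 2 / 4 - tau ^+ 2) + (cross * s ^+ 2 + 4 * cross * tau ^+ 2) = 0.
  by move: E; set X := dot (S *m p) e; set Y := dot (S *m r) f; move=> E; lra.
rewrite /La /Lb /curvature /cross; move: pyp ryr.
move: (skew_part p vp) (skew_part r vr) => y z py rz.
rewrite !(mulmxDr, mulmxN, dotDl, dotDr, dotNl, dotNr) -!scalemxAr !(mulmxN, dotZl, dotZr, dotNl, dotNr).
rewrite -?scalemxAr ?(dotZl, dotZr) py rz pvr.
rewrite (Ssym vp y) (Ssym vr z) ?(Ssym vr y) ?(Ssym vp z) ?(Ssym vr vp).
by field.
Qed.

Definition overlap_amp s tau := dot (S *m a s tau) p + dot (S *m b s tau) r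
  + 2^-1 * th * (s ^+ 2 / 4 - tau ^+ 2) - (dot (S *m p) p + dot (S *m r) r).

Definition overlap_phase s tau := dot (S *m p) (b s tau) - dot (S *m a s tau) r
  + lam * s - 2 * tau + 2^-1 * th * s * tau.

(** Each normalisation kills one term: q2 = lambda the linear term in s, q1 = 1 the linear term in
    tau, the value of [curvature] the term in s tau. The s^2 terms cancel by symmetry of S. *)
Lemma overlap_phase_expansion : bigO2 3 overlap_phase.
Proof.
have h1 := bigO2_dot (vbigO2_cst (S *m p)) eb3.
have h2 := bigO2_dot (vbigO2_cst (S *m r)) ea3.
apply: (bigO2_ext (bigO2D h1 (bigO2N h2))) => s tau.
rewrite /overlap_phase aE bE (Ssym _ r).
move: (Ea s tau) (Eb s tau) => e f.
rewrite [dot (S *m p) (r + Lb s tau + (Qb s tau + f))]dotDr [dot (S *m p) (r + Lb s tau)]dotDr.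
rewrite [dot (S *m p) (Qb s tau + f)]dotDr [dot (S *m r) (p + La s tau + (Qa s tau + e))]dotDr.
rewrite [dot (S *m r) (p + La s tau)]dotDr [dot (S *m r) (Qa s tau + e)]dotDr.
rewrite (SQa _ _ Svr) (SQb _ _ Svp) (Ssym p r).
suff E : dot (S *m p) (Lb s tau) - dot (S *m r) (La s tau)
   + (- s ^+ 2 * (2^-1 * dot (S *m (yp + 2^-1 *: vp)) (yr + 2^-1 *: vr))
        - s * tau * dot (S *m (yp + 2^-1 *: vp)) vp)
   - (- s ^+ 2 * (2^-1 * dot (S *m (yr + 2^-1 *: vr)) (yp + 2^-1 *: vp))
        + s * tau * dot (S *m (yr + 2^-1 *: vr)) vr)
   + lam * s - 2 * tau + 2^-1 * th * s * tau = 0.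
  by move: E; set X := dot (S *m p) f; set Y := dot (S *m r) e; move=> E; lra.
have rvr : dot (S *m r) vr = 2 - dot (S *m p) vp by rewrite -pvp addrC addKr.
rewrite /La /Lb /curvature /cross -ryp; move: pyr.
move: (skew_part p vp) (skew_part r vr) => y z pz.
rewrite !(mulmxDr, dotDl, dotDr) -!scalemxAr !(dotZl, dotZr, dotNr) pz rvr.
rewrite (Ssym vp y) (Ssym vr z) ?(Ssym vr y) ?(Ssym vp z) ?(Ssym vr vp) ?(Ssym z y).
by field.
Qed.

(** Polarization: Re <beta, alpha> = (|beta|^2 + |alpha|^2 - |beta - alpha|^2) / 2. The pairing
    therefore decays at least as fast as the norm. *)
Lemma overlap_ampE s tau : overlap_amp s tau = growth s tau
  - 2^-1 * (dot (S *m (a s tau - p)) (a s tau - p) + dot (S *m (b s tau - r)) (b s tau - r)).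
Proof.
rewrite /overlap_amp /growth !(mulmxBr, dotBl, dotBr) (Ssym p (a s tau)) (Ssym r (b s tau)).
by field.
Qed.

Let dist2 : bigO2 2 (fun s tau => dot (S *m (a s tau - p)) (a s tau - p)
  + dot (S *m (b s tau - r)) (b s tau - r)).
Proof.
have ha : vbigO2 1 (fun s tau => a s tau - p).
  apply: (vbigO2_ext (vbigO2D (linear1 yp (- vr)) (vbigO2W Ra2))) => s tau.
  by rewrite -/(La s tau) aE -[p + _ + _]addrA [p + _]addrC addrK.
have hb : vbigO2 1 (fun s tau => b s tau - r).
  apply: (vbigO2_ext (vbigO2D (linear1 yr vp) (vbigO2W Rb2))) => s tau.
  by rewrite -/(Lb s tau) bE -[r + _ + _]addrA [r + _]addrC addrK.
exact: bigO2D (bigO2_dot (vbigO2_mulmx S ha) ha) (bigO2_dot (vbigO2_mulmx S hb) hb).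
Qed.

Hypothesis pS : forall x : 'cV[R]_n, 0 <= dot (S *m x) x.

(** The quadratic form of [growth_expansion] is at least [cross] / 4 times (|s| + |tau|)^2; on a
    small square the cubic remainder uses up half of this, which leaves c = [cross] / 8. The upper
    bound on [growth] makes the boundary terms small, and the three bounds on the overlap feed the
    oscillatory integral. *)
Lemma exponent_bounds : 0 < cross ->
  exists eps c M, [/\ 0 < eps <= 1, 0 < c, 0 < M &
    forall s tau, `|s| <= eps -> `|tau| <= eps ->
    [/\ growth s tau <= - c * (`|s| + `|tau|) ^+ 2,
        overlap_amp s tau <= - c * (`|s| + `|tau|) ^+ 2,
        - M * (`|s| + `|tau|) ^+ 2 <= overlap_amp s tau &
        `|overlap_phase s tau| <= M * (`|s| + `|tau|) ^+ 3]].
Proof.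
move=> k0.
have k8 : 0 < cross / 8 by rewrite divr_gt0.
have [eps e01 hg] := bigO2_small growth_expansion k8.
have [M1 M10 h1] := dist2; have [M2 M20 h2] := overlap_phase_expansion.
exists eps, (cross / 8), (3 * cross + M1 + M2); split=> //.
  by rewrite ltr_pwDl// ltr_pwDl// mulr_gt0.
move=> s tau hs ht.
have /andP[e0 e1] := e01.
have hs1 := le_trans hs e1; have ht1 := le_trans ht e1.
have := hg s tau hs ht; rewrite ler_norml => /andP[g1 g2].
have := h1 s tau hs1 ht1; rewrite ler_norml => /andP[_ d2].
have d0 : 0 <= dot (S *m (a s tau - p)) (a s tau - p) + dot (S *m (b s tau - r)) (b s tau - r).
  by rewrite addr_ge0.
rewrite overlap_ampE.
have g3 := h2 s tau hs1 ht1.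
move: (growth s tau) (dot (S *m (a s tau - p)) _ + _) d0 d2 g1 g2 g3 => g D d0 d2 g1 g2 g3.
have a1 := normr_ge0 s; have a2 := normr_ge0 tau.
rewrite -[s ^+ 2]real_normK ?num_real// -[tau ^+ 2]real_normK ?num_real// in g1 g2.
move: (`|s|) (`|tau|) a1 a2 d2 g1 g2 g3 => x y a1 a2 d2 g1 g2 g3.
have r0 : 0 <= (x + y) ^+ 2 by rewrite sqr_ge0.
have xy : 2 * (x ^+ 2 + y ^+ 2) = (x + y) ^+ 2 + (x - y) ^+ 2 by ring.
have xy0 := sqr_ge0 (x - y).
have xyp : 0 <= x * y by rewrite mulr_ge0.
have xy1 : x ^+ 2 + y ^+ 2 + 2 * (x * y) = (x + y) ^+ 2 by ring.
have y0 := sqr_ge0 y; have x0 := sqr_ge0 x.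
have q1 : 2^-1 * cross * x ^+ 2 + 2 * cross * y ^+ 2 >= cross / 4 * (x + y) ^+ 2.
  rewrite -subr_ge0 (_ : _ - _ = cross * (4^-1 * (x - y) ^+ 2 + 3 / 2 * y ^+ 2)).
    by apply: mulr_ge0; [exact: ltW|lra].
  by field.
have q2 : 2^-1 * cross * x ^+ 2 + 2 * cross * y ^+ 2 <= 2 * cross * (x + y) ^+ 2.
  rewrite -subr_ge0 (_ : _ - _ = cross * (3 / 2 * x ^+ 2 + 4 * (x * y))).
    by apply: mulr_ge0; [exact: ltW|lra].
  by field.
have G : g <= - (cross / 8) * (x + y) ^+ 2.
  have -> : - (cross / 8) * (x + y) ^+ 2 = cross / 8 * (x + y) ^+ 2 - cross / 4 * (x + y) ^+ 2 by field.
  by lra.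
split=> //.
- by apply: le_trans G; rewrite lerBlDr lerDl mulr_ge0.
- have M2r : 0 <= M2 * (x + y) ^+ 2 by rewrite mulr_ge0.
  have M1r : 0 <= M1 * (x + y) ^+ 2 by rewrite mulr_ge0.
  have kr : 0 <= cross * (x + y) ^+ 2 by rewrite mulr_ge0// ltW.
  have -> : - (3 * cross + M1 + M2) * (x + y) ^+ 2 = - (3 * (cross * (x + y) ^+ 2))
    - M1 * (x + y) ^+ 2 - M2 * (x + y) ^+ 2 by ring.
  have q2' : 2^-1 * cross * x ^+ 2 + 2 * cross * y ^+ 2 <= 2 * (cross * (x + y) ^+ 2) by rewrite mulrA.
  have g1' : - (8^-1 * (cross * (x + y) ^+ 2)) <= g + (2^-1 * cross * x ^+ 2 + 2 * cross * y ^+ 2).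
    by rewrite mulrA (mulrC 8^-1).
  by lra.
- apply: le_trans g3 _; rewrite ler_wpM2r//; last by rewrite lerDr addr_ge0// mulr_ge0// ltW.
  by rewrite exprn_ge0// addr_ge0.
Qed.

End exponents.

(** * A lower bound for an oscillatory integral *)

Section oscillatory.
Context {R : realType}.
Local Notation Omega := (measurableTypeR R * measurableTypeR R)%type.

Lemma cos_ge_cos1 (y : R) : `|y| <= 1 -> cos 1 <= cos y.
Proof.
move=> y1; have -> : cos y = cos `|y| by case: ger0P => // _; rewrite cosN.
have p2 : (1 : R) <= pi by apply: le_trans (pi_ge2 R); rewrite ler1n.
rewrite leNgt ltr_cos ?in_itv/= ?normr_ge0 ?ler01//; last exact: le_trans p2.
by rewrite -leNgt.
Qed.

(** Keep a single term of the series of exp(y). *)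
Lemma expRN_le_pow (n : nat) (y : R) : 0 < y -> expR (- y) <= n.+1`!%:R / y ^+ n.+1.
Proof.
move=> y0; rewrite expRN.
have f0 : 0 < n.+1`!%:R :> R by rewrite ltr0n fact_gt0.
have p0 : 0 < y ^+ n.+1 / n.+1`!%:R by rewrite divr_gt0// exprn_gt0.
rewrite -[leRHS]invf_div lef_pV2 ?posrE ?expR_gt0//.
by apply: le_trans (expR_ge1Dxn n (ltW y0)); rewrite lerDr.
Qed.

Variables (eps c M T : R) (oa oph h : Omega -> R).
Hypotheses (eps0 : 0 < eps) (eps1 : eps <= 1) (c0 : 0 < c) (M0 : 0 < M) (T0 : 0 <= T).
Hypotheses (moa : measurable_fun setT oa) (moph : measurable_fun setT oph) (mh : measurable_fun setT h).
Local Notation rho z := (`|z.1| + `|z.2|).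
Hypothesis oa_le : forall z, sqr eps z -> oa z <= - c * rho z ^+ 2.
Hypothesis oa_ge : forall z, sqr eps z -> - M * rho z ^+ 2 <= oa z.
Hypothesis oph_le : forall z, sqr eps z -> `|oph z| <= M * rho z ^+ 3.
Hypothesis h_le : forall z, sqr eps z -> `|h z| <= T.

Let j t z := expR (t * oa z + h z) * cos (t * oph z).
Let f6 : R := 6`!%:R.
Let m1 := expR (- (4 * M) - T) * cos 1.
Let m3 := expR T * (f6 * M ^+ 4 / c ^+ 6).

Let m1_gt0 : 0 < m1. Proof. by rewrite mulr_gt0 ?expR_gt0 ?cos1_gt0. Qed.
Let f6_gt0 : 0 < f6. Proof. by rewrite ltr0n fact_gt0. Qed.
Let m3_gt0 : 0 < m3.
Proof. by rewrite mulr_gt0 ?expR_gt0// divr_gt0 ?mulr_gt0 ?exprn_gt0. Qed.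

(* Where the cosine is negative, [t rho^3] is bounded below, so that [t rho^2]
   is large and the Gaussian factor is [O(t^-2)]. *)
Let j_far t z : 1 <= t -> sqr eps z -> - (m3 / t ^+ 2) <= j t z.
Proof.
move=> t1 Dz; have t0 : 0 < t by exact: lt_le_trans t1.
have [cge|clt] := leP 0 (cos (t * oph z)).
  apply: (@le_trans _ _ 0); last by rewrite mulr_ge0// expR_ge0.
  by rewrite oppr_le0 divr_ge0 ?exprn_ge0// ltW.
have r0 : 0 <= rho z by rewrite addr_ge0.
have ph1 : 1 < t * (M * rho z ^+ 3).
  rewrite ltNge; apply/negP => le1; move: clt; rewrite ltNge => /negP; apply.
  apply: le_trans (ltW (cos1_gt0 R)) (cos_ge_cos1 _).
  rewrite normrM (ger0_norm (ltW t0)); apply: le_trans le1.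
  by rewrite ler_wpM2l ?(ltW t0)// oph_le.
have rp : 0 < rho z.
  rewrite lt_neqAle r0 andbT; apply/eqP => r00; move: ph1; rewrite -r00 expr0n/= !mulr0.
  by rewrite ltNge ler01.
pose y := c * (t * rho z ^+ 2).
have y0 : 0 < y by rewrite !mulr_gt0// exprn_gt0.
(* The sixth power is chosen because (t rho^2)^6 = t^2 (t rho^3)^4, where t M rho^3 > 1 on the
   region considered. *)
have y6 : c ^+ 6 * t ^+ 2 / M ^+ 4 <= y ^+ 6.
  have -> : y ^+ 6 = c ^+ 6 * t ^+ 2 / M ^+ 4 * (t * (M * rho z ^+ 3)) ^+ 4.
    by rewrite /y; field; exact: lt0r_neq0.
  rewrite ler_peMr ?exprn_ege1 ?(ltW ph1)//.
  by rewrite divr_ge0 ?mulr_ge0 ?exprn_ge0// ltW.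
apply: (@le_trans _ _ (- expR (t * oa z + h z))); last first.
  by rewrite -[leLHS]mulrN1 ler_wpM2l ?expR_ge0 ?cos_geN1.
rewrite lerN2; apply: (@le_trans _ _ (expR (T - y))).
  rewrite ler_expR [leLHS]addrC lerD//; first by apply: le_trans (h_le Dz); rewrite ler_norm.
  by apply: le_trans (ler_wpM2l (ltW t0) (oa_le Dz)) _; rewrite /y mulNr mulrN mulrCA.
rewrite expRD /m3 -mulrA ler_wpM2l ?expR_ge0//.
apply: le_trans (expRN_le_pow 5 y0) _.
have c6 : 0 < c ^+ 6 * t ^+ 2 / M ^+ 4 by rewrite divr_gt0 ?mulr_gt0 ?exprn_gt0.
have -> : f6 * M ^+ 4 / c ^+ 6 / t ^+ 2 = f6 / (c ^+ 6 * t ^+ 2 / M ^+ 4).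
  by field; rewrite !lt0r_neq0.
by rewrite ler_wpM2l ?(ltW f6_gt0)// lef_pV2 ?posrE ?exprn_gt0.
Qed.

(** On the square of half-side t^(-1/2) one has t rho^2 <= 4, whence the factor exp(-4 M - T), and
    the phase is at most 8 M t^(-1/2) <= 1. *)
Let j_near t z : 0 < t -> (Num.sqrt t)^-1 <= eps -> 8 * M <= Num.sqrt t ->
  sqr (Num.sqrt t)^-1 z -> m1 <= j t z.
Proof.
move=> t0 se sM; set sg := (Num.sqrt t)^-1.
have q0 : 0 < Num.sqrt t by rewrite sqrtr_gt0.
have sg0 : 0 < sg by rewrite invr_gt0.
have tE : t * sg ^+ 2 = 1 by rewrite -[t in LHS]sqr_sqrtr ?(ltW t0)// -exprMn divff ?expr1n// lt0r_neq0.
move=> [/= z1 z2].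
have Dz : sqr eps z.
  by split; rewrite /seg/= in_itv/= -ler_norml; apply: le_trans se; move: z1 z2; rewrite /seg/= !in_itv/= -!ler_norml.
have r2 : rho z <= 2 * sg.
  by move: z1 z2; rewrite /seg/= !in_itv/= -!ler_norml mulrDl mul1r => h1 h2; exact: lerD.
have r0 : 0 <= rho z by rewrite addr_ge0.
have tr2 : t * rho z ^+ 2 <= 4.
  apply: (@le_trans _ _ (t * (2 * sg) ^+ 2)).
    by rewrite ler_wpM2l ?(ltW t0)// lerXn2r ?nnegrE// mulr_ge0// ltW.
  by rewrite exprMn mulrCA tE mulr1 -natrX.
have M0' := ltW M0.
apply: ler_pM.
- exact: expR_ge0.
- exact: ltW (cos1_gt0 R).
- rewrite ler_expR lerD//; last by have := h_le Dz; rewrite ler_norml => /andP[].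
  apply: le_trans (ler_wpM2l (ltW t0) (oa_ge Dz)).
  by rewrite mulNr mulrN lerN2 mulrCA [4 * M]mulrC ler_wpM2l.
- apply: cos_ge_cos1; rewrite normrM (ger0_norm (ltW t0)).
  apply: (le_trans (ler_wpM2l (ltW t0) (oph_le Dz))).
  have -> : t * (M * rho z ^+ 3) = M * (t * rho z ^+ 2) * rho z by ring.
  apply: (@le_trans _ _ (M * 4 * (2 * sg))).
    by rewrite ler_pM ?mulr_ge0 ?exprn_ge0 ?(ltW t0)// ler_wpM2l.
  have -> : M * 4 * (2 * sg) = (8 * M) * sg by ring.
  by rewrite /sg ler_pdivrMr// mul1r.
Qed.

(** The square of half-side t^(-1/2) has area 4 / t and contributes at least 4 [m1] / t; elsewhere
    the integrand is at least -[m3] / t^2, a loss of at most half that gain for large t. *)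
Lemma oscillatory_integral_ge : exists k t1, 0 < k /\ forall t, t1 <= t ->
  k / t <= \int[area]_(z in sqr eps) (expR (t * oa z + h z) * cos (t * oph z)).
Proof.
(* The summands of the threshold ensure in turn t >= 1, t^(-1/2) <= eps, 8 M <= t^(1/2), and that
   the negative part is absorbed. *)
exists (2 * m1), (1 + (eps^-1) ^+ 2 + (8 * M) ^+ 2 + 2 * m3 / m1); split.
  by rewrite mulr_gt0.
move=> t ht.
have e2 : 0 < (eps^-1) ^+ 2 by rewrite exprn_gt0// invr_gt0.
have M2 : 0 < (8 * M) ^+ 2 by rewrite exprn_gt0// mulr_gt0.
have m31 : 0 < 2 * m3 / m1 by rewrite divr_gt0// mulr_gt0.
have t1 : 1 <= t by lra.
have t0 : 0 < t by exact: lt_le_trans t1.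
have q0 : 0 < Num.sqrt t by rewrite sqrtr_gt0.
pose sg := (Num.sqrt t)^-1.
have sg0 : 0 < sg by rewrite invr_gt0.
have se : sg <= eps.
  rewrite -[eps]invrK lef_pV2 ?posrE ?invr_gt0// -[eps^-1]ger0_norm ?invr_ge0 ?(ltW eps0)//.
  by rewrite -sqrtr_sqr ler_sqrt//; lra.
have sM : 8 * M <= Num.sqrt t.
  rewrite -[8 * M]ger0_norm ?mulr_ge0 ?(ltW M0)//.
  by rewrite -sqrtr_sqr ler_sqrt//; lra.
have mS := measurable_sqr eps.
have fS : (area (sqr eps) < +oo)%E by rewrite area_sqr ?ltry// ltW.
have mj : measurable_fun setT (j t).
  apply: measurable_funM.
    apply: measurableT_comp => //; apply: measurable_funD => //; exact: measurable_funM.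
  by apply: measurableT_comp; [exact: continuous_measurable_fun (@continuous_cos R)|exact: measurable_funM].
have ij : area.-integrable (sqr eps) (EFin \o j t).
  apply: measurable_bounded_integrable => //; first exact: measurable_funTS.
  exists (expR T); split; first exact: num_real.
  move=> N hN z Dz; apply: le_trans (ltW hN).
  rewrite /= /j normrM ger0_norm ?expR_ge0// -[leRHS]mulr1 ler_pM ?expR_ge0//; last by rewrite ler_norml cos_geN1 cos_le1.
  rewrite ler_expR; apply: (@le_trans _ _ (0 + T)); last by rewrite add0r.
  rewrite lerD//; last by apply: le_trans (h_le Dz); rewrite ler_norm.
  rewrite mulr_ge0_le0 ?(ltW t0)//; apply: le_trans (oa_le Dz) _.
  by rewrite mulNr oppr_le0 mulr_ge0 ?sqr_ge0// ltW.
have ssub : sqr sg `<=` sqr eps.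
  by move=> z [/= z1 z2]; split; move: z1 z2; rewrite /seg/= !in_itv/= -!ler_norml => h1 h2; exact: le_trans se.
have i1 : has_int area (sqr eps) (\1_(sqr sg) : Omega -> R) ((2 * sg) ^+ 2).
  have ms := measurable_sqr sg.
  split.
    apply: measurable_bounded_integrable => //.
    exists 1; split; first exact: num_real.
    move=> N hN z Dz; apply: le_trans (ltW hN).
    by rewrite /= indicE; case: (_ \in _); rewrite ?normr1 ?normr0 ?ler01.
  rewrite /Rintegral integral_indic// setIidl//.
  exact: (congr1 fine (area_sqr (ltW sg0))).
have ic : has_int area (sqr eps) (fun=> m3 / t ^+ 2) (m3 / t ^+ 2 * (2 * eps) ^+ 2).
  split.
    apply: measurable_bounded_integrable => //.
    exists (`|m3 / t ^+ 2|); split; first exact: num_real.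
    by move=> N hN z Dz; exact: ltW.
  rewrite Rintegral_cst//; congr (_ * _); exact: (congr1 fine (area_sqr (ltW eps0))).
have [_ e] := has_intD mS (has_intB mS (has_int_self ij) (has_intZ mS m1 i1)) ic.
have : 0 <= \int[area]_(z in sqr eps) (j t z - m1 * \1_(sqr sg) z + m3 / t ^+ 2).
  apply: Rintegral_ge0 => z Dz; rewrite indicE.
  have [zs|zs] := boolP (z \in sqr sg).
    rewrite mulr1 addr_ge0//; first by rewrite subr_ge0; apply: j_near => //; exact: set_mem.
    by rewrite divr_ge0 ?exprn_ge0// ltW.
  by rewrite mulr0 subr0 addrC -[m3 / _]opprK addrC subr_ge0 j_far.
rewrite e => h0.
have sg2 : sg ^+ 2 = t^-1 by rewrite exprVn sqr_sqrtr ?(ltW t0).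
have m3t : m3 / t ^+ 2 * (2 * eps) ^+ 2 <= 2 * m1 / t.
  have e4 : (2 * eps) ^+ 2 <= 4.
    by rewrite exprMn -natrX -[leRHS]mulr1 ler_wpM2l// expr_le1// ltW.
  apply: (@le_trans _ _ (m3 / t ^+ 2 * 4)).
    by rewrite ler_wpM2l// divr_ge0 ?exprn_ge0// ltW.
  have -> : m3 / t ^+ 2 * 4 = 2 / t * (2 * m3 / t) by field; exact: lt0r_neq0.
  have -> : 2 * m1 / t = 2 / t * m1 by ring.
  rewrite ler_wpM2l ?divr_ge0 ?(ltW t0)// ler_pdivrMr// [leRHS]mulrC -ler_pdivrMr//; lra.
have e5 : m1 * (2 * sg) ^+ 2 = 4 * m1 / t by rewrite exprMn sg2 -natrX; ring.
move: h0; rewrite e5 => h0.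
have e6 : 4 * m1 / t = 2 * m1 / t + 2 * m1 / t by rewrite -mulrDl; congr (_ / _); ring.
rewrite -/(j t _); lra.
Qed.

End oscillatory.

(** * Conclusion *)

Section spectral_data.
Context {R : realType} {n : nat} (Q B : 'M[R]_n).
Hypothesis pQ : posdefmx Q.
Local Notation S := (Qinf Q B).
Local Notation N0 := (S *m B^T - B *m S).

Lemma trmx_Qinf : S^T = S.
Proof.
have QT : Q^T = Q by case: pQ.
apply/matrixP => i j; rewrite !mxE; apply: eq_Rintegral => s _.
have GT : (expmx (s *: B) *m Q *m expmx (s *: B^T))^T = expmx (s *: B) *m Q *m expmx (s *: B^T).
  by rewrite !trmx_mul QT !trmx_expmx trmxK mulmxA.
by rewrite -[in RHS]GT [RHS]mxE.
Qed.

Hypothesis pS : posdefmx S.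

Let lyap : B *m S + S *m B^T = - Q. Proof. exact: lyapunov. Qed.
Let uS : S \in unitmx. Proof. exact: posdef_unit. Qed.

Lemma trmx_lyapunov_skew : N0^T = - N0.
Proof. by rewrite linearB/= !trmx_mul trmxK trmx_Qinf opprB. Qed.

Let SBT : S *m B^T = 2^-1 *: (N0 - Q).
Proof.
rewrite -lyap addrA subrK; move: (S *m B^T) => X.
by apply/matrixP => i j; rewrite !mxE; field.
Qed.

(** B^T = S^-1 (N - Q) / 2, and S^-1 Q commutes with itself, so its bracket with B^T is half its
    bracket with S^-1 N. *)
Lemma commutator_neq : bracket (invmx S *m Q) B^T != 0 ->
  Q *m invmx S *m N0 <> N0 *m invmx S *m Q.
Proof.
move=> /eqP br E; apply: br.
have BE : B^T = 2^-1 *: (invmx S *m (N0 - Q)) by rewrite scalemxAr -SBT mulKmx.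
rewrite /bracket BE -scalemxAr -scalemxAl -scalerBr; move: E; move: (N0) => W E.
have -> : invmx S *m Q *m (invmx S *m (W - Q)) =
    invmx S *m (Q *m invmx S *m W - Q *m invmx S *m Q) by rewrite !mulmxBr !mulmxA.
have -> : invmx S *m (W - Q) *m (invmx S *m Q) =
    invmx S *m (W *m invmx S *m Q - Q *m invmx S *m Q) by rewrite !(mulmxBr, mulmxBl) !mulmxA.
by rewrite E subrr scaler0.
Qed.

(** At x = 2 S p the matrix gives -Q p - 2 B S p, and -Q = B S + S B^T turns this into N p. *)
Lemma lyapunov_form p r : dot ((- 2^-1 *: (Q *m invmx S) - B) *m (2 *: (S *m p))) r = dot (N0 *m p) r.
Proof.
congr (dot _ _).
have -> : N0 = - Q - 2 *: (B *m S).
  rewrite -lyap; move: (S *m B^T) (B *m S) => X Y.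
  by apply/matrixP => i j; rewrite !mxE; ring.
rewrite -scalemxAr !mulmxBl -scalemxAl -mulmxA mulKmx// scalerBr scalerA -scalemxAl mulNmx mulmxA.
by rewrite mulrN divff// scaleN1r.
Qed.

Lemma enorm_Bset x xi : 2^-1 * enorm (sqrtmx Q *m xi) ^+ 2 +
    8^-1 * enorm (sqrtmx Q *m invmx S *m x) ^+ 2 =
  pencil_q1 Q (2^-1 *: (invmx S *m x)) xi.
Proof.
rewrite -mulmxA !(enorm_sqrtmx _ pQ) /pencil_q1 -scalemxAr dotZl dotZr.
by field.
Qed.

Lemma Bset_point (P : R -> Prop) : (exists2 y, [set Bform Q B w | w in Bset Q B] y & P y) ->
  exists p r, pencil_q1 Q p r = 1 /\ P (pencil_q2 N0 p r).
Proof.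
move=> [_ [[x xi] hB <-] Py].
exists (2^-1 *: (invmx S *m x)), xi; split; first by rewrite -enorm_Bset.
rewrite /pencil_q2 -lyapunov_form.
by have -> : 2 *: (S *m (2^-1 *: (invmx S *m x))) = x by rewrite -scalemxAr scalerA divff// scale1r mulKVmx.
Qed.

Lemma numerical_range_levels (lambda : R) : m_minus Q B < lambda < m_plus Q B ->
  (exists p r, pencil_q1 Q p r = 1 /\ lambda < pencil_q2 N0 p r) /\
  (exists p r, pencil_q1 Q p r = 1 /\ pencil_q2 N0 p r < lambda).
Proof.
rewrite /m_minus /m_plus => /andP[lo hi].
have ne : [set Bform Q B w | w in Bset Q B] !=set0.
  (* The supremum and infimum of the empty set are both 0 by convention, which would leave no room
     for lambda. *)
  apply/set0P/negP => /eqP E; move: lo hi; rewrite E sup0 inf0 => lo /(lt_trans lo).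
  by rewrite ltxx.
split; [exact: (@Bset_point (fun y => lambda < y) (sup_gt ne hi))|exact: (@Bset_point (fun y => y < lambda) (inf_lt ne lo))].
Qed.

End spectral_data.

Section expansion_links.
Context {R : realType} {n : nat} (B S : 'M[R]_n) (p r vp vr : 'cV[R]_n).

Lemma levelE t c0 s tau : level B S p r vp vr t (curvature B S p r vp vr) c0 s tau =
  t * (growth B S p r vp vr s tau + 2^-1 * (dot (S *m p) p + dot (S *m r) r)) + s * \tr B / 2 + c0.
Proof. by rewrite /level /amp /growth; field. Qed.

Lemma pair_ampE t c0 s tau : pair_amp B S p r vp vr t (curvature B S p r vp vr) c0 s tau =
  t * (overlap_amp B S p r vp vr s tau + (dot (S *m p) p + dot (S *m r) r)) + s * \tr B / 2 + c0.
Proof. by rewrite /pair_amp /overlap_amp; ring. Qed.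

Lemma nice_overlap_amp : nice (fun z : (measurableTypeR R * measurableTypeR R) * 'cV[R]_n =>
  overlap_amp B S p r vp vr z.1.1 z.1.2).
Proof.
rewrite /overlap_amp; apply: niceB; last exact: nice_cst.
apply: niceD; last first.
  apply: niceM; first exact: nice_cst.
  by apply: niceB; [apply: niceM; [apply: niceM|exact: nice_cst]|apply: niceM]; first [exact: nice_s|exact: nice_tau].
apply: niceD; (apply: nice_dot; last by move=> i; exact: nice_cst).
  by apply: nice_mulmx => i; exact: nice_orbit_re.
by apply: nice_mulmx => i; exact: nice_orbit_im.
Qed.

Lemma nice_overlap_phase lam : nice (fun z : (measurableTypeR R * measurableTypeR R) * 'cV[R]_n =>
  overlap_phase B S p r vp vr lam z.1.1 z.1.2).
Proof.
rewrite /overlap_phase.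
apply: niceD; [apply: niceB; [apply: niceD; [apply: niceB|]|]|].
- by apply: nice_dot => i; [exact: nice_cst|exact: nice_orbit_im].
- apply: nice_dot => i; [|exact: nice_cst].
  by apply: nice_mulmx => k; exact: nice_orbit_re.
- by apply: niceM; [exact: nice_cst|exact: nice_s].
- by apply: niceM; [exact: nice_cst|exact: nice_tau].
- by apply: niceM; [apply: niceM; [exact: nice_cst|exact: nice_s]|exact: nice_tau].
Qed.

End expansion_links.

(** * Exponential lower bound of the resolvent norm *)

Section resolvent_growth.
Context {R : realType} {n : nat} (Q B : 'M[R]_n) (mu : probability 'cV[R]_n R) (lambda : R).
Hypothesis pQ : posdefmx Q.
Hypothesis muS : forall A, measurable A ->
  mu A = (\int[leb R n]_(x in A) (gauss (Qinf Q B) x)%:E)%E.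
Hypothesis noncomm : bracket (invmx (Qinf Q B) *m Q) B^T != 0.
Hypothesis lam_range : m_minus Q B < lambda < m_plus Q B.
Local Notation S := (Qinf Q B).

Let ST : S^T = S. Proof. exact: trmx_Qinf. Qed.
Let pS : posdefmx S. Proof. exact: gaussian_cov_posdef ST muS. Qed.
Let lyap : B *m S + S *m B^T = - Q. Proof. exact: lyapunov. Qed.

(** The boundary level m = -4 satisfies the smallness condition of [resolvent_norm_ge], as exp(8) >=
    2^8. *)
Lemma expR8_ge128 : 128 * expR (2 * (- 4)) <= 1 :> R.
Proof.
have e1 : 2 <= expR 1 :> R by have := expR_ge1Dx (1 : R).
have -> : 2 * (- 4) = - (1 * 8%:R) :> R by ring.
rewrite expRN expRM_natr ler_pdivrMr ?exprn_gt0 ?expR_gt0// mul1r.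
apply: (@le_trans _ _ (2 ^+ 8)); last by rewrite lerXn2r ?nnegrE ?expR_ge0.
by rewrite -natrX ler_nat.
Qed.

Lemma resolvent_growth : exists k delta t1 : R, [/\ 0 < k, 0 < delta &
  forall t, t1 <= t -> ((k / t * expR (t * delta))%:E <=
    resolvent_norm mu (OU_L2 mu Q B) (- ((\tr B / 2)%:C + t%:C * (1 +i* lambda)))%R)%E].
Proof.
have QT : Q^T = Q by case: pQ.
have uS := posdef_unit pS.
have [lo hi] := numerical_range_levels pQ pS lam_range.
have [p [r [q1 q2 kpos]]] := pencil_level_k_gt0 pQ pS (trmx_lyapunov_skew B pQ)
  (commutator_neq pQ pS noncomm) lo hi.
pose vp := invmx S *m (Q *m p); pose vr := invmx S *m (Q *m r).
have Svp : S *m vp = Q *m p by rewrite mulKVmx.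
have Svr : S *m vr = Q *m r by rewrite mulKVmx.
have NE x v : S *m v = Q *m x -> (S *m B^T - B *m S) *m x = 2 *: (S *m skew_part B x v).
  move=> Sv; rewrite /skew_part mulmxDr -scalemxAr Sv mulmxBl.
  have -> : Q *m x = - (B *m S *m x + S *m B^T *m x) by rewrite -mulmxDl lyap mulNmx opprK.
  rewrite mulmxA; move: (S *m B^T *m x) (B *m S *m x) => X Y.
  by apply/matrixP => i j; rewrite !mxE; field.
have q1E : dot (Q *m p) p + dot (Q *m r) r = 2 by move: q1; rewrite /pencil_q1 => q1; lra.
have q2E : dot (S *m skew_part B p vp) r * 2 = lambda.
  by rewrite -q2 /pencil_q2 (NE _ _ Svp) dotZl mulrC.
have kE x v : S *m v = Q *m x ->
    pencil_k Q S (S *m B^T - B *m S) x = 2 * dot (S *m v) (skew_part B x v).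
  move=> Sv; rewrite /pencil_k (NE _ _ Sv) -scalemxAr mulKmx// -scalemxAr dotZl Sv.
  by rewrite dot_mull QT dotC.
(* By [kE], the sum of [pencil_k] over p and r is 4 [cross]. *)
have cr : 0 < cross B S p r vp vr.
  by move: kpos; rewrite (kE _ _ Svp) (kE _ _ Svr) /cross => kpos; lra.
have pS0 x : 0 <= dot (S *m x) x by exact: posdef_ge0.
have [eps [c [M [/andP[e0 e1] c0 M0 hb]]]] := exponent_bounds ST lyap Svp Svr QT q1E q2E pS0 cr.
have sqrb (z : measurableTypeR R * measurableTypeR R) : sqr eps z -> `|z.1| <= eps /\ `|z.2| <= eps.
  by move=> [z1 z2]; move: z1 z2; rewrite /seg/= !in_itv/= -!ler_norml.
pose T := `|\tr B|.
have hT s : `|s| <= eps -> `|s * \tr B / 2| <= T.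
  move=> hs; rewrite -mulrA normrM -[leRHS]mul1r ler_pM ?(le_trans hs)//.
  by rewrite normrM (ger0_norm (x := 2^-1))// ler_piMr// invf_le1// ler1n.
have nh : nice (fun z : (measurableTypeR R * measurableTypeR R) * 'cV[R]_n => z.1.1 * \tr B / 2).
  by apply: niceM; [apply: niceM|]; [exact: nice_s|exact: nice_cst|exact: nice_cst].
(* The three functions are independent of x, so their measurability in the parameters is read at x =
   0. The trace term does not grow with t and enters as the bounded perturbation h. *)
have [k [t1 [k0 hk]]] := oscillatory_integral_ge e0 e1 c0 M0
  (nice_slice 0 (nice_overlap_amp B S p r vp vr)) (nice_slice 0 (nice_overlap_phase B S p r vp vr lambda))
  (nice_slice 0 nh)
  (fun z Dz => let: And4 _ h _ _ := hb z.1 z.2 (proj1 (sqrb z Dz)) (proj2 (sqrb z Dz)) in h)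
  (fun z Dz => let: And4 _ _ h _ := hb z.1 z.2 (proj1 (sqrb z Dz)) (proj2 (sqrb z Dz)) in h)
  (fun z Dz => let: And4 _ _ _ h := hb z.1 z.2 (proj1 (sqrb z Dz)) (proj2 (sqrb z Dz)) in h)
  (fun z Dz => hT z.1 (proj1 (sqrb z Dz))).
(* On the sides of the square |s| + |tau| >= eps, so [growth] is at most -delta there, against 0 at
   the centre. *)
pose delta := c * eps ^+ 2.
have d0 : 0 < delta by rewrite mulr_gt0// exprn_gt0.
exists (k * expR (- T - 4)), delta, (Num.max 1 t1); split=> //; first by rewrite mulr_gt0 ?expR_gt0.
move=> t; rewrite ge_max => /andP[t1' ht].
have t0 : 0 <= t by exact: le_trans t1'.
have tp : 0 < t by exact: lt_le_trans t1'.
pose A2 := dot (S *m p) p + dot (S *m r) r.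
(* The largest normalisation these bounds allow: t delta uses up the gap at the boundary, T absorbs
   the trace term, and -4 is the level of [expR8_ge128]. *)
pose cc := t * (delta - 2^-1 * A2) - T - 4.
have edge s tau : `|s| <= eps -> `|tau| <= eps -> `|s| = eps \/ `|tau| = eps ->
    level B S p r vp vr t (curvature B S p r vp vr) cc s tau <= - 4.
  move=> hs ht' he; rewrite levelE -/A2.
  have [g _ _ _] := hb s tau hs ht'.
  have ge : eps ^+ 2 <= (`|s| + `|tau|) ^+ 2.
    rewrite lerXn2r ?nnegrE ?addr_ge0 ?(ltW e0)//.
    by case: he => ->; [rewrite lerDl|rewrite lerDr].
  have g' : growth B S p r vp vr s tau <= - delta.
    by apply: le_trans g _; rewrite mulNr lerN2 ler_wpM2l// ltW.
  have tg : t * (growth B S p r vp vr s tau + delta) <= 0.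
    by rewrite mulr_ge0_le0// -lerBrDr sub0r.
  have := hT s hs; rewrite ler_norml => /andP[_ sT].
  have -> : t * (growth B S p r vp vr s tau + 2^-1 * A2) + s * \tr B / 2 + cc =
     t * (growth B S p r vp vr s tau + delta) + (s * \tr B / 2 - T) - 4 by rewrite /cc; ring.
  lra.
have PE : pairing B S p r vp vr t lambda (curvature B S p r vp vr) cc eps =
  expR (t * A2 + cc) * \int[area]_(z in sqr eps)
   (expR (t * overlap_amp B S p r vp vr z.1 z.2 + z.1 * \tr B / 2) *
    cos (t * overlap_phase B S p r vp vr lambda z.1 z.2)).
  have nF : nice (fun z : (measurableTypeR R * measurableTypeR R) * 'cV[R]_n =>
      expR (t * overlap_amp B S p r vp vr z.1.1 z.1.2 + z.1.1 * \tr B / 2) *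
      cos (t * overlap_phase B S p r vp vr lambda z.1.1 z.1.2)).
    apply: niceM; [apply: nice_expR; apply: niceD|apply: nice_cos].
    - by apply: niceM; [exact: nice_cst|exact: nice_overlap_amp].
    - exact: nh.
    - by apply: niceM; [exact: nice_cst|exact: nice_overlap_phase].
  have mid : measurable_fun setT (@id (measurableTypeR R * measurableTypeR R)%type) by [].
  have [iF _] := sweep_has_int (measurable_sqr eps) (fin_sqr e0) mid (sqr_le1 e1) 0 nF.
  rewrite -(RintegralZl _ (measurable_sqr eps) iF); apply: eq_Rintegral => z _.
  rewrite pair_ampE mulrA -expRD; congr (expR _ * cos _).
  by rewrite -/A2 /cc; ring.
have P0 : 0 < pairing B S p r vp vr t lambda (curvature B S p r vp vr) cc eps.
  by rewrite PE mulr_gt0 ?expR_gt0// (lt_le_trans _ (hk t ht))// divr_gt0.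
apply: le_trans (resolvent_norm_ge ST muS lyap t0 e0 e1 edge expR8_ge128 P0).
rewrite lee_fin PE -/A2 [leRHS]mulrAC -expRD.
(* What survives after division by the norm exp(t A2 / 2) of the coherent state is the gap t delta,
   up to a constant. *)
have -> : t * A2 + cc + - (t / 2) * A2 = - T - 4 + t * delta by rewrite /cc; field.
have -> : k * expR (- T - 4) / t * expR (t * delta) = expR (- T - 4 + t * delta) * (k / t).
  by rewrite (expRD (- T - 4)); ring.
by apply: ler_wpM2l; [exact: expR_ge0|exact: hk].
Qed.

End resolvent_growth.

(** The term of degree N + 2 of the exponential series leaves one power of t after division by t and
    t^N. *)
Lemma expR_div_pow_cvgy {R : realType} (k delta : R) (N : nat) (A : R) : 0 < k -> 0 < delta ->
  \forall t \near +oo, A <= k / t * expR (t * delta) / t ^+ N.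
Proof.
move=> k0 d0.
pose f := (N.+2)`!%:R : R.
have f0 : 0 < f by rewrite ltr0n fact_gt0.
pose K := k * delta ^+ N.+2 / f.
have K0 : 0 < K by rewrite divr_gt0// mulr_gt0// exprn_gt0.
near=> t.
have t1 : 1 <= t by near: t; apply: nbhs_pinfty_ge; exact: num_real.
have tA : A / K <= t by near: t; apply: nbhs_pinfty_ge; exact: num_real.
have t0 : 0 < t by exact: lt_le_trans t1.
apply: (@le_trans _ _ (K * t)); first by rewrite mulrC -ler_pdivrMr.
have e : (t * delta) ^+ N.+2 / f <= expR (t * delta).
  by apply: le_trans (expR_ge1Dxn N.+1 (ltW (mulr_gt0 t0 d0))); rewrite lerDr.
apply: (@le_trans _ _ (k / t * ((t * delta) ^+ N.+2 / f) / t ^+ N)); last first.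
  by rewrite ler_wpM2r ?invr_ge0 ?exprn_ge0 ?(ltW t0)// ler_wpM2l// divr_ge0 ?ltW.
rewrite le_eqVlt; apply/orP; left; apply/eqP.
rewrite /K exprMn [t ^+ N.+2]exprS [t ^+ N.+1]exprS; field.
by rewrite ?expf_neq0 ?(lt0r_neq0 t0) ?(lt0r_neq0 f0).
Unshelve. all: by end_near.
Qed.

Theorem theorem2p4 (R : realType) (n : nat) (Q B : 'M[R]_n)
  (mu : probability 'cV[R]_n R) (lambda : R) (N : nat) :
  (0 < n)%N ->
  posdefmx Q ->
  OU_invariant Q B mu ->
  (forall A, measurable A ->
     mu A = (\int[leb R n]_(x in A) (gauss (Qinf Q B) x)%:E)%E) ->
  bracket (invmx (Qinf Q B) *m Q) B^T != 0 ->
  m_minus Q B < lambda < m_plus Q B ->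
  (fun t : R =>
     resolvent_norm mu (OU_L2 mu Q B)
       (- ((\tr B / 2)%:C + t%:C * (1 +i* lambda)))%R
     * ((t ^+ N)^-1)%:E)%E @ +oo%R --> +oo%E.
Proof.
move=> _ pQ _ muS noncomm lam_range.
have [k [delta [t1 [k0 d0 growth_t]]]] := resolvent_growth pQ muS noncomm lam_range.
apply/cvgeyPge => A; near=> t.
have t0 : 0 < t by near: t; apply: nbhs_pinfty_gt; exact: num_real.
have ht : t1 <= t by near: t; apply: nbhs_pinfty_ge; exact: num_real.
apply: (@le_trans _ _ ((k / t * expR (t * delta) / t ^+ N)%:E)).
  by rewrite lee_fin; near: t; exact: expR_div_pow_cvgy.
rewrite EFinM lee_wpmul2r ?lee_fin ?invr_ge0 ?exprn_ge0 ?(ltW t0)//.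
exact: growth_t.
Unshelve. all: by end_near.
Qed.
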